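(* Let $d\ge2$, $\gamma\in(0,\infty)^d$, $\lambda\in\mathbb{C}\setminus\{0\}$, $c_0\in(0,\infty)$, $\alpha\in(0,\infty)^d$, $\beta\in\mathbb{R}^d\setminus\{0\}$, and consider the Zakharov system $$i\partial_tu+\Delta_\alpha u=\lambda nu,\qquad \tfrac1{c_0^2}\partial_t^2n-\Delta_\alpha n=\Delta_\beta(|u|^2),\qquad (u,n,\partial_tn)|_{t=0}=(u_0,n_0,n_1)$$ on $\mathbb{T}_\gamma^d$ ($u$ complex-valued, $n$ real-valued). Let $(s,l)\in\mathbb{R}^2$ satisfy $l>\min\{2s-1,\,s+1\}$ or $l<\max\{0,\,s-2\}$. Then, for any $T>0$, the data-to-solution map of this system on smooth data cannot extend to a $C^2$ map from any neighborhood of the origin in $H^{s,l}$ into $\mathcal{C}([-T,T];H^{s,l})$. Moreover, if $d=2$ and $s<\frac32$, $l\ge0$, $l>2s-1$, then the system is ill-posed in $H^{s,l}$.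
   Context: For $\gamma\in(0,\infty)^d$, $\mathbb{T}_\gamma^d=(\mathbb{R}/2\pi\gamma_1\mathbb{Z})\times\dots\times(\mathbb{R}/2\pi\gamma_d\mathbb{Z})$, $\mathbb{Z}_\gamma^d=(\gamma_1^{-1}\mathbb{Z})\times\dots\times(\gamma_d^{-1}\mathbb{Z})$, $\widehat\varphi(k)=\int_{\mathbb{T}_\gamma^d}e^{-ik\cdot x}\varphi(x)\,dx$, $\langle k\rangle=(1+|k|^2)^{1/2}$, $\|\varphi\|_{H^s}^2=\frac1{\gamma_1\cdots\gamma_d}\sum_{k\in\mathbb{Z}_\gamma^d}\langle k\rangle^{2s}|\widehat\varphi(k)|^2$. $H^{s,l}=H^s(\mathbb{T}_\gamma^d;\mathbb{C})\times H^l(\mathbb{T}_\gamma^d;\mathbb{R})\times H^{l-1}(\mathbb{T}_\gamma^d;\mathbb{R})$ with the product norm. $(u,n)\in\mathcal{C}([-T,T];H^{s,l})$ means $u\in C([-T,T];H^s)$ and $n\in C([-T,T];H^l)\cap C^1([-T,T];H^{l-1})$. For $a\in\mathbb{R}^d$, $\Delta_a=\sum_{j=1}^da_j\partial_{x_j}^2$. The data-to-solution map is $(u_0,n_0,n_1)\mapsto(u,n)$. ''Ill-posed in $H^{s,l}$'' means that the data-to-solution map on smooth data cannot extend to a continuous map from a neighborhood of the origin in $H^{s,l}$ into $\mathcal{C}([-T,T];H^{s,l})$, for any $T>0$. *)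

(* Defs.v *)
From HB Require Import structures.
From mathcomp Require Import all_boot all_order all_algebra.
From mathcomp Require Import all_classical all_reals all_analysis.
From mathcomp Require Import complex ring lra.

Set Implicit Arguments.
Unset Strict Implicit.
Unset Printing Implicit Defensive.
Import Order.TTheory GRing.Theory Num.Theory.
Import numFieldNormedType.Exports.

Local Open Scope classical_set_scope.
Local Open Scope ring_scope.
Local Open Scope complex_scope.

(* An element of H^s(T_gamma^d) is represented by its family of Fourier
   coefficients; the frequency (m_1/gamma_1, ..., m_d/gamma_d) in Z_gamma^d is
   indexed by m in Z^d. *)
Section Sobolev.
Context {R : realType} {d : nat}.
Implicit Types (gamma : 'I_d -> {posnum R}) (m : {ffun 'I_d -> int}).

Definition freq gamma m (j : 'I_d) : R := (m j)%:~R / (gamma j)%:num.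

Definition bracket gamma m : R :=
  Num.sqrt (1 + \sum_(j < d) freq gamma m j ^+ 2).

Local Notation coefs := ({ffun 'I_d -> int} -> Rcomplex R).

Definition sobolev_sum gamma (s : R) (a : coefs) : \bar R :=
  \esum_(m in setT) (bracket gamma m `^ (2 * s) * `|a m| ^+ 2)%:E.

(* [hermitian_if b] is the condition that a distribution be real-valued when
   [b = true], and no condition when [b = false]. *)
Definition hermitian_if (b : bool) (a : coefs) : Prop :=
  b -> forall m, a (- m) = (a m)^*.

Definition sobolev_pred gamma (b : bool) (s : R) : {pred coefs} :=
  fun a => `[< (sobolev_sum gamma s a < +oo)%E /\ hermitian_if b a >].

Record sobolev gamma (b : bool) (s : R) : Type := Sobolev {
  coef :> {ffun 'I_d -> int} -> Rcomplex R;
  coefP : coef \in sobolev_pred gamma b s }.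

End Sobolev.

Section SobolevLmodule.
Context {R : realType} {d : nat}.
Variables (gamma : 'I_d -> {posnum R}) (b : bool) (s : R).
Local Notation coefs := ({ffun 'I_d -> int} -> Rcomplex R).
Local Notation S := (sobolev_sum gamma s).
Implicit Types (a c : coefs).

Lemma sobolev_predP a :
  reflect ((S a < +oo)%E /\ hermitian_if b a) (a \in sobolev_pred gamma b s).
Proof. exact: asboolP. Qed.

Lemma bracket_gt0 (m : {ffun 'I_d -> int}) : 0 < bracket gamma m.
Proof.
rewrite sqrtr_gt0 ltr_wpDr//; apply: sumr_ge0 => j _; exact: sqr_ge0.
Qed.

Lemma weight_gt0 (m : {ffun 'I_d -> int}) : 0 < bracket gamma m `^ (2 * s).
Proof. by rewrite powR_gt0// bracket_gt0. Qed.

Lemma sobolev_term_ge0 a m :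
  (0 <= (bracket gamma m `^ (2 * s) * `|a m| ^+ 2)%:E)%E.
Proof. by rewrite lee_fin mulr_ge0// powR_ge0. Qed.

Lemma sobolev_sum_ge0 a : (0 <= S a)%E.
Proof. by apply: esum_ge0 => m _; exact: sobolev_term_ge0. Qed.

Lemma ge0_esumZ (T : choiceType) (f : T -> \bar R) (k : R) : 0 <= k ->
  (forall i, 0 <= f i)%E ->
  (\esum_(i in setT) (k%:E * f i) = k%:E * \esum_(i in setT) f i)%E.
Proof.
move=> k0 f0; rewrite /esum -ereal_supZl//; last first.
  by apply/set0P; exists (\sum_(i \in set0) f i)%E, set0 => //; exact: fsets_set0.
congr ereal_sup; apply/seteqP; split => x /=.
  move=> [A AT <-]; exists (\sum_(i \in A) f i)%E; first by exists A.
  by rewrite ge0_mule_fsumr.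
by move=> [_ [A AT <-] <-]; exists A => //; rewrite ge0_mule_fsumr.
Qed.

Lemma normr_Rcomplex_scale (k : R) (z : Rcomplex R) : `|k *: z| = `|k| * `|z|.
Proof.
have nE (a c : R) : `|(a +i* c : Rcomplex R)| = Num.sqrt (a ^+ 2 + c ^+ 2) by [].
have sE (x y : R) :
  k *: (x +i* y : Rcomplex R) = ((k * x) +i* (k * y) : Rcomplex R) by [].
case: z => x y; rewrite sE !nE.
by rewrite !exprMn -mulrDr sqrtrM ?sqr_ge0// sqrtr_sqr.
Qed.

Lemma sobolev_sumZ (k : R) a : S (k *: a) = ((k ^+ 2)%:E * S a)%E.
Proof.
rewrite /sobolev_sum -ge0_esumZ ?sqr_ge0//; last exact: sobolev_term_ge0.
apply: eq_esum => m _; rewrite -EFinM; congr EFin.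
rewrite [(k *: a) m]/(k *: a m) normr_Rcomplex_scale exprMn.
by rewrite real_normK ?num_real// mulrCA.
Qed.

(* weighted form of |x + y|^2 <= (1 + e) |x|^2 + (1 + 1/e) |y|^2 *)
Lemma sobolev_sumD (e : R) a c : 0 < e ->
  (S (a + c)%R <= (1 + e)%:E * S a + (1 + e^-1)%:E * S c)%E.
Proof.
move=> e0; have ei0 : 0 < e^-1 by rewrite invr_gt0.
have e1 : 0 <= 1 + e by rewrite addr_ge0// ltW.
have ei1 : 0 <= 1 + e^-1 by rewrite addr_ge0// ltW.
rewrite /sobolev_sum -!ge0_esumZ//; try exact: sobolev_term_ge0.
rewrite -esumD; last 2 first.
- by move=> m _; rewrite mule_ge0 ?sobolev_term_ge0// lee_fin addr_ge0// ltW.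
- by move=> m _; rewrite mule_ge0 ?sobolev_term_ge0// lee_fin addr_ge0// ltW.
apply: le_esum => m _; rewrite -!EFinM -EFinD lee_fin.
rewrite [leRHS](_ : _ = bracket gamma m `^ (2 * s) *
  ((1 + e) * `|a m| ^+ 2 + (1 + e^-1) * `|c m| ^+ 2)); last first.
  by rewrite mulrDr; congr (_ + _); rewrite mulrCA.
rewrite ler_pM2l ?weight_gt0//.
apply: (@le_trans _ _ ((`|a m| + `|c m|) ^+ 2)).
  rewrite ler_sqr ?nnegrE ?addr_ge0//.
  exact: (@ler_normD R (Rcomplex R)).
set x := `|a m|; set y := `|c m|.
rewrite -subr_ge0 [leRHS](_ : _ = e^-1 * (e * x - y) ^+ 2); last first.
  by field; rewrite gt_eqF.
by rewrite mulr_ge0 ?sqr_ge0// ltW.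
Qed.

Lemma conjc_linear (k : R) (z w : Rcomplex R) :
  (k *: z + w)^* = k *: (z^* : Rcomplex R) + (w^* : Rcomplex R).
Proof.
have sE (x y : R) :
  k *: (x +i* y : Rcomplex R) = ((k * x) +i* (k * y) : Rcomplex R) by [].
case: z w => [x y] [x' y'] /=; rewrite sE.
by apply: congr2; [|rewrite opprD mulrN].
Qed.

Lemma sobolev_submod_closed : submod_closed (sobolev_pred gamma b s).
Proof.
split.
  apply/sobolev_predP; split; last first.
    by move=> _ m; rewrite [RHS](_ : _ = 0)//; exact: raddf0.
  rewrite -[X in sobolev_sum _ _ X](scale0r (0 : coefs)) sobolev_sumZ.
  by rewrite expr0n/= mul0e ltry.
move=> k a c /sobolev_predP[fa ha] /sobolev_predP[fc hc].
apply/sobolev_predP; split.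
  apply: (le_lt_trans (@sobolev_sumD 1 (k *: a) c ltr01)).
  rewrite sobolev_sumZ; apply: lte_add_pinfty.
    rewrite lte_mul_pinfty ?lee_fin ?addr_ge0//.
    by rewrite lte_mul_pinfty ?lee_fin ?sqr_ge0.
  by rewrite lte_mul_pinfty ?lee_fin ?addr_ge0// invr_ge0.
move=> b1 m.
rewrite [LHS]/(k *: a (- m) + c (- m)) (ha b1) (hc b1).
exact/esym/conjc_linear.
Qed.

HB.instance Definition _ :=
  GRing.isSubmodClosed.Build R coefs (sobolev_pred gamma b s)
    sobolev_submod_closed.

HB.instance Definition _ := [isSub for @coef R d gamma b s].
HB.instance Definition _ := [Choice of sobolev gamma b s by <:].
HB.instance Definition _ :=
  [SubChoice_isSubLmodule of sobolev gamma b s by <:].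

Implicit Types f g : sobolev gamma b s.

Definition sobolev_norm f : R :=
  Num.sqrt ((\prod_(j < d) (gamma j)%:num)^-1 * fine (S f)).

Lemma sobolev_fin f : S f = (fine (S f))%:E.
Proof.
have /sobolev_predP[ffin _] := coefP f.
by rewrite fineK// ge0_fin_numE// sobolev_sum_ge0.
Qed.

Lemma gprod_gt0 : 0 < (\prod_(j < d) (gamma j)%:num)^-1.
Proof. by rewrite invr_gt0; apply: prodr_gt0. Qed.

Lemma coefD f g : coef (f + g) = (f : coefs) + (g : coefs).
Proof. exact: (@raddfD _ _ (val : sobolev gamma b s -> coefs)). Qed.

Lemma coefZ (k : R) f : coef (k *: f) = k *: (f : coefs).
Proof. exact: (@linearZZ R _ _ (val : sobolev gamma b s -> coefs)). Qed.

Lemma sobolev_normZ (k : R) f : sobolev_norm (k *: f) = `|k| * sobolev_norm f.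
Proof.
rewrite /sobolev_norm coefZ sobolev_sumZ sobolev_fin /= mulrCA.
by rewrite sqrtrM ?sqr_ge0// sqrtr_sqr.
Qed.

Lemma sobolev_norm_sqr f :
  sobolev_norm f ^+ 2 = (\prod_(j < d) (gamma j)%:num)^-1 * fine (S f).
Proof.
by rewrite sqr_sqrtr// mulr_ge0 ?(ltW gprod_gt0)// fine_ge0// sobolev_sum_ge0.
Qed.

Lemma sobolev_norm_eq0 f : sobolev_norm f = 0 -> f = 0.
Proof.
move=> f0; have := sobolev_norm_sqr f; rewrite f0 expr0n/= => /esym/eqP.
rewrite mulf_eq0 gt_eqF ?gprod_gt0//= => /eqP Sf0.
apply: val_inj; rewrite raddf0; apply/funext => m.
have : ((bracket gamma m `^ (2 * s) * `|f m| ^+ 2)%:E <= S f)%E.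
  apply: esum_ge; exists [set m]; first by split.
  by rewrite fsbig_set1.
rewrite sobolev_fin Sf0 lee_fin pmulr_rle0 ?weight_gt0// => fm0.
have : `|f m| ^+ 2 == 0 by rewrite eq_le fm0 sqr_ge0.
by rewrite sqrf_eq0 => /eqP; exact: normr0_eq0.
Qed.

Lemma sobolev_normD f g : sobolev_norm (f + g) <= sobolev_norm f + sobolev_norm g.
Proof.
have p0 : 0 <= sobolev_norm f by exact: sqrtr_ge0.
have q0 : 0 <= sobolev_norm g by exact: sqrtr_ge0.
have [/eqP/sobolev_norm_eq0->|p1] := boolP (sobolev_norm f == 0).
  by rewrite add0r lerDr sqrtr_ge0.
have [/eqP/sobolev_norm_eq0->|q1] := boolP (sobolev_norm g == 0).
  by rewrite addr0 lerDl sqrtr_ge0.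
have pp : 0 < sobolev_norm f by rewrite lt_neqAle eq_sym p1.
have qp : 0 < sobolev_norm g by rewrite lt_neqAle eq_sym q1.
rewrite -ler_sqr ?nnegrE ?addr_ge0 ?sqrtr_ge0//.
have e0 : 0 < sobolev_norm g / sobolev_norm f by rewrite divr_gt0.
have := sobolev_sumD f g e0.
rewrite -coefD (sobolev_fin f) (sobolev_fin g) (sobolev_fin (f + g)).
rewrite -!EFinM -EFinD lee_fin => le1.
rewrite sobolev_norm_sqr; apply: (le_trans (ler_wpM2l (ltW gprod_gt0) le1)).
rewrite mulrDr ![_^-1 * (_ * _)]mulrCA -!sobolev_norm_sqr invf_div.
rewrite le_eqVlt; apply/orP; left; apply/eqP.
by field; rewrite p1 q1.
Qed.

HB.instance Definition _ :=
  Lmodule_isNormed.Build R (sobolev gamma b s)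
    sobolev_normD sobolev_normZ sobolev_norm_eq0.

End SobolevLmodule.

Section SobolevInclusion.
Context {R : realType} {d : nat} {gamma : 'I_d -> {posnum R}} {b : bool}.

Lemma sobolev_pred_sub (s s' : R) : s' <= s ->
  {subset sobolev_pred gamma b s <= sobolev_pred gamma b s'}.
Proof.
move=> ss' a /sobolev_predP[fa ha]; apply/sobolev_predP; split => //.
apply: le_lt_trans fa; apply: le_esum => m _; rewrite lee_fin.
apply: ler_wpM2r; first exact: sqr_ge0.
rewrite ler_powR ?ler_pM2l//.
rewrite /bracket -[leLHS]sqrtr1 ler_wsqrtr// lerDl.
by apply: sumr_ge0 => j _; exact: sqr_ge0.
Qed.

Lemma subr1_le (s : R) : s - 1 <= s.
Proof. by rewrite gerBl. Qed.

Definition sobolev_incl (s : R) (f : sobolev gamma b s) :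
    sobolev gamma b (s - 1) :=
  Sobolev (sobolev_pred_sub (subr1_le s) (coefP f)).

End SobolevInclusion.

(* C([-T, T]; X) with the supremum norm; a path on [-T, T] is represented by
   its extension by zero to the real line. *)
Section Paths.
Context {R : realType} (T : R) (X : normedModType R).

Definition path_pred : {pred R -> X} :=
  fun f => `[< (forall t, t \notin `[- T, T] -> f t = 0) /\
               {within `[- T, T], continuous f} >].

Record cpath : Type := CPath { pathfun :> R -> X; pathP : pathfun \in path_pred }.

Lemma path_predP (f : R -> X) :
  reflect ((forall t, t \notin `[- T, T] -> f t = 0) /\
           {within `[- T, T], continuous f}) (f \in path_pred).
Proof. exact: asboolP. Qed.

Lemma path_submod_closed : submod_closed path_pred.
Proof.
split.
  by apply/path_predP; split => // x; exact: cst_continuous.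
move=> k f g /path_predP[f0 fc] /path_predP[g0 gc]; apply/path_predP; split.
  move=> t tT; rewrite [LHS]/(k *: f t + g t) f0// g0// scaler0.
  exact: addr0.
move=> x; apply: (@cvgD _ _ _ (nbhs x) _ (k \*: f) g); last exact: gc.
by apply: cvgZl_tmp; exact: fc.
Qed.

HB.instance Definition _ :=
  GRing.isSubmodClosed.Build R (R -> X) path_pred path_submod_closed.

HB.instance Definition _ := [isSub for pathfun].
HB.instance Definition _ := [Choice of cpath by <:].
HB.instance Definition _ := [SubChoice_isSubLmodule of cpath by <:].

Implicit Types f g : cpath.

Definition path_norm f : R := sup [set `|f t| | t in `[- T, T]].

Lemma pathD f g : pathfun (f + g) = (f : R -> X) + (g : R -> X).
Proof. exact: (@raddfD _ _ (val : cpath -> (R -> X))). Qed.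

Lemma pathZ (k : R) f : pathfun (k *: f) = k *: (f : R -> X).
Proof. exact: (@linearZZ R _ _ (val : cpath -> (R -> X))). Qed.

Lemma path_has_ubound f : has_ubound [set `|f t| | t in `[- T, T]].
Proof.
have /path_predP[_ fc] := pathP f.
have [M [_ hM]] := compact_bounded (continuous_compact fc (@segment_compact _ _ _)).
exists (M + 1) => _ [t tT <-].
by apply: (hM (M + 1)); [rewrite ltrDl|exists t].
Qed.

Lemma le_path_norm f t : `|f t| <= path_norm f.
Proof.
have [tT|tT] := boolP (t \in `[- T, T]).
  by apply: ub_le_sup; [exact: path_has_ubound|exists t].
have /path_predP[f0 _] := pathP f; rewrite f0// normr0.
have [ne|/set0P/negP/negPn/eqP E] := pselect ([set `|f t| | t in `[- T, T]] !=set0).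
  have [_ [t' t'T _]] := ne.
  by apply: (@le_trans _ _ `|f t'|) => //; apply: ub_le_sup;
    [exact: path_has_ubound|exists t'].
by rewrite /path_norm E sup0.
Qed.

Lemma path_norm_le f (M : R) : 0 <= M -> (forall t, `|f t| <= M) ->
  path_norm f <= M.
Proof.
move=> M0 fM; rewrite /path_norm.
have [ne|/set0P/negP/negPn/eqP E] := pselect ([set `|f t| | t in `[- T, T]] !=set0).
  by apply: ge_sup => // _ [t _ <-].
by rewrite E sup0.
Qed.

Lemma path_norm_ge0 f : 0 <= path_norm f.
Proof. exact: le_trans (normr_ge0 _) (le_path_norm f 0). Qed.

Lemma path_normD f g : path_norm (f + g) <= path_norm f + path_norm g.
Proof.
apply: path_norm_le; first by rewrite addr_ge0 ?path_norm_ge0.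
move=> t; rewrite pathD; apply: (le_trans (ler_normD _ _)).
by rewrite lerD ?le_path_norm.
Qed.

Let path_normZ_le (k : R) f : path_norm (k *: f) <= `|k| * path_norm f.
Proof.
apply: path_norm_le; first by rewrite mulr_ge0 ?path_norm_ge0.
by move=> t; rewrite pathZ normrZ ler_wpM2l ?le_path_norm.
Qed.

Lemma path_normZ (k : R) f : path_norm (k *: f) = `|k| * path_norm f.
Proof.
apply/eqP; rewrite eq_le path_normZ_le/=.
have [->|k0] := eqVneq k 0; first by rewrite normr0 mul0r path_norm_ge0.
have := path_normZ_le k^-1 (k *: f); rewrite scalerA mulVf// scale1r.
by rewrite normfV ler_pdivlMl ?normr_gt0.
Qed.

Lemma path_norm_eq0 f : path_norm f = 0 -> f = 0.
Proof.
move=> f0; apply: val_inj; rewrite raddf0; apply/funext => t.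
by apply/eqP; rewrite -normr_le0 -f0 le_path_norm.
Qed.

HB.instance Definition _ :=
  Lmodule_isNormed.Build R cpath path_normD path_normZ path_norm_eq0.

End Paths.

Section Smoothness.
Context {R : realType} {V : normedModType R}.

Definition iter_derive (vs : seq V) (f : V -> R) : V -> R :=
  foldr (fun v g => 'D_v g) f vs.

(* f is of class C^oo on the open set A *)
Definition smooth_on (A : set V) (f : V -> R) : Prop :=
  forall (vs : seq V) (x : V), A x ->
    {for x, continuous (iter_derive vs f)} /\
    forall v, derivable (iter_derive vs f) x v.

Definition csmooth_on (A : set V) (f : V -> R[i]) : Prop :=
  smooth_on A (fun x => complex.Re (f x)) /\
  smooth_on A (fun x => complex.Im (f x)).

Definition cderive (v : V) (f : V -> R[i]) : V -> R[i] :=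
  fun x => 'D_v (fun y => complex.Re (f y)) x
           +i* 'D_v (fun y => complex.Im (f y)) x.

End Smoothness.

(* F is of class C^2, in the sense of Frechet, on the open set U: F is
   differentiable, its differential is differentiable for the operator norm,
   with derivative D2, and D2 is continuous for the norm of bounded bilinear
   maps. *)
Definition C2_on {R : realType} {V W : normedModType R}
    (U : set V) (F : V -> W) : Prop :=
  exists D2 : V -> V -> V -> W, forall x, U x ->
    [/\ differentiable F x,
        (forall h, linear (D2 x h)) /\ (forall k, linear (D2 x ^~ k)),
        exists M : R, forall h k, `|D2 x h k| <= M * `|h| * `|k|,
        forall e : R, 0 < e -> \forall h \near (0 : V), forall k,
          `|'d F (x + h) k - 'd F x k - D2 x h k| <= e * `|h| * `|k| &
        forall e : R, 0 < e -> \forall y \near x, forall h k,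
          `|D2 y h k - D2 x h k| <= e * `|h| * `|k| ].

Section Torus.
Context {R : realType} {d : nat} (gamma : 'I_d -> {posnum R}).

(* functions on T_gamma^d are functions on R^d with period 2 pi gamma_j in the
   j-th variable *)
Definition torus_periodic {A : Type} (f : 'rV[R]_d -> A) : Prop :=
  forall (j : 'I_d) x, f (x + (2 * pi * (gamma j)%:num) *: 'e_j) = f x.

End Torus.

(* iterated integral over [0, L_0] x ... x [0, L_(d-1)] *)
Fixpoint box_integral {R : realType} {d : nat} :
    ('I_d -> R) -> ('rV[R]_d -> R) -> R :=
  match d with
  | 0 => fun _ f => f 0
  | d'.+1 => fun L f =>
      \int[lebesgue_measure]_(t in `[0, L ord0])
        box_integral (fun j => L (lift ord0 j))
          (fun y : 'rV[R]_d' => f (row_mx (t%:M : 'rV[R]_1) y))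
  end.

Section Zakharov.
Context {R : realType} {d : nat} (gamma : 'I_d -> {posnum R}).
Implicit Types (a alpha beta : 'I_d -> R).

Definition torus_integral (f : 'rV[R]_d -> R[i]) : R[i] :=
  let L j := 2 * pi * (gamma j)%:num in
  box_integral L (fun x => complex.Re (f x))
  +i* box_integral L (fun x => complex.Im (f x)).

Definition fourier (f : 'rV[R]_d -> R[i]) (m : {ffun 'I_d -> int}) : R[i] :=
  torus_integral (fun x =>
    let theta := \sum_(j < d) freq gamma m j * x ord0 j in
    (cos theta -i* sin theta) * f x).

Definition rfourier (f : 'rV[R]_d -> R) : {ffun 'I_d -> int} -> R[i] :=
  fourier (fun x => (f x)%:C).

Definition data_space (s l : R) : normedModType R :=
  (sobolev gamma false s * sobolev gamma true l *
   sobolev gamma true (l - 1))%type.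

(* (u, n, m) with u in C([-T,T]; H^s), n in C([-T,T]; H^l) and
   m in C([-T,T]; H^(l-1)) *)
Definition path_space (T s l : R) : normedModType R :=
  (cpath T (sobolev gamma false s) * cpath T (sobolev gamma true l) *
   cpath T (sobolev gamma true (l - 1)))%type.

(* n belongs to C^1([-T,T]; H^(l-1)), with time derivative m *)
Definition time_derivative (T l : R) (n : cpath T (sobolev gamma true l))
    (m : cpath T (sobolev gamma true (l - 1))) : Prop :=
  forall t, t \in `[- T, T] ->
    (t' - t)^-1 *: (sobolev_incl (n t') - sobolev_incl (n t))
      @[t' --> within `[- T, T] t^'] --> m t.

(* The closed subspace C([-T,T]; H^{s,l}) of path_space: (u, n) is represented
   by (u, n, dn/dt). *)
Definition solution_space (T s l : R) : set (path_space T s l) :=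
  [set z | time_derivative z.1.2 z.2].

Local Notation spacetime := (R * 'rV[R]_d)%type.

Definition dir_t : spacetime := (1, 0).
Definition dir_x (j : 'I_d) : spacetime := (0, 'e_j).

Definition laplacian a (f : spacetime -> R) (p : spacetime) : R :=
  \sum_(j < d) a j * 'D_(dir_x j) ('D_(dir_x j) f) p.

Definition claplacian a (f : spacetime -> R[i]) (p : spacetime) : R[i] :=
  \sum_(j < d) (a j)%:C * cderive (dir_x j) (cderive (dir_x j) f) p.

Definition smooth_data (u0 : 'rV[R]_d -> R[i]) (n0 n1 : 'rV[R]_d -> R) : Prop :=
  [/\ csmooth_on setT u0, smooth_on setT n0, smooth_on setT n1 &
      [/\ torus_periodic gamma u0, torus_periodic gamma n0 & torus_periodic gamma n1]].

(* (u, n) is a smooth solution on [-T, T] x T_gamma^d; smoothness up to the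
   times -T and T means that u and n are the restrictions of smooth functions
   on a neighborhood ]-T', T'[ x T_gamma^d. *)
Definition zakharov_solution (lambda : R[i]) (c0 : R) alpha beta (T : R)
    (u0 : 'rV[R]_d -> R[i]) (n0 n1 : 'rV[R]_d -> R)
    (u : spacetime -> R[i]) (n : spacetime -> R) : Prop :=
  [/\ exists2 T', T < T' &
        [/\ csmooth_on [set p | `|p.1| < T'] u,
            smooth_on [set p | `|p.1| < T'] n &
            forall t, `|t| < T' ->
              torus_periodic gamma (fun x => u (t, x)) /\
              torus_periodic gamma (fun x => n (t, x))],
      forall t x, t \in `[- T, T] ->
        'i%C * cderive dir_t u (t, x) + claplacian alpha u (t, x) =
        lambda * (n (t, x))%:C * u (t, x),
      forall t x, t \in `[- T, T] ->
        (c0 ^+ 2)^-1 * 'D_dir_t ('D_dir_t n) (t, x) - laplacian alpha n (t, x) =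
        laplacian beta (fun p => Normc.normc (u p) ^+ 2) (t, x) &
      forall x, [/\ u (0, x) = u0 x, n (0, x) = n0 x & 'D_dir_t n (0, x) = n1 x]].

(* On U, F takes values in C([-T,T]; H^{s,l}) and coincides with the
   data-to-solution map on the smooth data in U for which the latter is defined,
   i.e. which admit a smooth solution on [-T, T]. *)
Definition extends_flow (lambda : R[i]) (c0 : R) alpha beta (T s l : R)
    (U : set (data_space s l)) (F : data_space s l -> path_space T s l) : Prop :=
  (forall z, U z -> solution_space (F z)) /\
  forall u0 n0 n1 u n z, U z ->
    smooth_data u0 n0 n1 ->
    zakharov_solution lambda c0 alpha beta T u0 n0 n1 u n ->
    [/\ coef z.1.1 = fourier u0, coef z.1.2 = rfourier n0 &
        coef z.2 = rfourier n1] ->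
    forall t, t \in `[- T, T] ->
      coef ((F z).1.1 t) = fourier (fun x => u (t, x)) /\
      coef ((F z).1.2 t) = rfourier (fun x => n (t, x)).

Definition flow_extends_C2 (lambda : R[i]) (c0 : R) alpha beta (T s l : R) :=
  exists (U : set (data_space s l)) (F : data_space s l -> path_space T s l),
    [/\ open_nbhs 0 U, extends_flow lambda c0 alpha beta U F & C2_on U F].

Definition flow_extends_continuous (lambda : R[i]) (c0 : R) alpha beta
    (T s l : R) :=
  exists (U : set (data_space s l)) (F : data_space s l -> path_space T s l),
    [/\ open_nbhs 0 U, extends_flow lambda c0 alpha beta U F &
        forall z, U z -> {for z, continuous F}].

Definition ill_posed (lambda : R[i]) (c0 : R) alpha beta (s l : R) : Prop :=
  forall T, 0 < T -> ~ flow_extends_continuous lambda c0 alpha beta T s l.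

End Zakharov.

(* Main.v *)
(* Write n = Re z, so that the wave equation becomes first order,
   z_t = - i Om(D) z - i c0^2 (b / Om)(D) |u|^2, where Om and b are the symbols of
   c0 (- Delta_alpha)^(1/2) and - Delta_beta. For trigonometric polynomials as
   data, the Duhamel formula expands (u, z) into a series graded by the number of
   interactions; its a-th term is a trigonometric polynomial with frequencies at
   most (a + 1) kap and size O(|t| / rho)^a, so for small data the series converges,
   with all its derivatives, to a smooth solution on [-T, T] whose terms with at
   most one interaction are explicit.
   Let k_N = 2 N e_1 + e_2 with beta_1 <> 0. For p_N = - N e_1 + P e_2 with P ~ N
   well chosen, om(p + k) - om(p) = Om(k) + O(1), where om is the symbol of
   - Delta_alpha: the interactions (p, k) -> p + k and (p, p + k) -> k are resonant
   and their Duhamel integrals grow linearly in t. For p = 0 they are nonresonant,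
   of size 1 / N^2. A C^2 extension of the flow would bound the second-order terms
   by the square of the norm of the data; the four exponent conditions contradict
   this bound as N -> oo, for the wave output or the Schroedinger output of the
   resonant or of the nonresonant interaction. For l >= 0 and l > 2 s - 1, the data
   u_0 = A (e_p + e_(p+k)), n_0 = n_1 = 0 with A = eps N^(-(l+1)/2) tends to 0 in
   H^s, while the mode k of n stays of size eps^2 in H^l, the cubic remainder being
   smaller by a factor eps. *)
Require Import Defs.
From mathcomp Require Import all_boot all_order all_algebra.
From mathcomp Require Import all_classical all_reals all_analysis.
From mathcomp Require Import complex ring lra zify.
Set Implicit Arguments.
Unset Strict Implicit.
Unset Printing Implicit Defensive.
Import Order.TTheory GRing.Theory Num.Theory.
Import numFieldNormedType.Exports.
Local Open Scope classical_set_scope.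
Local Open Scope ring_scope.
Local Open Scope complex_scope.
Import Normc.

(** * Calculus and geometric sequences *)

(** [extends_flow] constrains an extension only along smooth solutions that live on all of [-T, T].
    Such solutions must therefore be produced, with a remainder explicit in the size and the
    frequency of the data. The obstacle is a loss of one derivative: the multiplier b / Om of the
    wave source has order one. Frequencies at most (a + 1) kap after a interactions make this loss
    harmless, because the time integration brings a factor 1 / (a + 1) which absorbs it. What is
    left is a pair of quadratic inequalities for sums of moduli of coefficients, closed on a time
    scale rho for which |lambda| rho B and kap rho A^2 / B are small; the remainder after one
    interaction is then (t / rho)^2 times a multiple of A or B. The observed modes are absent from
    the data, so the linear part of the flow does not reach them, and a second difference at 0, e h,
    2 e h isolates the quadratic term. *)

Section RealCalculus.
Context {R : realType}.
Implicit Types (f g : R -> R).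

Lemma is_derive_continuous f (x df : R) : is_derive x 1 f df -> {for x, continuous f}.
Proof.
by move=> fd; apply/differentiable_continuous/derivable1_diffP; case: fd.
Qed.

Lemma within_is_derive_continuous f (df : R -> R) (a b : R) :
  (forall x, x \in `[a, b] -> is_derive x 1 f (df x)) ->
  {within `[a, b], continuous f}.
Proof.
move=> fd; apply: continuous_in_subspaceT => x.
by rewrite inE => xab; apply: is_derive_continuous (fd x xab).
Qed.

Lemma is_derive_le (f df g dg : R -> R) (a b : R) : a <= b ->
  (forall x, x \in `[a, b] -> is_derive x 1 f (df x)) ->
  (forall x, x \in `[a, b] -> is_derive x 1 g (dg x)) ->
  (forall x, x \in `[a, b] -> df x <= dg x) ->
  f b - f a <= g b - g a.
Proof.
move=> ab fd gd le; rewrite -subr_ge0.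
have hd x : x \in `[a, b] -> is_derive x 1 (g - f) (dg x - df x).
  by move=> xab; have := fd x xab; have := gd x xab => ? ?; exact: is_deriveB.
have hc : {within `[a, b], continuous (g - f)}.
  exact: (@within_is_derive_continuous _ (fun x => dg x - df x)).
have hd' x : x \in `]a, b[ -> is_derive x 1 (g - f) ((fun y => dg y - df y) x).
  by move=> /subset_itv_oo_cc; exact: hd.
have [c cab E] := MVT_segment ab hd' hc.
move: E; rewrite /= !fctE => E.
have -> : g b - g a - (f b - f a) = g b - f b - (g a - f a) by ring.
by rewrite E mulr_ge0 ?subr_ge0 ?le.
Qed.

Lemma is_derive0_cst f (a b x y : R) :
  (forall z : R, z \in `[a, b] -> is_derive z 1 f 0) ->
  x \in `[a, b] -> y \in `[a, b] -> f x = f y.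
Proof.
move=> fd; wlog xy : x y / x <= y => [H|] xab yab.
  by have [/H|/ltW /H] := leP x y; [exact|move=> ->].
have fd' z : z \in `[x, y] -> is_derive z 1 f ((fun=> 0) z).
  move=> zxy; apply: fd; move: xab yab zxy; rewrite !in_itv/=.
  by move=> /andP[? ?] /andP[? ?] /andP[? ?]; apply/andP; split; lra.
have cd z : z \in `[x, y] -> is_derive z 1 (fun=> 0 : R) ((fun=> 0) z).
  by move=> _; exact: is_derive_cst.
have h1 := is_derive_le xy fd' cd (fun=> fun=> lexx _).
have h2 := is_derive_le xy cd fd' (fun=> fun=> lexx _).
by apply/eqP; rewrite eq_sym -subr_eq0 eq_le; apply/andP; split; lra.
Qed.

(** The fundamental theorem of calculus is applied from the left endpoint -n; subtracting the value
    at 0 normalises the primitive. *)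
Lemma ex_primitive_on f (n : R) : 0 < n -> continuous f ->
  exists2 G : R -> R, G 0 = 0 & forall t : R, - n < t -> t < n -> is_derive t 1 G (f t).
Proof.
move=> n0 fc.
have fi : lebesgue_measure.-integrable `[-n, n] (EFin \o f).
  apply: continuous_compact_integrable; first exact: segment_compact.
  exact: continuous_subspaceT.
pose G t := \int[lebesgue_measure]_(s in `[-n, t]) f s.
exists (fun t => G t - G 0) => [|t nt tn]; first by rewrite subrr.
have [Gd GE] := continuous_FTC1_closed tn fi nt (fc t).
rewrite -[f t]subr0; apply: is_deriveB.
by apply: DeriveDef; [exact: Gd|rewrite -derive1E].
Qed.

(** Primitives vanishing at 0 on larger and larger intervals agree where both are defined, by
    [is_derive0_cst]. The value at t is read off the one on the interval of half-length trunc |t| +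
    1. *)
Lemma ex_primitive f : continuous f ->
  exists2 G : R -> R, G 0 = 0 & forall t : R, is_derive t 1 G (f t).
Proof.
move=> fc.
have n0 (n : nat) : 0 < n.+1%:R :> R by [].
pose H n := s2val (cid2 (ex_primitive_on (n0 n) fc)).
have H0 n : H n 0 = 0 by rewrite /H; case: cid2.
have Hd n (t : R) : - n.+1%:R < t -> t < n.+1%:R -> is_derive t 1 (H n) (f t).
  by rewrite /H; case: cid2 => G G0 Gd; exact: Gd.
have HE m n (t : R) : (n <= m)%N -> - n.+1%:R < t -> t < n.+1%:R -> H m t = H n t.
  move=> nm nt tn; apply/eqP; rewrite -subr_eq0; apply/eqP.
  have nmR : n.+1%:R <= m.+1%:R :> R by rewrite ler_nat ltnS.
  have t0 : `|t| < n.+1%:R by rewrite ltr_norml nt.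
  have -> : 0 = (H m - H n) 0 by rewrite !fctE !H0 subrr.
  apply: (@is_derive0_cst (H m - H n) (- `|t|) `|t|).
  - move=> z; rewrite in_itv/= => /andP[z1 z2].
    rewrite -[0](subrr (f z)).
    by apply: is_deriveB; apply: Hd; lra.
  - by rewrite in_itv/= -ler_norml.
  - by rewrite in_itv/= normr_ge0 andbT oppr_le0.
pose G t := H (Num.trunc `|t|) t.
exists G => [|t]; first by rewrite /G H0.
(* One index more than t requires, so that a single function [H m] serves on a whole neighbourhood
   of t. *)
pose m := (Num.trunc `|t|).+1.
have tm : `|t| < m%:R by rewrite /m truncnS_gt.
have : is_derive t 1 (H m) (f t).
  apply: Hd; have := ltr_norml t m%:R; rewrite tm => /esym/andP[? ?].
    by rewrite -natr1; lra.
  by rewrite -natr1; lra.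
apply: near_eq_is_derive.
have : \forall y \near t, `|y| < m%:R.
  have cn : {for t, continuous (fun y : R => `|y|)} by exact: norm_continuous.
  exact: (cn _ (lt_nbhsl tm)).
apply: filterS => y ym; rewrite /G.
have yt : `|y| < (Num.trunc `|y|).+1%:R by rewrite truncnS_gt.
have := ltr_norml y (Num.trunc `|y|).+1%:R; rewrite yt => /esym/andP[? ?].
apply: HE => //.
have : (Num.trunc `|y| < m)%N by rewrite truncn_lt_nat.
by move/ltnW.
Qed.

Definition prim f : R -> R :=
  xget (fun=> 0) [set G | G 0 = 0 /\ forall t : R, is_derive t 1 G (f t)].

Lemma prim_spec f : continuous f ->
  prim f 0 = 0 /\ forall t : R, is_derive t 1 (prim f) (f t).
Proof.
move=> /ex_primitive[G G0 Gd]; rewrite /prim.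
by case: xgetP => [P -> //|/(_ G)] []; split.
Qed.

(** Comparison with the primitives of M x^a and -M x^a. The gain 1 / (a + 1) is essential: it pays
    later for the growth of the frequencies. *)
Lemma primitive_pow_le (G g : R -> R) (M : R) (a : nat) : G 0 = 0 ->
  (forall t : R, is_derive t 1 G (g t)) ->
  (forall t, `|g t| <= M * `|t| ^+ a) ->
  forall t, `|G t| <= M / a.+1%:R * `|t| ^+ a.+1.
Proof.
move=> G0 Gd gM t.
have pd (k x : R) : is_derive x 1 (fun y => k / a.+1%:R * y ^+ a.+1) (k * x ^+ a).
  have -> : (fun y => k / a.+1%:R * y ^+ a.+1) =
      (k / a.+1%:R) \*: ((@id R) ^+ a.+1).
    by apply/funext => y; rewrite !fctE.
  apply: is_derive_eq; rewrite /= /GRing.scale/= mulr1 mulrA.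
  by rewrite divfK// pnatr_eq0.
wlog t0 : t G g G0 Gd gM / 0 <= t => [H|].
  have [|/ltW t0] := leP 0 t; first exact: H.
  have := H (- t) (fun x => G (- x)) (fun x => - g (- x)).
  rewrite oppr0 opprK normrN; apply => // [x|x|]; last by rewrite oppr_ge0.
    have -> : - g (- x) = g (- x) * (-1) by rewrite mulrN1.
    exact: (@is_derive1_comp _ G -%R x _ _ (Gd (- x)) (is_deriveNid x 1)).
  by rewrite normrN -[in leRHS]normrN gM.
have gM' x : x \in `[0, t] -> - (M * x ^+ a) <= g x <= M * x ^+ a.
  rewrite in_itv/= => /andP[x0 _].
  by have := gM x; rewrite (ger0_norm x0) ler_norml.
rewrite (ger0_norm t0) ler_norml.
have h1 := @is_derive_le G g (fun y => M / a.+1%:R * y ^+ a.+1) (fun x => M * x ^+ a) 0 t t0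
  (fun x _ => Gd x) (fun x _ => pd M x) (fun x xt => proj2 (andP (gM' x xt))).
have h2 := @is_derive_le (fun y => (- M) / a.+1%:R * y ^+ a.+1) (fun x => - M * x ^+ a) G g 0 t t0
  (fun x _ => pd (- M) x) (fun x _ => Gd x).
have h2' x : x \in `[0, t] -> - M * x ^+ a <= g x.
  by move=> xt; rewrite mulNr; have /andP[] := gM' x xt.
have {h2 h2'} := h2 h2'; move: h1; rewrite G0 expr0n /= !mulr0 !subr0 => h1 h2.
by rewrite h1 andbT -!mulNr.
Qed.

End RealCalculus.

(** * Geometrically decaying sequences and their Cauchy products *)

Section GeometricSeries.
Context {R : realType}.
Implicit Types (u v : nat -> R).

(** Geometric decay, rather than mere summability, survives multiplication by powers of a + 1, which
    is the price of derivatives of the expansion. *)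
Definition geo u := exists C th : R, [/\ 0 <= C, 0 < th, th < 1 &
  forall a, `|u a| <= C * th ^+ a].

Lemma geo_le u v (K : R) : geo u -> (forall a, `|v a| <= K * `|u a|) -> geo v.
Proof.
move=> [C [th [C0 th0 th1 h]]] vu; exists (`|K| * C), th; split=> //.
  by rewrite mulr_ge0.
move=> a; apply: (le_trans (vu a)); rewrite -mulrA.
apply: (@le_trans _ _ (`|K| * `|u a|)); first by rewrite ler_wpM2r// ler_norm.
by rewrite ler_wpM2l.
Qed.

Lemma geo2 u v : geo u -> geo v -> exists C th : R, [/\ 0 <= C, 0 < th, th < 1 &
  forall a, `|u a| <= C * th ^+ a /\ `|v a| <= C * th ^+ a].
Proof.
move=> [C [th [C0 th0 th1 h]]] [C' [th' [C0' th0' th1' h']]].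
exists (Num.max C C'), (Num.max th th'); split.
- by rewrite le_max C0.
- by rewrite lt_max th0.
- by rewrite gt_max th1 th1'.
have mono (c t : R) a : 0 <= c -> 0 < t -> c <= Num.max C C' ->
    t <= Num.max th th' -> c * t ^+ a <= Num.max C C' * Num.max th th' ^+ a.
  move=> c0 t0 cC tt; apply: ler_pM => //; first by rewrite exprn_ge0// ltW.
  by apply: lerXn2r => //; rewrite nnegrE ltW// (lt_le_trans t0).
move=> a; split; [apply: (le_trans (h a))|apply: (le_trans (h' a))];
  by apply: mono => //; rewrite le_max lexx ?orbT.
Qed.

Lemma geoD u v : geo u -> geo v -> geo (fun a => u a + v a).
Proof.
move=> gu gv; have [C [th [C0 th0 th1 h]]] := geo2 gu gv.
exists (C + C), th; split=> //; first by rewrite addr_ge0.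
move=> a; apply: (le_trans (ler_normD _ _)); rewrite mulrDl.
by have [? ?] := h a; rewrite lerD.
Qed.

(* Bernoulli: with r = th' / th > 1, a + 1 is at most a multiple of r ^ a. *)
Lemma geoS u : geo u -> geo (fun a => a.+1%:R * u a).
Proof.
move=> [C [th [C0 th0 th1 h]]].
pose th' := (1 + th) / 2; pose r := th' / th.
have th'0 : 0 < th' by rewrite /th'; lra.
have r1 : 0 < r - 1 by rewrite subr_gt0 /r ltr_pdivlMr// mul1r /th'; lra.
have bern a : 1 + a%:R * (r - 1) <= r ^+ a.
  elim: a => [|a IH]; first by rewrite expr0 mul0r addr0.
  rewrite exprS -natr1.
  have : r * (1 + a%:R * (r - 1)) <= r * r ^+ a by rewrite ler_wpM2l//; lra.
  apply: le_trans; rewrite -subr_ge0.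
  rewrite (_ : _ - _ = a%:R * (r - 1) ^+ 2); last by ring.
  by rewrite mulr_ge0// sqr_ge0.
pose D := 1 + (r - 1)^-1.
have D0 : 0 <= D by rewrite addr_ge0// invr_ge0 ltW.
exists (D * C), th'; split=> //; [by rewrite mulr_ge0|by rewrite /th'; lra|].
move=> a; rewrite normrM ger0_norm//.
have rE : th' ^+ a = r ^+ a * th ^+ a.
  by rewrite -exprMn /r divfK// gt_eqF.
have aD : a.+1%:R <= D * r ^+ a.
  apply: (@le_trans _ _ (D * (1 + a%:R * (r - 1)))); last by rewrite ler_wpM2l.
  rewrite -natr1 /D mulrDl mul1r.
  have -> : (r - 1)^-1 * (1 + a%:R * (r - 1)) = (r - 1)^-1 + a%:R.
    by rewrite mulrDr mulr1 mulrCA mulVf ?mulr1// gt_eqF.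
  have : 0 <= a%:R * (r - 1) by rewrite mulr_ge0// ltW.
  have : 0 < (r - 1)^-1 by rewrite invr_gt0.
  lra.
rewrite rE mulrACA; apply: ler_pM => //.
Qed.

(** With a common ratio th, each of the n + 1 products is at most C^2 th^n, and [geoS] absorbs the
    factor n + 1. *)
Lemma geo_conv u v : geo u -> geo v ->
  geo (fun n => \sum_(b < n.+1) u b * v (n - b)%N).
Proof.
move=> gu gv; have [C [th [C0 th0 th1 h]]] := geo2 gu gv.
have : geo (fun a => a.+1%:R * (C * C * th ^+ a)).
  apply: geoS; exists (C * C), th; split=> //; first by rewrite mulr_ge0.
  by move=> a; rewrite ger0_norm// !mulr_ge0// exprn_ge0// ltW.
move=> g1; apply: (@geo_le _ _ 1 g1).
move=> n; rewrite mul1r [leRHS]ger0_norm; last first.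
  by rewrite !mulr_ge0// exprn_ge0// ltW.
apply: (le_trans (ler_norm_sum _ _ _)).
rewrite (_ : _ * _ = \sum_(b < n.+1) C * C * th ^+ n); last first.
  by rewrite sumr_const card_ord [LHS]mulr_natl.
apply: ler_sum => b _; rewrite normrM.
have bn : (b <= n)%N by rewrite -ltnS.
have -> : th ^+ n = th ^+ b * th ^+ (n - b) by rewrite -exprD subnKC.
rewrite mulrACA.
by apply: ler_pM => //; have [] := h b; have [] := h (n - b)%N.
Qed.

Lemma geo_is_cvg u : geo u -> cvgn (series u).
Proof.
move=> [C [th [C0 th0 th1 h]]]; apply: normed_cvg.
apply: (@series_le_cvg _ _ (geometric C th)) => // [n|n|].
- exact: normr_ge0.
- by rewrite /geometric/= mulr_ge0// exprn_ge0// ltW.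
- by apply: is_cvg_geometric_series; rewrite ger0_norm// ltW.
Qed.

Lemma geo_cvg0 u : geo u -> u n @[n --> \oo] --> 0.
Proof. by move=> /geo_is_cvg; exact: cvg_series_cvg_0. Qed.

Definition rsum u : R := limn (series u).

Lemma rsum_cvg u : geo u -> series u n @[n --> \oo] --> rsum u.
Proof. exact: geo_is_cvg. Qed.

Lemma rsum_unique u (x : R) : series u n @[n --> \oo] --> x -> rsum u = x.
Proof. by move=> h; apply/cvg_lim => //; exact: Rhausdorff. Qed.

Lemma rsumD u v : geo u -> geo v ->
  rsum (fun a => u a + v a) = rsum u + rsum v.
Proof.
move=> gu gv; apply: rsum_unique.
rewrite (_ : series _ = series u \+ series v); last first.
  by apply/funext => n; rewrite /series/= big_split.
by apply: cvgD; exact: rsum_cvg.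
Qed.

Lemma rsumZ u (k : R) : geo u -> rsum (fun a => k * u a) = k * rsum u.
Proof.
move=> gu; apply: rsum_unique.
rewrite (_ : series _ = fun n => k * series u n); last first.
  by apply/funext => n; rewrite /series/= mulr_sumr.
by apply: cvgM; [exact: cvg_cst|exact: rsum_cvg].
Qed.

Lemma rsum0 : rsum (fun=> 0) = 0.
Proof.
apply: rsum_unique; rewrite (_ : series _ = fun=> 0); first exact: cvg_cst.
by apply/funext => n; rewrite /series/= big1.
Qed.

Lemma geo_shift u : geo u -> geo (fun a => u a.+1).
Proof.
move=> [C [th [C0 th0 th1 h]]]; exists C, th; split => // a.
apply: (le_trans (h _)); rewrite exprS ler_wpM2l//.
by rewrite ler_piMl ?exprn_ge0 // ltW.
Qed.

Lemma rsum_recl u : geo u -> rsum u = u 0%N + rsum (fun a => u a.+1).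
Proof.
move=> gu; apply: rsum_unique; rewrite -cvg_shiftS /=.
rewrite (_ : (fun n => _) = fun n => u 0%N + series (fun a => u a.+1) n).
  by apply: cvgD; [exact: cvg_cst|apply: rsum_cvg; exact: geo_shift].
by apply/funext => n; rewrite /series/= big_nat_recl.
Qed.

Lemma rsum_norm_le u (M : R) : geo u ->
  (forall n, \sum_(a < n) `|u a| <= M) -> `|rsum u| <= M.
Proof.
move=> gu h.
have c : `|series u n| @[n --> \oo] --> `|rsum u|.
  exact: cvg_norm (rsum_cvg gu).
rewrite -(cvg_lim (@Rhausdorff _) c); apply: limr_le; first exact: cvgP c.
near=> n; rewrite /series/= big_mkord; apply: le_trans (h n).
exact: ler_norm_sum.
Unshelve. all: by end_near. Qed.

Lemma rsum_geometric_le u (C th : R) : 0 <= C -> 0 < th -> th < 1 ->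
  (forall a, `|u a| <= C * th ^+ a) -> `|rsum u| <= C / (1 - th).
Proof.
move=> C0 th0 th1 h; have d0 : 0 < 1 - th by lra.
apply: rsum_norm_le; first by exists C, th; split.
move=> n; apply: (@le_trans _ _ (\sum_(a < n) C * th ^+ a)).
  by apply: ler_sum => a _.
rewrite -mulr_sumr ler_wpM2l//.
have := subrX1 th n; set S := \sum_(i < n) _ => E.
rewrite -[leRHS]mul1r ler_pdivlMr//.
have -> : S * (1 - th) = 1 - th ^+ n by rewrite -[RHS]opprB E; ring.
by rewrite gerBl exprn_ge0// ltW.
Qed.

(** The triangle of indices covered by the first n Cauchy terms, summed along the rows of fixed
    b. *)
Lemma series_conv u v n :
  series (fun n => \sum_(b < n.+1) u b * v (n - b)%N) n =
  \sum_(b < n) u b * series v (n - b)%N.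
Proof.
pose V n := \sum_(0 <= c < n) v c.
have V0 : V 0%N = 0 by rewrite /V big_geq.
rewrite -[RHS]/(\sum_(b < n) u b * V (n - b)%N).
elim: n => [|n IH]; first by rewrite /series/= big_nil big_ord0.
rewrite seriesSr IH.
rewrite [RHS](_ : _ = \sum_(b < n.+1) (u b * V (n - b)%N + u b * v (n - b)%N)).
  rewrite big_split/=; congr (_ + _).
  by rewrite [RHS]big_ord_recr/= subnn V0 mulr0 addr0.
apply: eq_bigr => b _; rewrite -mulrDr; congr (_ * _).
have bn : (b <= n)%N by rewrite -ltnS.
by rewrite subSn// /V big_nat_recr.
Qed.

Lemma rsum_conv u v : geo u -> geo v ->
  rsum (fun n => \sum_(b < n.+1) u b * v (n - b)%N) = rsum u * rsum v.
Proof.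
move=> gu gv; have [C [th [C0 th0 th1 h]]] := geo2 gu gv.
pose V n := \sum_(0 <= c < n) v c.
have convE := series_conv u v.
(* The two partial sums differ by b terms, each at most C th^(n - b). *)
have Vd n b : (b <= n)%N -> `|V n - V (n - b)%N| <= b%:R * (C * th ^+ (n - b)).
  elim: b => [|b IH] bn; first by rewrite subn0 subrr normr0 mul0r.
  have bn' : (b < n)%N by [].
  have -> : V n - V (n - b.+1)%N = V n - V (n - b)%N + v (n - b.+1)%N.
    rewrite -(subnSK bn') /V big_nat_recr//=; ring.
  apply: (le_trans (ler_normD _ _)); rewrite -natr1 mulrDl mul1r lerD//.
    apply: (le_trans (IH (ltnW bn))).
    rewrite ler_wpM2l// ler_wpM2l// ler_wiXn2l ?(ltW th0) ?(ltW th1)//.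
    by rewrite leq_sub2l.
  by have [] := h (n - b.+1)%N.
(* [W n] is the part of the square of indices outside the triangle. It is at most n^2 C^2 th^n,
   hence tends to 0. *)
pose W n := series u n * series v n -
   series (fun n => \sum_(b < n.+1) u b * v (n - b)%N) n.
have W0 : W n @[n --> \oo] --> 0.
  apply: geo_cvg0.
  have : geo (fun a => a.+1%:R * (a.+1%:R * (C * C * th ^+ a))).
    do 2 apply: geoS; exists (C * C), th; split=> //; first by rewrite mulr_ge0.
    by move=> a; rewrite ger0_norm// !mulr_ge0// exprn_ge0// ltW.
  move=> g1; apply: (@geo_le _ _ 1 g1).
  move=> n; rewrite mul1r [leRHS]ger0_norm; last first.
    by rewrite !mulr_ge0// exprn_ge0// ltW.
  rewrite /W convE {1}/series/= big_mkord mulr_suml -sumrB.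
  apply: (le_trans (ler_norm_sum _ _ _)).
  apply: (@le_trans _ _ (\sum_(b < n) n%:R * (C * C * th ^+ n))).
    apply: ler_sum => b _; rewrite -mulrBr normrM.
    have bn : (b <= n)%N by rewrite ltnW.
    apply: (@le_trans _ _ (C * th ^+ b * (n%:R * (C * th ^+ (n - b))))).
      apply: ler_pM => //; first by have [] := h b.
      apply: (le_trans (Vd _ _ bn)); rewrite ler_wpM2r ?ler_nat//.
      by rewrite mulr_ge0// exprn_ge0// ltW.
    have -> : th ^+ n = th ^+ b * th ^+ (n - b) by rewrite -exprD subnKC.
    rewrite le_eqVlt; apply/orP; left; apply/eqP; ring.
  rewrite sumr_const card_ord -[leLHS]mulr_natl.
  have p0 : 0 <= C * C * th ^+ n by rewrite !mulr_ge0// exprn_ge0// ltW.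
  have nn : n%:R <= n.+1%:R :> R by rewrite ler_nat.
  by apply: ler_pM => //; [by rewrite mulr_ge0|by apply: ler_wpM2r].
apply: rsum_unique.
rewrite (_ : series _ = fun n => series u n * series v n - W n); last first.
  by apply/funext => n; rewrite /W; ring.
rewrite -[X in _ --> X]subr0; apply: cvgB => //.
by apply: cvgM; exact: rsum_cvg.
Qed.

Lemma sum_conv_le u v n : (forall a, 0 <= u a) -> (forall a, 0 <= v a) ->
  \sum_(a < n) \sum_(b < a.+1) u b * v (a - b)%N <=
  (\sum_(a < n) u a) * (\sum_(a < n) v a).
Proof.
move=> u0 v0; have := series_conv u v n; rewrite /series/= big_mkord => ->.
rewrite mulr_suml; apply: ler_sum => b _; rewrite ler_wpM2l// -(big_mkord predT v).
rewrite [leRHS](@big_cat_nat _ _ _ (n - b)%N)//= ?leq_subr// lerDl.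
exact: sumr_ge0.
Qed.

End GeometricSeries.

Section Complexes.
Context {R : realType}.
Local Notation C := R[i].
Implicit Types (z w : C).

Lemma Re_D z w : complex.Re (z + w) = complex.Re z + complex.Re w.
Proof. by case: z; case: w. Qed.
Lemma Im_D z w : complex.Im (z + w) = complex.Im z + complex.Im w.
Proof. by case: z; case: w. Qed.
Lemma Re_M z w : complex.Re (z * w) =
  complex.Re z * complex.Re w - complex.Im z * complex.Im w.
Proof. by case: z; case: w. Qed.
Lemma Im_M z w : complex.Im (z * w) =
  complex.Re z * complex.Im w + complex.Im z * complex.Re w.
Proof. by case: z; case: w. Qed.
Lemma Re_J z : complex.Re z^*%C = complex.Re z. Proof. by case: z. Qed.
Lemma Im_J z : complex.Im z^*%C = - complex.Im z. Proof. by case: z. Qed.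
Lemma Re_sum (I : Type) (r : seq I) (P : pred I) (F : I -> C) :
  complex.Re (\sum_(i <- r | P i) F i) = \sum_(i <- r | P i) complex.Re (F i).
Proof. by apply: (big_morph _ Re_D). Qed.
Lemma Im_sum (I : Type) (r : seq I) (P : pred I) (F : I -> C) :
  complex.Im (\sum_(i <- r | P i) F i) = \sum_(i <- r | P i) complex.Im (F i).
Proof. by apply: (big_morph _ Im_D). Qed.

Lemma complex_eq z w :
  complex.Re z = complex.Re w -> complex.Im z = complex.Im w -> z = w.
Proof. by case: z; case: w => a b c e /= -> ->. Qed.

Lemma normcE_sqr z : normc z ^+ 2 = complex.Re z ^+ 2 + complex.Im z ^+ 2.
Proof. by case: z => a b /=; rewrite sqr_sqrtr// addr_ge0 ?sqr_ge0. Qed.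

Lemma normc_ge0 z : 0 <= normc z.
Proof. by case: z => a b; exact: sqrtr_ge0. Qed.

Lemma Re_le_normc z : `|complex.Re z| <= normc z.
Proof.
rewrite -ler_sqr ?nnegrE ?normc_ge0// normcE_sqr real_normK ?num_real//.
by rewrite lerDl sqr_ge0.
Qed.

Lemma Im_le_normc z : `|complex.Im z| <= normc z.
Proof.
rewrite -ler_sqr ?nnegrE ?normc_ge0// normcE_sqr real_normK ?num_real//.
by rewrite lerDr sqr_ge0.
Qed.

Lemma normc_le_ReIm z : normc z <= `|complex.Re z| + `|complex.Im z|.
Proof.
rewrite -ler_sqr ?nnegrE ?normc_ge0// ?addr_ge0// normcE_sqr.
rewrite sqrrD !real_normK ?num_real// lerD2r lerDl mulrn_wge0//.
Qed.

Lemma normc_conj z : normc z^*%C = normc z.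
Proof. by case: z => a b /=; rewrite sqrrN. Qed.

Lemma normc_sum (I : Type) (r : seq I) (P : pred I) (F : I -> C) :
  normc (\sum_(i <- r | P i) F i) <= \sum_(i <- r | P i) normc (F i).
Proof.
elim/big_ind2: _ => [|z a w b za wb|//]; first by rewrite normc0.
by apply: (le_trans (le_normcD _ _)); rewrite lerD.
Qed.

Lemma normc_real (x : R) : normc x%:C = `|x|.
Proof. by rewrite /= expr0n/= addr0 sqrtr_sqr. Qed.

Lemma normc_i : normc ('i%C : C) = 1.
Proof. by rewrite /= expr0n/= add0r expr1n sqrtr1. Qed.

Lemma normc_eq0 z : (normc z == 0) = (z == 0).
Proof.
apply/eqP/eqP => [/eq0_normc//|->]; exact: normc0.
Qed.

Lemma realCM (x y : R) : (x * y)%:C = x%:C * y%:C. Proof. exact: rmorphM. Qed.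

Definition cis (x : R) : C := cos x +i* sin x.

Lemma cis0 : cis 0 = 1. Proof. by rewrite /cis cos0 sin0. Qed.
Lemma cisD x y : cis (x + y) = cis x * cis y.
Proof.
rewrite /cis cosD sinD; apply: complex_eq; rewrite ?Re_M ?Im_M//=.
by rewrite addrC; congr (_ + _); rewrite mulrC.
Qed.
Lemma cisN x : cis (- x) = (cis x)^*%C. Proof. by rewrite /cis cosN sinN. Qed.
Lemma normc_cis x : normc (cis x) = 1.
Proof. by rewrite /= cos2Dsin2 sqrtr1. Qed.
Lemma cis_pi2 (k : int) x : cis (x + 2 * pi * k%:~R) = cis x.
Proof.
have nat_case (n : nat) y : cis (y + 2 * pi * n%:R) = cis y.
  elim: n y => [|n IH] y; first by rewrite mulr0 addr0.
  rewrite -[n.+1%:R]natr1 mulrDr mulr1 addrA cisD IH -cisD.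
  by rewrite mulr_natl /cis cosD2pi sinD2pi.
case: k => n; first exact: nat_case.
rewrite NegzE rmorphN/= mulrN -[in RHS](subrK (2 * pi * n.+1%:R) x).
by rewrite nat_case.
Qed.

End Complexes.

(** * Complex functions of time, their derivatives and Duhamel integrals *)

Section TimeFunctions.
Context {R : realType}.
Local Notation C := R[i].
Implicit Types (f g : R -> C).

Definition cdiff f (t : R) : Prop :=
  derivable (fun s => complex.Re (f s)) t 1 /\
  derivable (fun s => complex.Im (f s)) t 1.

Definition dc f : R -> C := fun t =>
  ('D_1 (fun s => complex.Re (f s)) t : R) +i* ('D_1 (fun s => complex.Im (f s)) t : R).

Definition cD f (t : R) (z : C) : Prop :=
  is_derive t 1 (fun s => complex.Re (f s)) (complex.Re z) /\
  is_derive t 1 (fun s => complex.Im (f s)) (complex.Im z).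

Lemma cD_diff f t z : cD f t z -> cdiff f t.
Proof. by case=> [[d1 _] [d2 _]]; exact: conj d1 d2. Qed.
Lemma cD_val f t z : cD f t z -> dc f t = z.
Proof. by case=> [[_ h1] [_ h2]]; rewrite /dc h1 h2; exact: complex_eq. Qed.
Lemma cdiffP f t : cdiff f t -> cD f t (dc f t).
Proof. by case=> h1 h2; exact: conj (DeriveDef h1 erefl) (DeriveDef h2 erefl). Qed.

Lemma cDD f g t z w : cD f t z -> cD g t w -> cD (fun s => f s + g s) t (z + w).
Proof.
move=> [f1 f2] [g1 g2]; split.
  rewrite Re_D (_ : (fun s => _) = (fun s => complex.Re (f s)) + (fun s => complex.Re (g s))).
    exact: is_deriveD.
  by apply/funext => s; rewrite Re_D.
rewrite Im_D (_ : (fun s => _) = (fun s => complex.Im (f s)) + (fun s => complex.Im (g s))).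
  exact: is_deriveD.
by apply/funext => s; rewrite Im_D.
Qed.

Lemma cDM f g t z w : cD f t z -> cD g t w ->
  cD (fun s => f s * g s) t (z * g t + f t * w).
Proof.
move=> [f1 f2] [g1 g2]; split.
  rewrite (_ : (fun s => _) = (fun s => complex.Re (f s)) * (fun s => complex.Re (g s))
     - (fun s => complex.Im (f s)) * (fun s => complex.Im (g s))).
    apply: is_derive_eq (is_deriveB (is_deriveM f1 g1) (is_deriveM f2 g2)) _.
    rewrite /GRing.scale/= Re_D !Re_M; ring.
  by apply/funext => s; rewrite Re_M.
rewrite (_ : (fun s => _) = (fun s => complex.Re (f s)) * (fun s => complex.Im (g s))
   + (fun s => complex.Im (f s)) * (fun s => complex.Re (g s))).
  apply: is_derive_eq (is_deriveD (is_deriveM f1 g2) (is_deriveM f2 g1)) _.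
  rewrite /GRing.scale/= Im_D !Im_M; ring.
by apply/funext => s; rewrite Im_M.
Qed.

Lemma cDcst (k : C) t : cD (fun=> k) t 0.
Proof. by split; exact: is_derive_cst. Qed.

Lemma cDJ f t z : cD f t z -> cD (fun s => (f s)^*%C) t z^*%C.
Proof.
move=> [f1 f2]; split.
  by rewrite Re_J (_ : (fun s => _) = fun s => complex.Re (f s))//; apply/funext => s; rewrite Re_J.
rewrite Im_J (_ : (fun s => _) = - (fun s => complex.Im (f s))); first exact: is_deriveN.
by apply/funext => s; rewrite Im_J.
Qed.

Lemma cDcis (k : R) (a : R) t : cD (fun s => cis (k * s + a)) t ((0 +i* k) * cis (k * t + a)).
Proof.
have h : is_derive t 1 (fun s => k * s + a) k.
  rewrite (_ : (fun s => _) = k \*: (@id R) + cst a); last first.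
    by apply/funext => s; rewrite !fctE.
  by apply: is_derive_eq; rewrite addr0 /GRing.scale/= mulr1.
split.
  rewrite (_ : (fun s => _) = cos \o (fun s => k * s + a))//.
  have h' := is_derive_cos (k * t + a).
  apply: is_derive_eq; rewrite Re_M/=; ring.
rewrite (_ : (fun s => _) = sin \o (fun s => k * s + a))//.
have h' := is_derive_sin (k * t + a).
apply: is_derive_eq; rewrite Im_M/=; ring.
Qed.

Lemma eq_cD f g t z w : cD f t z -> f =1 g -> z = w -> cD g t w.
Proof. by move=> + /funext <- <-. Qed.

(** [smn r] provides r + 1 derivatives: already [smn 0] asks for differentiability. *)
Fixpoint smn (r : nat) f : Prop :=
  (forall t, cdiff f t) /\ (if r is r'.+1 then smn r' (dc f) else True).

Definition csmooth f := forall r, smn r f.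

Lemma smnW r f : smn r.+1 f -> smn r f.
Proof. by elim: r f => [|r IH] f [h1 h2]; split=> //; exact: IH. Qed.

Lemma smn0 r f : smn r f -> forall t, cdiff f t.
Proof. by case: r => [|r] []. Qed.

Lemma dcD f g : (forall t, cdiff f t) -> (forall t, cdiff g t) ->
  dc (fun s => f s + g s) = (fun s => dc f s + dc g s).
Proof. by move=> hf hg; apply/funext => t; apply/cD_val/cDD; exact: cdiffP. Qed.

Lemma dcM f g : (forall t, cdiff f t) -> (forall t, cdiff g t) ->
  dc (fun s => f s * g s) = (fun s => dc f s * g s + f s * dc g s).
Proof. by move=> hf hg; apply/funext => t; apply/cD_val/cDM; exact: cdiffP. Qed.

Lemma dcJ f : (forall t, cdiff f t) -> dc (fun s => (f s)^*%C) = (fun s => (dc f s)^*%C).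
Proof. by move=> hf; apply/funext => t; apply/cD_val/cDJ/cdiffP. Qed.

Lemma dc_cst (k : C) : dc (fun=> k) = fun=> 0.
Proof. by apply/funext => t; apply/cD_val/cDcst. Qed.

Lemma smnD r f g : smn r f -> smn r g -> smn r (fun s => f s + g s).
Proof.
elim: r f g => [|r IH] f g [f0 f1] [g0 g1].
  by split=> [t|]; [exact: cD_diff (cDD (cdiffP (f0 t)) (cdiffP (g0 t)))|exact: I].
split=> [t|]; first exact: cD_diff (cDD (cdiffP (f0 t)) (cdiffP (g0 t))).
by rewrite (dcD f0 g0); exact: IH.
Qed.

Lemma smnM r f g : smn r f -> smn r g -> smn r (fun s => f s * g s).
Proof.
elim: r f g => [|r IH] f g hf hg; have f0 := smn0 hf; have g0 := smn0 hg.
  by split=> [t|]; [exact: cD_diff (cDM (cdiffP (f0 t)) (cdiffP (g0 t)))|exact: I].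
split=> [t|]; first exact: cD_diff (cDM (cdiffP (f0 t)) (cdiffP (g0 t))).
by rewrite (dcM f0 g0); exact: smnD (IH _ _ hf.2 (smnW hg)) (IH _ _ (smnW hf) hg.2).
Qed.

Lemma smnJ r f : smn r f -> smn r (fun s => (f s)^*%C).
Proof.
elim: r f => [|r IH] f [f0 f1].
  by split=> [t|]; [exact: cD_diff (cDJ (cdiffP (f0 t)))|exact: I].
split=> [t|]; first exact: cD_diff (cDJ (cdiffP (f0 t))).
by rewrite (dcJ f0); exact: IH.
Qed.

Lemma smn_cst r (k : C) : smn r (fun=> k).
Proof.
elim: r k => [|r IH] k; split=> [t|]; do ?[exact: cD_diff (cDcst _ _)|exact: I].
rewrite dc_cst; exact: IH.
Qed.

Lemma smn_cis r (k a : R) : smn r (fun s => cis (k * s + a)).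
Proof.
elim: r => [|r IH]; split=> [t|]; do ?[exact: cD_diff (cDcis _ _ _)|exact: I].
rewrite (_ : dc _ = fun s => (0 +i* k) * cis (k * s + a)).
  by apply: smnM => //; exact: smn_cst.
by apply/funext => t; apply/cD_val/cDcis.
Qed.

Fixpoint nmr (r : nat) f (t : R) : R :=
  normc (f t) + (if r is r'.+1 then nmr r' (dc f) t else 0).

Lemma nmr_ge0 r f t : 0 <= nmr r f t.
Proof. by elim: r f => [|r IH] f /=; rewrite addr_ge0 ?normc_ge0. Qed.

Lemma normc_le_nmr r f t : normc (f t) <= nmr r f t.
Proof. by case: r => [|r] /=; rewrite ?addr0// lerDl nmr_ge0. Qed.

Lemma nmrS r f t : nmr r f t <= nmr r.+1 f t.
Proof.
elim: r f => [|r IH] f; first by rewrite /= addr0 lerDl addr_ge0 ?normc_ge0.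
by move: (IH (dc f)) => /= h; rewrite lerD2l.
Qed.

Lemma nmr_dc r f t : nmr r (dc f) t <= nmr r.+1 f t.
Proof. by rewrite /= lerDr normc_ge0. Qed.

Lemma nmrD r f g t : smn r f -> smn r g ->
  nmr r (fun s => f s + g s) t <= nmr r f t + nmr r g t.
Proof.
elim: r f g => [|r IH] f g [f0 f1] [g0 g1] /=; rewrite ?addr0 ?le_normcD//.
rewrite dcD// addrACA lerD ?le_normcD//; exact: IH.
Qed.

Lemma nmrJ r f t : smn r f -> nmr r (fun s => (f s)^*%C) t = nmr r f t.
Proof.
elim: r f => [|r IH] f [f0 f1]; rewrite /= normc_conj// dcJ// IH//.
Qed.

(** By Leibniz, one more order replaces a product by three products, f g, f' g and f g', all
    controlled at the lower order; hence one factor 3 per order. *)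
Lemma nmrM r f g t : smn r f -> smn r g ->
  nmr r (fun s => f s * g s) t <= 3 ^+ r * nmr r f t * nmr r g t.
Proof.
elim: r f g => [|r IH] f g hf hg; have f0 := smn0 hf; have g0 := smn0 hg.
  by rewrite /= !addr0 expr0 mul1r normcM.
rewrite [nmr _ (fun s => f s * g s) _]/= dcM// normcM.
set F := nmr r.+1 f t; set G := nmr r.+1 g t.
have F0 : 0 <= F by exact: nmr_ge0.
have G0 : 0 <= G by exact: nmr_ge0.
have h3 : 0 <= 3 ^+ r :> R by rewrite exprn_ge0.
have h3' : 1 <= 3 ^+ r :> R by rewrite exprn_ege1// ler1n.
have FG0 : 0 <= F * G by rewrite mulr_ge0.
have e1 : normc (f t) * normc (g t) <= 3 ^+ r * F * G.
  rewrite -mulrA; apply: (@le_trans _ _ (1 * (F * G))); last by rewrite ler_wpM2r.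
  by rewrite mul1r; apply: ler_pM; rewrite ?normc_ge0// normc_le_nmr.
have e2 : nmr r (fun s => dc f s * g s) t <= 3 ^+ r * F * G.
  apply: (le_trans (IH _ _ _ _)); [by case: hf|exact: smnW|].
  by apply: ler_pM; rewrite ?mulr_ge0 ?nmr_ge0 ?ler_wpM2l ?nmr_dc// nmrS.
have e3 : nmr r (fun s => f s * dc g s) t <= 3 ^+ r * F * G.
  apply: (le_trans (IH _ _ _ _)); [exact: smnW|by case: hg|].
  by apply: ler_pM; rewrite ?mulr_ge0 ?nmr_ge0 ?ler_wpM2l ?nmr_dc// nmrS.
have e4 := @nmrD r (fun s => dc f s * g s) (fun s => f s * dc g s) t.
rewrite exprS.
suff : nmr r (fun s => dc f s * g s + f s * dc g s) t <= 3 ^+ r * F * G + 3 ^+ r * F * G by lra.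
apply: le_trans (lerD e2 e3).
exact: e4 (smnM hf.2 (smnW hg)) (smnM (smnW hf) hg.2).
Qed.

Lemma nmr_cstM r (k : C) f t : smn r f ->
  nmr r (fun s => k * f s) t = normc k * nmr r f t.
Proof.
elim: r f => [|r IH] f [f0 f1] /=; first by rewrite !addr0 normcM.
have kd s : cdiff (fun=> k) s by exact: cD_diff (cDcst _ _).
rewrite dcM//.
rewrite dc_cst (_ : (fun s => _) = fun s => k * dc f s).
  by rewrite IH// normcM mulrDr.
by apply/funext => s; rewrite mul0r add0r.
Qed.

Lemma cdiff_continuous f : (forall t, cdiff f t) ->
  continuous (fun s => complex.Re (f s)) /\ continuous (fun s => complex.Im (f s)).
Proof.
by move=> h; split=> t; apply/differentiable_continuous/derivable1_diffP;
  [exact: (h t).1|exact: (h t).2].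
Qed.

(* the solution y of y' = - i phi y + f, y(0) = 0 *)
Definition duh (phi : R) f : R -> C := fun t =>
  let g s := cis (phi * s + 0) * f s in
  cis (- phi * t + 0) *
  (prim (fun s => complex.Re (g s)) t +i* prim (fun s => complex.Im (g s)) t).

Lemma duh_spec (phi : R) f : (forall t, cdiff f t) ->
  duh phi f 0 = 0 /\ forall t, cD (duh phi f) t ((0 -i* phi) * duh phi f t + f t).
Proof.
move=> fd; pose g s := cis (phi * s + 0) * f s.
have gd t : cdiff g t by apply/cD_diff/cDM; [exact: cDcis|exact: cdiffP].
have [g1 g2] := cdiff_continuous gd.
have [P0 P1] := prim_spec g1; have [Q0 Q1] := prim_spec g2.
split; first by rewrite /duh P0 Q0 mulr0.
move=> t; set G := fun t => prim (fun s => complex.Re (g s)) t +i* prim (fun s => complex.Im (g s)) t.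
have GD : cD G t (g t) by split; [exact: P1|exact: Q1].
apply: eq_cD (cDM (cDcis (- phi) 0 t) GD) _ _ => //.
rewrite /duh -/G mulrA; congr (_ + _).
rewrite /g mulrA -cisD (_ : _ + _ = 0) ?cis0 ?mul1r//; ring.
Qed.

Lemma smn_duh r (phi : R) f : smn r f -> smn r (duh phi f).
Proof.
elim: r f => [|r IH] f hf; have [_ h] := duh_spec phi (smn0 hf).
  by split=> [t|]; [exact: cD_diff (h t)|exact: I].
split=> [t|]; first exact: cD_diff (h t).
rewrite (_ : dc _ = fun s => (0 -i* phi) * duh phi f s + f s).
  apply: smnD; last exact: smnW.
  by apply: smnM; [exact: smn_cst|apply: IH; exact: smnW].
by apply/funext => t; exact: cD_val.
Qed.

(** The oscillating factors have modulus 1, so the bound does not see phi. The factor 2 comes from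
    treating real and imaginary parts separately. *)
Lemma duh_le (phi M : R) (a : nat) f : (forall t, cdiff f t) ->
  (forall t, normc (f t) <= M * `|t| ^+ a) ->
  forall t, normc (duh phi f t) <= 2 * M / a.+1%:R * `|t| ^+ a.+1.
Proof.
move=> fd fM t; pose g s := cis (phi * s + 0) * f s.
have gd s : cdiff g s by apply/cD_diff/cDM; [exact: cDcis|exact: cdiffP].
have [g1 g2] := cdiff_continuous gd.
have [P0 P1] := prim_spec g1; have [Q0 Q1] := prim_spec g2.
have gM s : normc (g s) <= M * `|s| ^+ a by rewrite normcM normc_cis mul1r.
have h1 := primitive_pow_le P0 P1 (fun s => le_trans (Re_le_normc _) (gM s)) t.
have h2 := primitive_pow_le Q0 Q1 (fun s => le_trans (Im_le_normc _) (gM s)) t.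
rewrite /duh normcM normc_cis mul1r.
apply: (le_trans (normc_le_ReIm _)).
by apply: (le_trans (lerD h1 h2)); rewrite le_eqVlt; apply/orP; left; apply/eqP; ring.
Qed.

End TimeFunctions.

Arguments Normc.normc : simpl never.
Arguments cis : simpl never.
Arguments duh : simpl never.

Lemma MVT_closed {R : realType} (F F1 : R -> R) (a b : R) : a <= b ->
  (forall x : R, x \in `[a, b] -> is_derive x 1 F (F1 x)) ->
  exists2 c, c \in `[a, b] & F b - F a = F1 c * (b - a).
Proof.
move=> ab Fd; have hc := within_is_derive_continuous Fd.
have Fd' (x : R) : x \in `]a, b[ -> is_derive x 1 F (F1 x).
  by move=> /subset_itv_oo_cc; exact: Fd.
exact: (MVT_segment ab Fd' hc).
Qed.

Section RealSeries.
Context {R : realType}.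
Implicit Types (u v : nat -> R).

Lemma geoZ u (k : R) : geo u -> geo (fun a => k * u a).
Proof. by move=> gu; apply: (@geo_le _ _ _ `|k| gu) => a; rewrite normrM. Qed.

Lemma geoN u : geo u -> geo (fun a => - u a).
Proof. by move=> gu; apply: (@geo_le _ _ _ 1 gu) => a; rewrite normrN mul1r. Qed.

Lemma geoB u v : geo u -> geo v -> geo (fun a => u a - v a).
Proof. by move=> gu gv; apply: geoD => //; exact: geoN. Qed.

Lemma rsumN u : geo u -> rsum (fun a => - u a) = - rsum u.
Proof.
move=> gu; rewrite -mulN1r -rsumZ//.
by congr rsum; apply/funext => a; rewrite mulN1r.
Qed.

Lemma rsumB u v : geo u -> geo v ->
  rsum (fun a => u a - v a) = rsum u - rsum v.
Proof. by move=> gu gv; rewrite rsumD ?rsumN//; exact: geoN. Qed.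

Lemma rsum_ge0 u : geo u -> (forall a, 0 <= u a) -> 0 <= rsum u.
Proof.
move=> gu u0; rewrite /rsum; apply: limr_ge; first exact: geo_is_cvg.
by apply: nearW => n; rewrite /series/=; exact: sumr_ge0.
Qed.

End RealSeries.

(** * Complex series and termwise differentiation *)

Section ComplexSeries.
Context {R : realType}.
Local Notation C := R[i].
Implicit Types (w : nat -> C).

Definition csum w : C :=
  rsum (fun a => complex.Re (w a)) +i* rsum (fun a => complex.Im (w a)).

Definition cgeo w := geo (fun a => normc (w a)).

Lemma cgeo_Re w : cgeo w -> geo (fun a => complex.Re (w a)).
Proof.
move=> h; apply: (@geo_le _ _ _ 1 h) => a.
by rewrite mul1r (ger0_norm (normc_ge0 _)) Re_le_normc.
Qed.

Lemma cgeo_Im w : cgeo w -> geo (fun a => complex.Im (w a)).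
Proof.
move=> h; apply: (@geo_le _ _ _ 1 h) => a.
by rewrite mul1r (ger0_norm (normc_ge0 _)) Im_le_normc.
Qed.

Lemma cgeo_le w (g : nat -> R) : geo g -> (forall a, normc (w a) <= g a) -> cgeo w.
Proof.
move=> h wg; apply: (@geo_le _ _ _ 1 h) => a.
by rewrite mul1r (ger0_norm (normc_ge0 _)) (le_trans (wg a))// ler_norm.
Qed.

Lemma csumD w w' : cgeo w -> cgeo w' ->
  csum (fun a => w a + w' a) = csum w + csum w'.
Proof.
move=> h h'; apply: complex_eq; rewrite ?Re_D ?Im_D /=.
  rewrite -rsumD; [|exact: cgeo_Re|exact: cgeo_Re].
  by congr rsum; apply/funext => a; rewrite Re_D.
rewrite -rsumD; [|exact: cgeo_Im|exact: cgeo_Im].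
by congr rsum; apply/funext => a; rewrite Im_D.
Qed.

Lemma csumZ w (k : C) : cgeo w -> csum (fun a => k * w a) = k * csum w.
Proof.
move=> h; have hr := cgeo_Re h; have hi := cgeo_Im h.
apply: complex_eq; rewrite ?Re_M ?Im_M /= -!rsumZ//.
  rewrite -rsumB; [|exact: geoZ|exact: geoZ].
  by congr rsum; apply/funext => a; rewrite Re_M.
rewrite -rsumD; [|exact: geoZ|exact: geoZ].
by congr rsum; apply/funext => a; rewrite Im_M.
Qed.

Lemma csum_recl w : cgeo w -> csum w = w 0%N + csum (fun a => w a.+1).
Proof.
move=> h; apply: complex_eq; rewrite ?Re_D ?Im_D /=.
  exact: (rsum_recl (cgeo_Re h)).
exact: (rsum_recl (cgeo_Im h)).
Qed.

Lemma csum0 : csum (fun=> 0) = 0.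
Proof. by apply: complex_eq; rewrite /= rsum0. Qed.

Lemma csumJ w : cgeo w -> csum (fun a => (w a)^*%C) = (csum w)^*%C.
Proof.
move=> h; apply: complex_eq; rewrite ?Re_J ?Im_J /=.
  by congr rsum; apply/funext => a; rewrite Re_J.
rewrite -mulN1r -rsumZ; last exact: cgeo_Im.
by congr rsum; apply/funext => a; rewrite Im_J mulN1r.
Qed.

Lemma csum_conv w w' : cgeo w -> cgeo w' ->
  csum (fun n => \sum_(b < n.+1) w b * w' (n - b)%N) = csum w * csum w'.
Proof.
move=> h h'; have hr := cgeo_Re h; have hi := cgeo_Im h.
have hr' := cgeo_Re h'; have hi' := cgeo_Im h'.
apply: complex_eq; rewrite ?Re_M ?Im_M /= -!rsum_conv//.
  rewrite -rsumB; [|exact: (geo_conv hr hr')|exact: (geo_conv hi hi')].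
  congr rsum; apply/funext => a; rewrite Re_sum -sumrB.
  by apply: eq_bigr => b _; rewrite Re_M.
rewrite -rsumD; [|exact: (geo_conv hr hi')|exact: (geo_conv hi hr')].
congr rsum; apply/funext => a; rewrite Im_sum -big_split/=.
by apply: eq_bigr => b _; rewrite Im_M.
Qed.

Lemma csum_geometric_le w (K th : R) : 0 <= K -> 0 < th -> th < 1 ->
  (forall a, normc (w a) <= K * th ^+ a) -> normc (csum w) <= 2 * K / (1 - th).
Proof.
move=> K0 th0 th1 h; apply: (le_trans (normc_le_ReIm _)).
have h1 := rsum_geometric_le K0 th0 th1 (fun a => le_trans (Re_le_normc _) (h a)).
have h2 := rsum_geometric_le K0 th0 th1 (fun a => le_trans (Im_le_normc _) (h a)).
by apply: (le_trans (lerD h1 h2)); rewrite le_eqVlt; apply/orP; left; apply/eqP; ring.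
Qed.

(* Each term is approximated by its tangent up to g a * h ^ 2, so that the sum is too. *)
Lemma rsum_is_derive (f f1 f2 : nat -> R -> R) (g : nat -> R) (e : R) :
  0 < e -> geo g ->
  (forall a (h : R), `|h| < e -> is_derive h 1 (f a) (f1 a h)) ->
  (forall a (h : R), `|h| < e -> is_derive h 1 (f1 a) (f2 a h)) ->
  (forall a h, `|h| < e -> `|f a h| <= g a) ->
  (forall a h, `|h| < e -> `|f1 a h| <= g a) ->
  (forall a h, `|h| < e -> `|f2 a h| <= g a) ->
  is_derive (0 : R) (1 : R) (fun h => rsum (fun a => f a h)) (rsum (fun a => f1 a 0)).
Proof.
move=> e0 gg fd f1d fg f1g f2g.
have zero : `|0 : R| < e by rewrite normr0.
have mvt (F F1 : R -> R) (h : R) : `|h| < e ->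
    (forall s : R, `|s| < e -> is_derive s 1 F (F1 s)) ->
    exists2 c, `|c| <= `|h| & F h - F 0 = F1 c * h.
  move=> he Fd; have [h0|h0] := leP 0 h.
    have Fd' s : s \in `[0, h] -> is_derive s 1 F (F1 s).
      rewrite in_itv/= => /andP[s0 sh]; apply: Fd.
      by rewrite ger0_norm// (le_lt_trans sh)// -(ger0_norm h0).
    have [c] := MVT_closed h0 Fd'.
    rewrite in_itv/= subr0 => /andP[c0 ch] E; exists c => //.
    by rewrite !ger0_norm.
  have Fd' s : s \in `[h, 0] -> is_derive s 1 F (F1 s).
    rewrite in_itv/= => /andP[sh s0]; apply: Fd; apply: le_lt_trans he.
    by rewrite ler0_norm// ltr0_norm// lerN2.
  have [c] := MVT_closed (ltW h0) Fd'.
  rewrite in_itv/= sub0r => /andP[hc c0] E; exists c => //.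
    by rewrite ler0_norm// ltr0_norm// lerN2.
  by rewrite -opprB E mulrN opprK.
have tang a h : `|h| < e -> `|f a h - f a 0 - h * f1 a 0| <= h ^+ 2 * g a.
  move=> he; have [c ch ->] := mvt _ _ h he (fd a).
  have ce : `|c| < e by exact: le_lt_trans he.
  have [c' ch' E] := mvt _ _ c ce (f1d a).
  rewrite (mulrC h) -mulrBl E -(@real_normK _ h) ?num_real// normrM normrM mulrC expr2.
  rewrite -mulrA ler_wpM2l// [leRHS]mulrC; apply: ler_pM => //.
  by apply: f2g; apply: le_lt_trans ce.
have gdom u : (forall a, `|u a| <= g a) -> geo u.
  by move=> h; apply: (@geo_le _ _ _ 1 gg) => a; rewrite mul1r (le_trans (h a))// ler_norm.
pose F h := rsum (fun a => f a h).
have FT h : `|h| < e -> `|F h - F 0 - h * rsum (fun a => f1 a 0)| <= h ^+ 2 * rsum g.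
  move=> he.
  have gfh : geo (fun a => f a h) by apply: gdom => a; exact: fg.
  have gf0 : geo (fun a => f a 0) by apply: gdom => a; exact: fg.
  have gf1 : geo (fun a => f1 a 0) by apply: gdom => a; exact: f1g.
  rewrite /F -rsumZ// -!rsumB//; [|exact: geoB|exact: geoZ].
  rewrite -rsumZ//; apply: rsum_norm_le.
    by apply: geoB; [exact: geoB|exact: geoZ].
  move=> n; apply: (@le_trans _ _ (\sum_(a < n) h ^+ 2 * g a)).
    by apply: ler_sum => a _; exact: tang.
  have cv := rsum_cvg (geoZ (h ^+ 2) gg).
  rewrite -[leLHS](big_mkord predT (fun a => h ^+ 2 * g a)).
  apply: (nondecreasing_cvgn_le _ (cvgP _ cv)) => //.
  apply/nondecreasing_seqP => k; rewrite seriesSr lerDl mulr_ge0 ?sqr_ge0//.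
  exact: le_trans (fg k 0 zero).
pose K := rsum g; pose D := rsum (fun a => f1 a 0); rewrite -/K -/D in FT *.
have cv : h^-1 *: (F (h *: (1 : R) + 0) - F 0) @[h --> (0 : R)^'] --> (D : R).
  apply/cvgrPdist_le => /= eps eps0; near=> h.
  have h0 : h != 0 by near: h; exact: nbhs_dnbhs_neq.
  have he : `|h| < e.
    near: h; apply: dnbhs0_lt => //.
  have hK : `|h| * `|K| <= eps.
    have : `|h| < eps / (`|K| + 1).
      by near: h; apply: dnbhs0_lt; rewrite divr_gt0// ltr_wpDl.
    rewrite ltr_pdivlMr ?ltr_wpDl// mulrDr mulr1 => /ltW; apply: le_trans.
    by rewrite lerDl.
  rewrite addr0 /GRing.scale/= mulr1 distrC.
  have -> : h^-1 * (F h - F 0) - D = h^-1 * (F h - F 0 - h * D).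
    by rewrite [RHS]mulrBr mulKf.
  rewrite normrM; apply: (@le_trans _ _ (`|h^-1| * (h ^+ 2 * K))).
    by rewrite ler_wpM2l// FT.
  apply: le_trans hK; rewrite -(@real_normK _ h) ?num_real// normfV expr2 !mulrA.
  by rewrite mulVf ?mul1r ?normr_eq0// ler_wpM2l// ler_norm.
apply: (@DeriveDef _ _ _ _ _ F); first by apply/cvg_ex; exists D.
by apply: cvg_lim => //; exact: Rhausdorff.
Unshelve. all: by end_near. Qed.

Lemma is_derive_line (V : normedModType R) (f : V -> R) (x v : V) (df : R) :
  is_derive (0 : R) (1 : R) (fun h => f (h *: v + x)) df -> is_derive x v f df.
Proof.
move=> [d1 d2].
have E : (fun h : R => h^-1 *: (f ((h *: (1 : R) + 0) *: v + x) - f (0 *: v + x))) =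
         (fun h : R => h^-1 *: (f (h *: v + x) - f x)).
  by apply/funext => h; rewrite addr0 scale0r add0r [h *: 1]mulr1.
by apply: DeriveDef; [rewrite /derivable -E|rewrite -d2 /derive -E].
Qed.

End ComplexSeries.

(** * Trigonometric polynomials with time-dependent coefficients *)

Section Phases.
Context {R : realType} {d : nat} (gamma : 'I_d -> {posnum R}).
Local Notation C := R[i].
Local Notation lattice := {ffun 'I_d -> int}.
Implicit Types (m : lattice) (x y : 'rV[R]_d).

Lemma freqD m m' j : freq gamma (m + m') j = freq gamma m j + freq gamma m' j.
Proof. by rewrite /freq ffunE intrD mulrDl. Qed.

Lemma freqN m j : freq gamma (- m) j = - freq gamma m j.
Proof. by rewrite /freq ffunE mulrNz mulNr. Qed.

Definition phase m x : R := \sum_(j < d) freq gamma m j * x ord0 j.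

Lemma phaseD m m' x : phase (m + m') x = phase m x + phase m' x.
Proof. by rewrite /phase -big_split; apply: eq_bigr => j _; rewrite freqD mulrDl. Qed.

Lemma phaseN m x : phase (- m) x = - phase m x.
Proof. by rewrite /phase -sumrN; apply: eq_bigr => j _; rewrite freqN mulNr. Qed.

Lemma phase_line m x y (h : R) : phase m (h *: y + x) = phase m y * h + phase m x.
Proof.
rewrite /phase mulr_suml -big_split; apply: eq_bigr => j _.
by rewrite !mxE /=; ring.
Qed.

Lemma phase_e m j : phase m 'e_j = freq gamma m j.
Proof.
rewrite /phase (bigD1 j)//= big1 => [|i ij]; first by rewrite mxE !eqxx mulr1 addr0.
by rewrite mxE (negbTE ij) andbF mulr0.
Qed.

(** The l^1 norm of the frequency: it is subadditive, and it is dual to the maximum norm of row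
    vectors, which gives [phase_le]. *)
Definition fsize m : R := \sum_(j < d) `|freq gamma m j|.

Lemma fsize_ge0 m : 0 <= fsize m.
Proof. by apply: sumr_ge0. Qed.

Lemma fsizeD m m' : fsize (m + m') <= fsize m + fsize m'.
Proof.
rewrite /fsize -big_split; apply: ler_sum => j _; rewrite freqD.
exact: ler_normD.
Qed.

Lemma fsizeN m : fsize (- m) = fsize m.
Proof. by apply: eq_bigr => j _; rewrite freqN normrN. Qed.

Lemma coord_le_norm x j : `|x ord0 j| <= `|x|.
Proof.
rewrite [leRHS]mx_normrE.
exact: (@le_bigmax _ _ _ 0 (fun ij : 'I_1 * 'I_d => `|x ij.1 ij.2|) (ord0, j)).
Qed.

Lemma phase_le m x : `|phase m x| <= fsize m * `|x|.
Proof.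
apply: (le_trans (ler_norm_sum _ _ _)); rewrite /fsize mulr_suml.
by apply: ler_sum => j _; rewrite normrM ler_wpM2l// coord_le_norm.
Qed.

Lemma freq_le m j : `|freq gamma m j| <= fsize m.
Proof. by rewrite /fsize (bigD1 j)//= lerDl sumr_ge0. Qed.

End Phases.

(* A trigonometric polynomial with time dependent coefficients is a list of
   terms (c, M, m), read as the sum of the c(t) exp(i m . x); the real M keeps
   track of a bound for c. *)
Section TrigLists.
Context {R : realType} {d : nat} (gamma : 'I_d -> {posnum R}).
Local Notation C := R[i].
Local Notation lattice := {ffun 'I_d -> int}.
Local Notation term := ((R -> C) * R * lattice)%type.
Local Notation spacetime := (R * 'rV[R]_d)%type.
Local Notation phase := (phase gamma).
Local Notation fsize := (fsize gamma).
Implicit Types (L : seq term) (m : lattice) (p v : spacetime) (mu : lattice -> C).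

Definition Ev L p : C := \sum_(l <- L) l.1.1 p.1 * cis (phase l.2 p.2).

Definition opL mu L : seq term :=
  [seq (fun t => mu l.2 * l.1.1 t, normc (mu l.2) * l.1.2, l.2) | l <- L].

Definition conjL L : seq term :=
  [seq (fun t => (l.1.1 t)^*%C, l.1.2, - l.2) | l <- L].

Definition mulL L L' : seq term :=
  [seq (fun t => x.1.1 t * y.1.1 t, x.1.2 * y.1.2, x.2 + y.2) | x <- L, y <- L'].

(** A list for the real part of the sum: this is how n = Re z enters the products. *)
Definition symL L : seq term := opL (fun=> (2^-1)%:C) (L ++ conjL L).

(** The component of degree a of the product of two graded series. *)
Definition convL (F G : nat -> seq term) (a : nat) : seq term :=
  flatten [seq mulL (F b) (G (a - b)%N) | b <- iota 0 a.+1].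

(** The derivative in the space-time direction v. The recorded bound is set to 0 because derivatives
    are measured by [NM] and never by the recorded bounds. *)
Definition derL v L : seq term :=
  [seq (fun t => v.1%:C * dc l.1.1 t + (0 +i* phase l.2 v.2) * l.1.1 t, 0, l.2) | l <- L].

Lemma Ev_cat L L' p : Ev (L ++ L') p = Ev L p + Ev L' p.
Proof. by rewrite /Ev big_cat. Qed.

Lemma Ev_op_op mu nu L p : Ev (opL mu (opL nu L)) p = Ev (opL (fun m => mu m * nu m) L) p.
Proof.
by rewrite /Ev !big_map; apply: eq_bigr => l _ /=; rewrite !mulrA.
Qed.

Lemma Ev_opZ (k : C) mu L p : Ev (opL (fun m => k * mu m) L) p = k * Ev (opL mu L) p.
Proof.
by rewrite /Ev !big_map mulr_sumr; apply: eq_bigr => l _ /=; rewrite !mulrA.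
Qed.

Lemma Ev_op1 L p : Ev (opL (fun=> 1) L) p = Ev L p.
Proof. by rewrite /Ev !big_map; apply: eq_bigr => l _ /=; rewrite mul1r. Qed.

Lemma Ev_op_cst (k : C) L p : Ev (opL (fun=> k) L) p = k * Ev L p.
Proof.
rewrite -[in RHS]Ev_op1 -Ev_opZ; congr (Ev (opL _ _) _).
by apply/funext => m; rewrite mulr1.
Qed.

Lemma Ev_opD mu nu L p :
  Ev (opL (fun m => mu m + nu m) L) p = Ev (opL mu L) p + Ev (opL nu L) p.
Proof.
by rewrite /Ev !big_map -big_split; apply: eq_bigr => l _ /=; rewrite !mulrDl.
Qed.

Lemma Ev_op_conj mu L p : (forall m, mu (- m) = (mu m)^*%C) ->
  Ev (opL mu (conjL L)) p = (Ev (opL mu L) p)^*%C.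
Proof.
move=> h; rewrite /Ev !big_map rmorph_sum /=; apply: eq_bigr => l _.
by rewrite h phaseN cisN !rmorphM.
Qed.

Lemma Ev_conj L p : Ev (conjL L) p = (Ev L p)^*%C.
Proof.
rewrite -[in RHS]Ev_op1 -Ev_op_conj ?Ev_op1// => m.
by rewrite rmorph1.
Qed.

(** The hypothesis says that the multiplier maps real functions to real functions; it therefore
    commutes with taking real parts. *)
Lemma Ev_op_sym mu L p : (forall m, mu (- m) = (mu m)^*%C) ->
  Ev (opL mu (symL L)) p = (complex.Re (Ev (opL mu L) p))%:C.
Proof.
move=> h; rewrite /symL Ev_op_op.
have -> : (fun m => mu m * (2^-1)%:C) = (fun m => (2^-1)%:C * mu m).
  by apply/funext => m; rewrite mulrC.
rewrite Ev_opZ /opL map_cat Ev_cat -/(opL _ _) -/(opL _ _) Ev_op_conj//.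
rewrite addcJ mulrA -(rmorph_nat (real_complex R) 2) -rmorphM /=.
by rewrite mulVf ?pnatr_eq0// rmorph1 mul1r.
Qed.

Lemma Ev_sym L p : Ev (symL L) p = (complex.Re (Ev L p))%:C.
Proof. by rewrite -[in LHS]Ev_op1 Ev_op_sym ?Ev_op1// => m; rewrite rmorph1. Qed.

Lemma Ev_mul L L' p : Ev (mulL L L') p = Ev L p * Ev L' p.
Proof.
rewrite /Ev big_allpairs_dep mulr_suml; apply: eq_bigr => l _.
rewrite mulr_sumr; apply: eq_bigr => l' _ /=.
by rewrite phaseD cisD; ring.
Qed.

Lemma Ev_conv F G a p :
  Ev (convL F G a) p = \sum_(b < a.+1) Ev (F b) p * Ev (G (a - b)%N) p.
Proof.
rewrite /Ev big_flatten big_map -[iota 0 a.+1]/(index_iota 0 a.+1) big_mkord.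
by apply: eq_bigr => b _; exact: (Ev_mul (F b) (G (a - b)%N) p).
Qed.

Definition smoothL L := forall l, l \in L -> csmooth l.1.1.

Lemma Ev_der L p v (h : R) : smoothL L ->
  cD (fun s => Ev L (s *: v + p)) h (Ev (derL v L) (h *: v + p)).
Proof.
rewrite /Ev big_map; elim: L => [|l L IH] sL.
  by rewrite !big_nil; apply: eq_cD (cDcst 0 h) _ _ => // s; rewrite big_nil.
rewrite big_cons; apply: (@eq_cD _ (fun s => l.1.1 (s *: v + p).1 * cis (phase l.2 (s *: v + p).2) +
   \sum_(l0 <- L) l0.1.1 (s *: v + p).1 * cis (phase l0.2 (s *: v + p).2))) => //.
  apply: cDD; last first.
    by apply: IH => l' l'L; apply: sL; rewrite inE l'L orbT.
  have lc : csmooth l.1.1 by apply: sL; rewrite inE eqxx.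
  have c1 : cD (fun s => l.1.1 (s *: v + p).1) h (v.1%:C * dc l.1.1 (h *: v + p).1).
    have [d1 d2] := cdiffP (smn0 (lc 0%N) (h *: v + p).1).
    have hl : is_derive h 1 (fun s : R => (s *: v + p).1) v.1.
      rewrite (_ : (fun s => _) = (v.1 \*: (@id R) + cst p.1)); last first.
        by apply/funext => s; rewrite !fctE /= /GRing.scale/= mulrC.
      by apply: is_derive_eq; rewrite addr0 /GRing.scale/= mulr1.
    split.
      apply: (@is_derive_eq _ _ _ _ _ _ _ _ (@is_derive1_comp _ (fun s => complex.Re (l.1.1 s)) (fun s : R => (s *: v + p).1) h _ _ d1 hl)).
      by rewrite Re_M/= mul0r subr0 mulrC.
    apply: (@is_derive_eq _ _ _ _ _ _ _ _ (@is_derive1_comp _ (fun s => complex.Im (l.1.1 s)) (fun s : R => (s *: v + p).1) h _ _ d2 hl)).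
    by rewrite Im_M/= mul0r addr0 mulrC.
  have c2 := cDcis (phase l.2 v.2) (phase l.2 p.2) h.
  apply: eq_cD (cDM c1 c2) _ _ => [s|] /=; first by rewrite phase_line.
  by rewrite phase_line; ring.
by move=> s; rewrite big_cons.
Qed.

Definition NM (r : nat) L (t : R) : R := \sum_(l <- L) nmr r l.1.1 t.

Lemma NM_ge0 r L t : 0 <= NM r L t.
Proof. by apply: sumr_ge0 => l _; exact: nmr_ge0. Qed.

Lemma Ev_le L p : normc (Ev L p) <= NM 0 L p.1.
Proof.
apply: (le_trans (normc_sum _ _ _)); apply: ler_sum => l _.
by rewrite normcM normc_cis mulr1 normc_le_nmr.
Qed.

Lemma smooth_cat L L' : smoothL L -> smoothL L' -> smoothL (L ++ L').
Proof. by move=> h h' l; rewrite mem_cat => /orP[/h|/h']. Qed.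

Lemma smooth_op mu L : smoothL L -> smoothL (opL mu L).
Proof. by move=> h _ /mapP[l lL ->] r /=; apply: smnM; [exact: smn_cst|exact: h]. Qed.

Lemma smooth_conj L : smoothL L -> smoothL (conjL L).
Proof. by move=> h _ /mapP[l lL ->] r /=; apply: smnJ; exact: h. Qed.

Lemma smooth_sym L : smoothL L -> smoothL (symL L).
Proof. by move=> h; apply: smooth_op; apply: smooth_cat => //; exact: smooth_conj. Qed.

Lemma smooth_mul L L' : smoothL L -> smoothL L' -> smoothL (mulL L L').
Proof.
by move=> h h' _ /allpairsP[[x y] [xL yL ->]] r /=; apply: smnM; [exact: h|exact: h'].
Qed.

Lemma smooth_conv F G a : (forall b, smoothL (F b)) -> (forall b, smoothL (G b)) ->
  smoothL (convL F G a).
Proof.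
move=> h h' l /flattenP[_ /mapP[b _ ->]]; exact: (smooth_mul (h b) (h' _)).
Qed.

Lemma csmooth_dc (f : R -> C) : csmooth f -> csmooth (dc f).
Proof. by move=> h r; case: (h r.+1). Qed.

Lemma smooth_der v L : smoothL L -> smoothL (derL v L).
Proof.
move=> h _ /mapP[l lL ->] r /=; apply: smnD; apply: smnM; do ?exact: smn_cst.
  exact: csmooth_dc (h l lL) r.
exact: h.
Qed.

Lemma NM_cat r L L' t : NM r (L ++ L') t = NM r L t + NM r L' t.
Proof. by rewrite /NM big_cat. Qed.

Lemma NM_op r mu (k : R) L t : smoothL L -> (forall l, l \in L -> normc (mu l.2) <= k) ->
  NM r (opL mu L) t <= k * NM r L t.
Proof.
move=> sL h; rewrite /NM big_map mulr_sumr big_seq [leRHS]big_seq.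
apply: ler_sum => l lL; rewrite /= nmr_cstM; last exact: sL.
by rewrite ler_wpM2r ?nmr_ge0// h.
Qed.

Lemma NM_conj r L t : smoothL L -> NM r (conjL L) t = NM r L t.
Proof.
move=> sL; rewrite /NM big_map big_seq [RHS]big_seq.
by apply: eq_bigr => l lL; rewrite /= nmrJ//; exact: sL.
Qed.

Lemma NM_sym r L t : smoothL L -> NM r (symL L) t <= NM r L t.
Proof.
move=> sL; apply: (le_trans (@NM_op r _ (2^-1) (L ++ conjL L) t _ _)).
- by apply: smooth_cat => //; exact: smooth_conj.
- by move=> l _; rewrite normc_real ger0_norm// invr_ge0.
- by rewrite NM_cat NM_conj//; lra.
Qed.

Lemma NM_mul r L L' t : smoothL L -> smoothL L' ->
  NM r (mulL L L') t <= 3 ^+ r * NM r L t * NM r L' t.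
Proof.
move=> sL sL'; rewrite /NM big_allpairs_dep -mulrA mulr_suml mulr_sumr.
rewrite big_seq [leRHS]big_seq; apply: ler_sum => l lL.
rewrite mulrA mulr_sumr big_seq [leRHS]big_seq; apply: ler_sum => l' lL'.
by apply: nmrM; [exact: sL|exact: sL'].
Qed.

Lemma NM_conv r F G a t : (forall b, smoothL (F b)) -> (forall b, smoothL (G b)) ->
  NM r (convL F G a) t <= 3 ^+ r * \sum_(b < a.+1) NM r (F b) t * NM r (G (a - b)%N) t.
Proof.
move=> sF sG; rewrite /NM big_flatten big_map.
rewrite -[iota 0 a.+1]/(index_iota 0 a.+1) big_mkord mulr_sumr.
by apply: ler_sum => b _; rewrite mulrA; exact: NM_mul.
Qed.

(** The time component of v costs one order in r, its space component at most the frequency bound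
    k. *)
Lemma NM_der r v (k : R) L t : smoothL L -> (forall l, l \in L -> fsize l.2 <= k) ->
  NM r (derL v L) t <= `|v| * (1 + k) * NM r.+1 L t.
Proof.
move=> sL h; rewrite /NM big_map mulr_sumr big_seq [leRHS]big_seq.
apply: ler_sum => l lL; rewrite /=.
have sl := sL l lL; have sdl := csmooth_dc sl.
have v1 : `|v.1| <= `|v| by rewrite [leRHS]prod_normE le_max lexx.
have v2 : `|v.2| <= `|v| by rewrite [leRHS]prod_normE le_max lexx orbT.
apply: (le_trans (nmrD _ _ _)).
- by apply: smnM; [exact: smn_cst|exact: sdl].
- by apply: smnM; [exact: smn_cst|exact: sl].
rewrite nmr_cstM// nmr_cstM// [`|v| * (1 + k)]mulrDr mulr1 [leRHS]mulrDl; apply: lerD.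
  by rewrite normc_real; apply: ler_pM; rewrite ?nmr_ge0// nmr_dc.
apply: ler_pM; rewrite ?normc_ge0 ?nmr_ge0//; last exact: nmrS.
rewrite (_ : (0 +i* _) = 'i%C * (phase l.2 v.2)%:C); last first.
  by apply: complex_eq; rewrite ?Re_M ?Im_M/=; ring.
rewrite normcM normc_i mul1r normc_real; apply: (le_trans (phase_le _ _ _)).
by rewrite mulrC; apply: ler_pM; rewrite ?fsize_ge0// h.
Qed.

End TrigLists.

(** * Families that may be summed and differentiated termwise *)

Section TameFamilies.
Context {R : realType} {d : nat} (gamma : 'I_d -> {posnum R}) (tau : R).
Local Notation C := R[i].
Local Notation lattice := {ffun 'I_d -> int}.
Local Notation term := ((R -> C) * R * lattice)%type.
Local Notation spacetime := (R * 'rV[R]_d)%type.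
Local Notation phase := (phase gamma).
Local Notation fsize := (fsize gamma).
Local Notation Ev := (Ev gamma).
Local Notation derL := (derL gamma).
Implicit Types (F G : nat -> seq term) (p v : spacetime) (mu : lattice -> C).

(* the first r time derivatives of F a decay geometrically in a, for |t| < tau *)
Definition grow (r : nat) F : Prop :=
  exists2 g, geo g & forall a t, `|t| < tau -> NM r (F a) t <= g a.

Definition fsize_bound (K : R) F := forall a l, l \in F a -> fsize l.2 <= K * a.+1%:R.

(** Closed under products, multipliers of polynomial growth and derivatives. A space derivative
    costs a factor proportional to a + 1, since the frequencies grow linearly in a, and a time
    derivative costs one unit of r; geometric decay at every order r absorbs both. *)
Definition tame F : Prop :=
  [/\ forall a, smoothL (F a), exists2 K : R, 0 <= K & fsize_bound K F &
   forall r, grow r F].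

Lemma geo_expS (e : nat) (g : nat -> R) : geo g -> geo (fun a => a.+1%:R ^+ e * g a).
Proof.
move=> gg; elim: e => [|e IH]; first by apply: (@geo_le _ _ _ 1 gg) => a; rewrite mul1r expr0 mul1r.
by apply: (@geo_le _ _ _ 1 (geoS IH)) => a; rewrite mul1r exprS mulrA.
Qed.

Lemma grow_op mu (k K : R) (e r : nat) F : 0 <= k -> 0 <= K ->
  (forall m, normc (mu m) <= k * (1 + fsize m) ^+ e) ->
  (forall a, smoothL (F a)) -> fsize_bound K F ->
  grow r F -> grow r (fun a => opL mu (F a)).
Proof.
move=> k0 K0 hmu sF szF [g gg hg].
exists (fun a => k * (1 + K) ^+ e * (a.+1%:R ^+ e * g a)).
  by apply: geoZ; exact: geo_expS.
move=> a t tt; apply: (le_trans (NM_op r (k := k * ((1 + K) * a.+1%:R) ^+ e) _ (sF a) _)).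
  move=> l lF; apply: (le_trans (hmu _)); rewrite ler_wpM2l//.
  apply: lerXn2r; rewrite ?nnegrE ?addr_ge0 ?fsize_ge0 ?mulr_ge0//.
    by rewrite addr_ge0.
  by rewrite mulrDl mul1r lerD ?ler1n//; exact: szF lF.
rewrite exprMn !mulrA ler_wpM2l ?hg//.
by rewrite !mulr_ge0 ?exprn_ge0 ?addr_ge0.
Qed.

Lemma tame_op mu (k : R) (e : nat) F : 0 <= k ->
  (forall m, normc (mu m) <= k * (1 + fsize m) ^+ e) ->
  tame F -> tame (fun a => opL mu (F a)).
Proof.
move=> k0 hmu [sF [K K0 szF] nF]; split.
- by move=> a; exact: smooth_op.
- by exists K => // a _ /mapP[l lF ->]; exact: szF lF.
- by move=> r; exact: (grow_op k0 K0 hmu).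
Qed.

Lemma fsize_bound_conj K F : fsize_bound K F -> fsize_bound K (fun a => conjL (F a)).
Proof. by move=> szF a _ /mapP[l lF ->]; rewrite /= fsizeN; exact: szF. Qed.

Lemma fsize_bound_conv K K' F G : 0 <= K -> 0 <= K' ->
  fsize_bound K F -> fsize_bound K' G -> fsize_bound (K + K') (convL F G).
Proof.
move=> K0 K0' szF szG a l /flattenP[_ /mapP[b + ->]] /allpairsP[[x y] /= [xF yG ->]] /=.
rewrite mem_iota add0n => /= ba; apply: (le_trans (fsizeD _ _ _)).
rewrite mulrDl lerD//; [apply: (le_trans (szF _ _ xF))|apply: (le_trans (szG _ _ yG))].
  by rewrite ler_wpM2l// ler_nat.
by rewrite ler_wpM2l// ler_nat ltnS leq_subr.
Qed.

Lemma grow_conj r F : (forall a, smoothL (F a)) ->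
  grow r F -> grow r (fun a => conjL (F a)).
Proof. by move=> sF [g gg hg]; exists g => // a t tt; rewrite NM_conj// hg. Qed.

Lemma tame_conj F : tame F -> tame (fun a => conjL (F a)).
Proof.
move=> [sF [K K0 szF] nF]; split.
- by move=> a; exact: smooth_conj.
- by exists K => //; exact: fsize_bound_conj.
- by move=> r; exact: grow_conj.
Qed.

Lemma fsize_bound_sym K F : fsize_bound K F -> fsize_bound K (fun a => symL (F a)).
Proof.
move=> szF a _ /mapP[l + ->]; rewrite mem_cat => /orP[|] lF /=; first exact: szF.
exact: (fsize_bound_conj szF) lF.
Qed.

Lemma grow_sym r F : (forall a, smoothL (F a)) ->
  grow r F -> grow r (fun a => symL (F a)).
Proof.
move=> sF [g gg hg]; exists g => // a t tt.
by apply: (le_trans (NM_sym _ _ (sF a))); exact: hg.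
Qed.

Lemma tame_sym F : tame F -> tame (fun a => symL (F a)).
Proof.
move=> [sF [K K0 szF] nF]; split.
- by move=> a; exact: smooth_sym.
- by exists K => //; exact: fsize_bound_sym.
- by move=> r; exact: grow_sym.
Qed.

Lemma grow_conv r F G : (forall a, smoothL (F a)) -> (forall a, smoothL (G a)) ->
  grow r F -> grow r G -> grow r (convL F G).
Proof.
move=> sF sG [g gg hg] [g' gg' hg'].
exists (fun a => 3 ^+ r * \sum_(b < a.+1) `|g b| * `|g' (a - b)%N|).
  have ga : geo (fun b => `|g b|) by apply: (@geo_le _ _ _ 1 gg) => b; rewrite mul1r normr_id.
  have ga' : geo (fun b => `|g' b|) by apply: (@geo_le _ _ _ 1 gg') => b; rewrite mul1r normr_id.
  by apply: geoZ; exact: (geo_conv ga ga').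
move=> a t tt; apply: (le_trans (NM_conv _ _ _ sF sG)).
rewrite ler_wpM2l ?exprn_ge0//; apply: ler_sum => b _.
by apply: ler_pM; rewrite ?NM_ge0// (le_trans _ (ler_norm _))// ?hg ?hg'.
Qed.

Lemma tame_conv F G : tame F -> tame G -> tame (convL F G).
Proof.
move=> [sF [K K0 szF] nF] [sG [K' K0' szG] nG]; split.
- by move=> a; exact: smooth_conv.
- by exists (K + K'); [rewrite addr_ge0|exact: fsize_bound_conv].
- by move=> r; exact: grow_conv.
Qed.

(** The recursion controls only the terms with at least one interaction; the data term enters as a
    single bounded term. *)
Lemma grow_unshift r F :
  grow r (fun a => F a.+1) ->
  (exists B : R, forall t, NM r (F 0%N) t <= B) -> grow r F.
Proof.
move=> [g [Cg [th [C0 th0 th1 hg]]] h] [B hB].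
exists (fun a => if a is a'.+1 then g a' else B).
  exists (`|B| + Cg / th), th; split => //.
    by rewrite addr_ge0// divr_ge0// ltW.
  case=> [|a]; first by rewrite expr0 mulr1 lerDl divr_ge0// ltW.
  apply: (le_trans (hg a)); rewrite mulrDl exprS (mulrA (Cg / th)) divfK ?gt_eqF//.
  by rewrite lerDr mulr_ge0// mulr_ge0// ?exprn_ge0// ltW.
by case=> [|a] t tt; [exact: hB|exact: h].
Qed.

Lemma tame_shift F : tame F -> tame (fun a => F a.+1).
Proof.
move=> [sF [K K0 szF] nF]; split.
- by move=> a.
- exists (2 * K); first by rewrite mulr_ge0.
  move=> a l /szF h; apply: (le_trans h); rewrite -[2 * K]mulrC -mulrA ler_wpM2l//.
  by rewrite -natrM ler_nat mul2n -addnn addSn ltnS leq_addl.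
move=> r; have [g gg hg] := nF r.
by exists (fun a => g a.+1); [exact: geo_shift|move=> a t tt; exact: hg].
Qed.

Lemma tame_der v F : tame F -> tame (fun a => derL v (F a)).
Proof.
move=> [sF [K K0 szF] nF]; split.
- by move=> a; exact: smooth_der.
- by exists K => // a _ /mapP[l lF ->]; exact: szF lF.
move=> r; have [g gg hg] := nF r.+1.
exists (fun a => `|v| * (1 + K) * (a.+1%:R * g a)); first by apply: geoZ; exact: geoS.
move=> a t tt; apply: (le_trans (NM_der r v t (sF a) (fun l lF => szF a l lF))).
rewrite !mulrA -!mulrA ler_wpM2l// mulrA; apply: ler_pM; rewrite ?NM_ge0 ?hg//.
  by rewrite addr_ge0// mulr_ge0.
by rewrite mulrDl mul1r lerD ?ler1n.
Qed.

Definition Evs F p : C := csum (fun a => Ev (F a) p).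

Lemma S_geo F p : tame F -> `|p.1| < tau -> cgeo (fun a => Ev (F a) p).
Proof.
move=> [_ _ /(_ 0%N)[g gg hg]] pt; apply: (cgeo_le gg) => a.
by apply: (le_trans (Ev_le _ _ _)); exact: hg.
Qed.

Lemma S_cat F G p : tame F -> tame G -> `|p.1| < tau ->
  Evs (fun a => F a ++ G a) p = Evs F p + Evs G p.
Proof.
move=> tF tG pt; rewrite -csumD; [|exact: S_geo|exact: S_geo].
by congr csum; apply/funext => a; rewrite Ev_cat.
Qed.

Lemma S_conv F G p : tame F -> tame G -> `|p.1| < tau ->
  Evs (convL F G) p = Evs F p * Evs G p.
Proof.
move=> tF tG pt; rewrite -csum_conv; [|exact: S_geo|exact: S_geo].
by congr csum; apply/funext => a; rewrite Ev_conv.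
Qed.

Lemma S_conj F p : tame F -> `|p.1| < tau -> Evs (fun a => conjL (F a)) p = (Evs F p)^*%C.
Proof.
move=> tF pt; rewrite -csumJ; last exact: S_geo.
by congr csum; apply/funext => a; rewrite Ev_conj.
Qed.

Lemma S_op_sym mu F p : (forall m, mu (- m) = (mu m)^*%C) ->
  Evs (fun a => opL mu (symL (F a))) p = (complex.Re (Evs (fun a => opL mu (F a)) p))%:C.
Proof.
move=> h; apply: complex_eq; rewrite /=.
  by congr rsum; apply/funext => a; rewrite Ev_op_sym.
by rewrite -[RHS](@rsum0 R); congr rsum; apply/funext => a; rewrite Ev_op_sym.
Qed.

Lemma S_sym F p : Evs (fun a => symL (F a)) p = (complex.Re (Evs F p))%:C.
Proof.
apply: complex_eq; rewrite /=.
  by congr rsum; apply/funext => a; rewrite Ev_sym.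
by rewrite -[RHS](@rsum0 R); congr rsum; apply/funext => a; rewrite Ev_sym.
Qed.

Lemma S_opZ (k : C) mu F p : tame (fun a => opL mu (F a)) -> `|p.1| < tau ->
  Evs (fun a => opL (fun m => k * mu m) (F a)) p = k * Evs (fun a => opL mu (F a)) p.
Proof.
move=> tF pt; rewrite -csumZ; last exact: S_geo.
by congr csum; apply/funext => a; rewrite Ev_opZ.
Qed.

Lemma eq_S F G p : (forall a, Ev (F a) p = Ev (G a) p) -> Evs F p = Evs G p.
Proof. by move=> h; congr csum; apply/funext => a. Qed.

Lemma S_recl F p : tame F -> `|p.1| < tau -> Evs F p = Ev (F 0%N) p + Evs (fun a => F a.+1) p.
Proof. by move=> tF pt; rewrite /Evs csum_recl//; exact: S_geo. Qed.

Lemma S_is_derive F p v : tame F -> `|p.1| < tau ->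
  is_derive p v (fun q => complex.Re (Evs F q)) (complex.Re (Evs (fun a => derL v (F a)) p)) /\
  is_derive p v (fun q => complex.Im (Evs F q)) (complex.Im (Evs (fun a => derL v (F a)) p)).
Proof.
move=> tF pt.
have tF1 := tame_der v tF; have tF2 := tame_der v tF1.
have [g0 gg0 hg0] := let: And3 _ _ h := tF in h 0%N.
have [g1 gg1 hg1] := let: And3 _ _ h := tF1 in h 0%N.
have [g2 gg2 hg2] := let: And3 _ _ h := tF2 in h 0%N.
pose g a := `|g0 a| + `|g1 a| + `|g2 a|.
have gg : geo g.
  by apply: geoD; [apply: geoD|]; [apply: (@geo_le _ _ _ 1 gg0)|apply: (@geo_le _ _ _ 1 gg1)|
    apply: (@geo_le _ _ _ 1 gg2)] => a; rewrite mul1r normr_id.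
(* For |h| < e the point h v + p stays in the slab; only its time component matters. The + 1 covers
   directions with v.1 = 0. *)
pose e := (tau - `|p.1|) / (`|v.1| + 1).
have v0 : 0 < `|v.1| + 1 by rewrite ltr_wpDl.
have e0 : 0 < e by rewrite divr_gt0// subr_gt0.
have inA (h : R) : `|h| < e -> `|(h *: v + p).1| < tau.
  rewrite /e ltr_pdivlMr// => he /=; apply: (le_lt_trans (ler_normD _ _)).
  rewrite normrM -ltrBrDr; apply: le_lt_trans he.
  by rewrite ler_wpM2l// lerDl.
have b0 a h : `|h| < e -> normc (Ev (F a) (h *: v + p)) <= g a.
  move=> /inA he; apply: (le_trans (Ev_le _ _ _)); apply: (le_trans (hg0 a _ he)).
  by rewrite /g -addrA; apply: (le_trans (ler_norm _)); rewrite lerDl addr_ge0.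
have b1 a h : `|h| < e -> normc (Ev (derL v (F a)) (h *: v + p)) <= g a.
  move=> /inA he; apply: (le_trans (Ev_le _ _ _)); apply: (le_trans (hg1 a _ he)).
  by rewrite /g; apply: (le_trans (ler_norm _)); have := normr_ge0 (g0 a); have := normr_ge0 (g2 a); lra.
have b2 a h : `|h| < e -> normc (Ev (derL v (derL v (F a))) (h *: v + p)) <= g a.
  move=> /inA he; apply: (le_trans (Ev_le _ _ _)); apply: (le_trans (hg2 a _ he)).
  by rewrite /g; apply: (le_trans (ler_norm _)); have := normr_ge0 (g0 a); have := normr_ge0 (g1 a); lra.
have sF a : smoothL (F a) by case: tF.
have sF1 a : smoothL (derL v (F a)) by case: tF1.
split; apply: is_derive_line.
  have := @rsum_is_derive R (fun a h => complex.Re (Ev (F a) (h *: v + p)))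
    (fun a h => complex.Re (Ev (derL v (F a)) (h *: v + p)))
    (fun a h => complex.Re (Ev (derL v (derL v (F a))) (h *: v + p))) g e e0 gg.
  rewrite scale0r add0r; apply => a h he.
  - by case: (Ev_der gamma p v h (sF a)).
  - by case: (Ev_der gamma p v h (sF1 a)).
  - exact: le_trans (Re_le_normc _) (b0 a h he).
  - exact: le_trans (Re_le_normc _) (b1 a h he).
  - exact: le_trans (Re_le_normc _) (b2 a h he).
have := @rsum_is_derive R (fun a h => complex.Im (Ev (F a) (h *: v + p)))
  (fun a h => complex.Im (Ev (derL v (F a)) (h *: v + p)))
  (fun a h => complex.Im (Ev (derL v (derL v (F a))) (h *: v + p))) g e e0 gg.
rewrite scale0r add0r; apply => a h he.
- by case: (Ev_der gamma p v h (sF a)).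
- by case: (Ev_der gamma p v h (sF1 a)).
- exact: le_trans (Im_le_normc _) (b0 a h he).
- exact: le_trans (Im_le_normc _) (b1 a h he).
- exact: le_trans (Im_le_normc _) (b2 a h he).
Qed.

(** Directional derivatives alone do not give continuity. Here they are bounded by a constant times
    |v|, uniformly on the slab, which is convex, so the mean value theorem along a segment applies.
    The estimate also provides the Lipschitz bounds that the Fourier integrals require. *)
Lemma S_lipschitz F : tame F -> exists2 K : R, 0 <= K &
  forall p q, `|p.1| < tau -> `|q.1| < tau -> normc (Evs F q - Evs F p) <= K * `|q - p|.
Proof.
move=> tF; have [sF [K0 K00 szF] nF] := tF.
have [g gg hg] := nF 1%N.
pose g' a := (1 + K0) * (a.+1%:R * `|g a|).
have gg' : geo g'.
  apply: geoZ; apply: geoS; apply: (@geo_le _ _ _ 1 gg) => a; by rewrite mul1r normr_id.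
have g'0 a : 0 <= g' a by rewrite !mulr_ge0// addr_ge0.
have bnd v p : `|p.1| < tau ->
    `|rsum (fun a => complex.Re (Ev (derL v (F a)) p))| <= rsum g' * `|v| /\
    `|rsum (fun a => complex.Im (Ev (derL v (F a)) p))| <= rsum g' * `|v|.
  move=> pt; have gev := S_geo (tame_der v tF) pt.
  have key a : normc (Ev (derL v (F a)) p) <= `|v| * g' a.
    apply: (le_trans (Ev_le _ _ _)).
    apply: (le_trans (NM_der 0 v p.1 (sF a) (fun l lF => szF a l lF))).
    rewrite /g' -!mulrA ler_wpM2l// mulrA; apply: ler_pM; rewrite ?NM_ge0//.
    - by rewrite addr_ge0// mulr_ge0.
    - by rewrite mulrDl mul1r lerD ?ler1n.
    - by apply: (le_trans (hg a _ pt)); exact: ler_norm.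
  have sumle n : \sum_(a < n) `|v| * g' a <= rsum g' * `|v|.
    rewrite mulrC -rsumZ//.
    rewrite -(big_mkord predT (fun a => `|v| * g' a)).
    apply: (nondecreasing_cvgn_le _ (cvgP _ (rsum_cvg (geoZ _ gg')))) => //.
    by apply/nondecreasing_seqP => k; rewrite seriesSr lerDl mulr_ge0.
  split; (apply: rsum_norm_le; [exact: cgeo_Re|]) || (apply: rsum_norm_le; [exact: cgeo_Im|]);
   move=> n; apply: le_trans (sumle n); apply: ler_sum => a _;
   apply: le_trans (key a); [exact: Re_le_normc|exact: Im_le_normc].
exists (rsum g' + rsum g').
  by rewrite addr_ge0// rsum_ge0.
move=> p q pt qt; pose v := q - p.
have inA (h : R) : 0 <= h -> h <= 1 -> `|(h *: v + p).1| < tau.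
  move=> h0 h1; rewrite /v /=.
  have -> : h * (q.1 - p.1) + p.1 = h * q.1 + (1 - h) * p.1 by ring.
  apply: (le_lt_trans (ler_normD _ _)); rewrite !normrM (ger0_norm h0).
  rewrite [`|1 - h|]ger0_norm ?subr_ge0//.
  have [->|h1'] := eqVneq h 1; first by rewrite mul1r subrr mul0r addr0.
  have h2 : 0 < 1 - h by rewrite subr_gt0 lt_neqAle h1'.
  have e1 : h * `|q.1| <= h * tau by rewrite ler_wpM2l// ltW.
  have e2 : (1 - h) * `|p.1| < (1 - h) * tau by rewrite ltr_pM2l.
  by apply: (lt_le_trans (ler_ltD e1 e2)); lra.
have line (f : C -> R) (df : R -> R) : (forall h : R, 0 <= h -> h <= 1 ->
      is_derive (h *: v + p) v (fun q' => f (Evs F q')) (df h)) ->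
    (forall h, 0 <= h -> h <= 1 -> `|df h| <= rsum g' * `|v|) ->
    `|f (Evs F q) - f (Evs F p)| <= rsum g' * `|v|.
  move=> hd hb.
  have hd' (h : R) : h \in `[0, 1] -> is_derive h 1 (fun s : R => f (Evs F (s *: v + p))) (df h).
    rewrite in_itv/= => /andP[h0 h1]; have [d1 d2] := hd h h0 h1.
    have E : (fun k : R => k^-1 *: (f (Evs F ((k *: (1 : R) + h) *: v + p)) - f (Evs F (h *: v + p)))) =
        (fun k : R => k^-1 *: (f (Evs F (k *: v + (h *: v + p))) - f (Evs F (h *: v + p)))).
      by apply/funext => k; rewrite scalerDl addrA [k *: 1]mulr1.
    by apply: DeriveDef; [rewrite /derivable E|rewrite -d2 /derive E].
  have [c] := MVT_closed (ler01) hd'.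
  rewrite in_itv/= => /andP[c0 c1].
  have vpq : v + p = q by rewrite /v subrK.
  by rewrite scale0r add0r scale1r vpq subr0 mulr1 => ->; exact: hb.
apply: (le_trans (normc_le_ReIm _)); rewrite Re_D Im_D mulrDl.
have ReN z : complex.Re (- z : C) = - complex.Re z by case: z.
have ImN z : complex.Im (- z : C) = - complex.Im z by case: z.
rewrite ReN ImN; apply: lerD.
  apply: (line (fun z => complex.Re z) (fun h => complex.Re (Evs (fun a => derL v (F a)) (h *: v + p)))) => h h0 h1.
    by have [] := S_is_derive v tF (inA h h0 h1).
  by have [] := bnd v _ (inA h h0 h1).
apply: (line (fun z => complex.Im z) (fun h => complex.Im (Evs (fun a => derL v (F a)) (h *: v + p)))) => h h0 h1.
  by have [] := S_is_derive v tF (inA h h0 h1).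
by have [] := bnd v _ (inA h h0 h1).
Qed.

Definition slab : set spacetime := [set p | `|p.1| < tau].

Lemma slab_nbhs p : slab p -> \forall q \near p, slab q.
Proof.
move=> pt; have cn : {for p, continuous (fun q : spacetime => `|q.1|)}.
  by apply: continuous_comp; [exact: cvg_fst|exact: norm_continuous].
exact: (cn _ (lt_nbhsl pt)).
Qed.

Lemma S_continuous F p : tame F -> slab p ->
  {for p, continuous (fun q => complex.Re (Evs F q))} /\
  {for p, continuous (fun q => complex.Im (Evs F q))}.
Proof.
move=> tF pt; have [K K0 hK] := S_lipschitz tF.
have ReN z : complex.Re (- z : C) = - complex.Re z by case: z.
have ImN z : complex.Im (- z : C) = - complex.Im z by case: z.
have gen (f : C -> R) : (forall z w, `|f z - f w| <= normc (z - w)) ->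
    {for p, continuous (fun q => f (Evs F q))}.
  move=> fl; apply/cvgrPdist_le => /= eps eps0; near=> q.
  have qt : slab q by near: q; exact: slab_nbhs.
  apply: (le_trans (fl _ _)); apply: (le_trans (hK _ _ qt pt)).
  have : `|p - q| < eps / (K + 1).
    near: q; apply: cvgr_dist_lt; last by rewrite divr_gt0// ltr_wpDl.
    exact: cvg_id.
  rewrite ltr_pdivlMr ?ltr_wpDl// => /ltW; apply: le_trans.
  by rewrite mulrC ler_wpM2l// lerDl.
split; apply: gen => z w.
  by rewrite -ReN -Re_D Re_le_normc.
by rewrite -ImN -Im_D Im_le_normc.
Unshelve. all: by end_near. Qed.

Definition derFs (vs : seq spacetime) F : nat -> seq term :=
  foldr (fun v G => fun a => derL v (G a)) F vs.

Lemma tame_derFs vs F : tame F -> tame (derFs vs F).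
Proof. by move=> tF; elim: vs => [|v vs IH] //=; exact: tame_der. Qed.

(** The termwise formula holds on the slab only. The slab is open, so it can be differentiated again
    at each point. *)
Lemma iter_derive_S vs F p : tame F -> slab p ->
  iter_derive vs (fun q => complex.Re (Evs F q)) p = complex.Re (Evs (derFs vs F) p) /\
  iter_derive vs (fun q => complex.Im (Evs F q)) p = complex.Im (Evs (derFs vs F) p).
Proof.
move=> tF; elim: vs p => [|v vs IH] p pt //=.
have [d1 d2] := S_is_derive v (tame_derFs vs tF) pt.
move: d1 d2 => [_ e1] [_ e2]; split; [apply: etrans e1|apply: etrans e2];
  apply: near_eq_derive; near=> q; have qt : slab q by [near: q; exact: slab_nbhs].
  by have [] := IH q qt.
by have [] := IH q qt.
Unshelve. all: by end_near. Qed.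

Lemma smooth_S F : tame F -> csmooth_on slab (Evs F).
Proof.
move=> tF; split=> vs p pt; have tG := tame_derFs vs tF;
  have [c1 c2] := S_continuous tG pt.
  have E : \forall q \near p, complex.Re (Evs (derFs vs F) q) =
      iter_derive vs (fun x => complex.Re (Evs F x)) q.
    near=> q; have qt : slab q by near: q; exact: slab_nbhs.
    by have [-> _] := iter_derive_S vs tF qt.
  split; last first.
    move=> v; apply: near_eq_derivable E _.
    by have [[]] := S_is_derive v tG pt.
  have [Ep _] := iter_derive_S vs tF pt.
  rewrite /prop_for /continuous_at Ep; apply: cvg_trans c1.
  by apply: near_eq_cvg; near do apply: esym; apply: filterS E => q ->.
have E : \forall q \near p, complex.Im (Evs (derFs vs F) q) =
    iter_derive vs (fun x => complex.Im (Evs F x)) q.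
  near=> q; have qt : slab q by near: q; exact: slab_nbhs.
  by have [_ ->] := iter_derive_S vs tF qt.
split; last first.
  move=> v; apply: near_eq_derivable E _.
  by have [_ []] := S_is_derive v tG pt.
have [_ Ep] := iter_derive_S vs tF pt.
rewrite /prop_for /continuous_at Ep; apply: cvg_trans c2.
by apply: near_eq_cvg; apply: filterS E => q ->.
Unshelve. all: by end_near. Qed.

End TameFamilies.

(** * The graded Duhamel expansion *)

Section GradedLists.
Context {R : realType} {d : nat} (gamma : 'I_d -> {posnum R}).
Local Notation C := R[i].
Local Notation lattice := {ffun 'I_d -> int}.
Local Notation term := ((R -> C) * R * lattice)%type.
Local Notation fsize := (fsize gamma).
Implicit Types (L : seq term) (mu : lattice -> C) (phi : lattice -> R) (D : seq (C * lattice)).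

Definition dataL phi D : seq term :=
  [seq (fun t => cis (- phi x.2 * t + 0) * x.1, normc x.1, x.2) | x <- D].

Definition duhL phi (a : nat) L : seq term :=
  [seq (duh (phi l.2) l.1.1, 2 * l.1.2 / a.+1%:R, l.2) | l <- L].

(** The invariant of terms with a interactions: their coefficients are a-fold time integrals, hence
    O(|t|^a) with the recorded constants. *)
Definition graded (a : nat) (s : R) L : Prop := forall l, l \in L ->
  [/\ csmooth l.1.1, 0 <= l.1.2, forall t, normc (l.1.1 t) <= l.1.2 * `|t| ^+ a &
      fsize l.2 <= s].

(** For a list of grade a, [mass] times |t|^a majorises the Wiener norm, the sum of the moduli of
    the Fourier coefficients. It is multiplicative under [mulL]. *)
Definition mass L : R := \sum_(l <- L) l.1.2.

Lemma mass_ge0 a s L : graded a s L -> 0 <= mass L.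
Proof.
move=> h; rewrite /mass big_seq; apply: sumr_ge0 => l /h[] //.
Qed.

Lemma graded_data phi D (s : R) : (forall x, x \in D -> fsize x.2 <= s) ->
  graded 0 s (dataL phi D).
Proof.
move=> h _ /mapP[x xD ->]; split => //=; last exact: h.
- by move=> r; apply: smnM; [exact: smn_cis|exact: smn_cst].
- exact: normc_ge0.
- by move=> t; rewrite normcM normc_cis mul1r expr0 mulr1.
Qed.

Lemma graded_op mu a s L : graded a s L -> graded a s (opL mu L).
Proof.
move=> h _ /mapP[l lL ->] /=; have [h1 h2 h3 h4] := h l lL; split => //=.
- by move=> r; apply: smnM; [exact: smn_cst|exact: h1].
- by rewrite mulr_ge0 ?normc_ge0.
- by move=> t; rewrite normcM -mulrA ler_wpM2l ?normc_ge0.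
Qed.

Lemma graded_conj a s L : graded a s L -> graded a s (conjL L).
Proof.
move=> h _ /mapP[l lL ->] /=; have [h1 h2 h3 h4] := h l lL; split => //=.
- by move=> r; apply: smnJ; exact: h1.
- by move=> t; rewrite normc_conj.
- by rewrite fsizeN.
Qed.

Lemma graded_sym a s L : graded a s L -> graded a s (symL L).
Proof.
move=> h; apply: graded_op => l; rewrite mem_cat => /orP[|]; first exact: h.
exact: graded_conj h l.
Qed.

Lemma graded_mul a a' s s' L L' : graded a s L -> graded a' s' L' ->
  graded (a + a') (s + s') (mulL L L').
Proof.
move=> h h' _ /allpairsP[[x y] /= [xL yL ->]] /=.
have [h1 h2 h3 h4] := h x xL; have [h1' h2' h3' h4'] := h' y yL; split => /=.
- by move=> r; apply: smnM; [exact: h1|exact: h1'].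
- by rewrite mulr_ge0.
- move=> t; rewrite normcM exprD mulrACA.
  by apply: ler_pM; rewrite ?normc_ge0.
- by apply: (le_trans (fsizeD _ _ _)); exact: lerD.
Qed.

(** The frequency bounds add up to (b + 1) + (a - b + 1) = a + 2, which is the right bound for the
    next grade, reached after one time integration. *)
Lemma graded_conv (s : R) (F G : nat -> seq term) a :
  (forall b, (b <= a)%N -> graded b (b.+1%:R * s) (F b)) ->
  (forall b, (b <= a)%N -> graded b (b.+1%:R * s) (G b)) ->
  graded a (a.+2%:R * s) (convL F G a).
Proof.
move=> hF hG l /flattenP[_ /mapP[b + ->]] lL; rewrite mem_iota add0n => /= ba.
have := graded_mul (hF b _) (hG (a - b)%N _) lL.
rewrite subnKC// => /(_ ba (leq_subr _ _)).
rewrite -mulrDl -natrD addSnnS -addSnnS addSn addnS subnKC//.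
Qed.

Lemma graded_duh phi a s L : graded a s L -> graded a.+1 s (duhL phi a L).
Proof.
move=> h _ /mapP[l lL ->] /=; have [h1 h2 h3 h4] := h l lL; split => //=.
- by move=> r; exact: smn_duh (h1 r).
- by rewrite divr_ge0// mulr_ge0.
- by apply: duh_le => //; exact: smn0 (h1 0%N).
Qed.

Lemma mass_data phi D : mass (dataL phi D) = \sum_(x <- D) normc x.1.
Proof. by rewrite /mass big_map. Qed.

Lemma mass_op mu (k : R) a s L : graded a s L ->
  (forall l, l \in L -> normc (mu l.2) <= k) -> mass (opL mu L) <= k * mass L.
Proof.
move=> h hk; rewrite /mass big_map mulr_sumr big_seq [leRHS]big_seq.
by apply: ler_sum => l lL; rewrite ler_wpM2r ?hk//; have [] := h l lL.
Qed.

Lemma mass_conj L : mass (conjL L) = mass L.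
Proof. by rewrite /mass big_map. Qed.

Lemma mass_sym L : mass (symL L) = mass L.
Proof.
have e : normc (2^-1)%:C = 2^-1 :> R by rewrite normc_real ger0_norm// invr_ge0.
rewrite /mass big_map (eq_bigr (fun l : term => 2^-1 * l.1.2)); last first.
  by move=> l _; exact: (congr1 (fun z => z * l.1.2) e).
by rewrite -mulr_sumr big_cat big_map /=; lra.
Qed.

Lemma mass_mul L L' : mass (mulL L L') = mass L * mass L'.
Proof.
rewrite /mass big_allpairs_dep mulr_suml; apply: eq_bigr => l _.
by rewrite mulr_sumr.
Qed.

Lemma mass_conv (F G : nat -> seq term) a :
  mass (convL F G a) = \sum_(b < a.+1) mass (F b) * mass (G (a - b)%N).
Proof.
rewrite /mass big_flatten big_map -[iota 0 a.+1]/(index_iota 0 a.+1) big_mkord.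
by apply: eq_bigr => b _; exact: (mass_mul (F b) (G (a - b)%N)).
Qed.

Lemma mass_duh phi a L : mass (duhL phi a L) = 2 / a.+1%:R * mass L.
Proof.
rewrite /mass big_map mulr_sumr; apply: eq_bigr => l _ /=; ring.
Qed.

Lemma NM0_graded a s L t : graded a s L -> NM 0 L t <= mass L * `|t| ^+ a.
Proof.
move=> h; rewrite /NM /mass mulr_suml big_seq [leRHS]big_seq.
by apply: ler_sum => l /h[_ _ h3 _] /=; rewrite addr0.
Qed.

(** The equation y' = - i phi y + f replaces one time derivative of a Duhamel integral by a
    multiplier and its source. Bounds of order r thus give bounds of order r + 1. *)
Lemma NM_duh r phi a L t : smoothL L ->
  NM r.+1 (duhL phi a L) t <= NM 0 (duhL phi a L) t +
    NM r (opL (fun m => 0 -i* phi m) (duhL phi a L)) t + NM r L t.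
Proof.
move=> sL; rewrite /NM !big_map -!big_split big_seq [leRHS]big_seq.
apply: ler_sum => l lL; apply: (@le_trans _ _ (normc (duh (phi l.2) l.1.1 t) +
  (nmr r (fun s => (0 -i* phi l.2) * duh (phi l.2) l.1.1 s) t + nmr r l.1.1 t))); last first.
  by rewrite /= addr0 addrA.
rewrite [leLHS]/= lerD2l.
have sl : smn r l.1.1 by exact: sL.
have [_ h] := duh_spec (phi l.2) (smn0 sl).
rewrite (_ : dc _ = fun s => (0 -i* phi l.2) * duh (phi l.2) l.1.1 s + l.1.1 s).
  apply: nmrD => //; apply: smnM; [exact: smn_cst|exact: smn_duh].
by apply/funext => s; exact: cD_val.
Qed.

Lemma NM_data r phi D : exists B : R, forall t, NM r (dataL phi D) t <= B.
Proof.
have ncis (k a : R) : exists B : R, forall t, nmr r (fun s => cis (k * s + a)) t <= B.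
  elim: r => [|r [B hB]].
    by exists 1 => t; rewrite /nmr addr0 normc_cis.
  exists (1 + `|k| * B) => t.
  rewrite -[leLHS]/(normc (cis (k * t + a)) + nmr r (dc (fun s => cis (k * s + a))) t).
  rewrite normc_cis lerD2l.
  rewrite (_ : dc _ = fun s => (0 +i* k) * cis (k * s + a)).
    rewrite nmr_cstM; last exact: smn_cis.
    by rewrite /normc expr0n/= add0r sqrtr_sqr ler_wpM2l.
  by apply/funext => s; exact: cD_val (cDcis _ _ _).
rewrite /NM; elim: D => [|x D [B hB]].
  by exists 0 => t; rewrite big_nil.
have [B' hB'] := ncis (- phi x.2) 0.
exists (normc x.1 * B' + B) => t; rewrite big_cons /= lerD//.
have -> : (fun s => cis (- phi x.2 * s + 0) * x.1) = (fun s => x.1 * cis (- phi x.2 * s + 0)).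
  by apply/funext => s; rewrite mulrC.
rewrite nmr_cstM; last exact: smn_cis.
by rewrite ler_wpM2l ?normc_ge0.
Qed.

End GradedLists.

Section Recursion.
Context {R : realType} {d : nat} (gamma : 'I_d -> {posnum R}) (lambda : R[i])
  (c0 : R) (alpha beta : 'I_d -> R) (U0 Z0 : seq (R[i] * {ffun 'I_d -> int})).
Local Notation C := R[i].
Local Notation lattice := {ffun 'I_d -> int}.
Local Notation term := ((R -> C) * R * lattice)%type.
Local Notation fsize := (fsize gamma).
Context (c0_gt0 : 0 < c0) (alpha_gt0 : forall j, 0 < alpha j).

Definition quad (a : 'I_d -> R) (m : lattice) : R := \sum_(j < d) a j * freq gamma m j ^+ 2.
Definition om := quad alpha.
Definition Om m : R := c0 * Num.sqrt (om m).
Definition rz m : R := c0 ^+ 2 * quad beta m / Om m.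
Definition Kz : R := \sum_(j < d) c0 * `|beta j| / Num.sqrt (alpha j).

Lemma quadN a m : quad a (- m) = quad a m.
Proof. by apply: eq_bigr => j _; rewrite freqN sqrrN. Qed.

Lemma OmN m : Om (- m) = Om m. Proof. by rewrite /Om /om quadN. Qed.

Lemma rzN m : rz (- m) = rz m. Proof. by rewrite /rz OmN quadN. Qed.

Lemma om_ge0 m : 0 <= om m.
Proof. by apply: sumr_ge0 => j _; rewrite mulr_ge0 ?sqr_ge0// ltW. Qed.

Lemma Om_ge0 m : 0 <= Om m.
Proof. by rewrite mulr_ge0 ?sqrtr_ge0// ltW. Qed.

Lemma Om_sqr m : Om m ^+ 2 = c0 ^+ 2 * om m.
Proof. by rewrite exprMn sqr_sqrtr ?om_ge0. Qed.

Lemma Om_freq m j : c0 * Num.sqrt (alpha j) * `|freq gamma m j| <= Om m.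
Proof.
rewrite /Om -mulrA ler_wpM2l ?(ltW c0_gt0)//.
rewrite -sqrtr_sqr -sqrtrM ?(ltW (alpha_gt0 j))// ler_wsqrtr//.
rewrite /om /quad (bigD1 j)//= lerDl sumr_ge0// => i _.
by rewrite mulr_ge0 ?sqr_ge0// ltW.
Qed.

(** Where [Om] vanishes the quotient [rz] is 0 by convention. The identity survives because there
    all components of the frequency vanish, and the symbol of beta with them. *)
Lemma rz_Om m : rz m * Om m = c0 ^+ 2 * quad beta m.
Proof.
have [E|N] := eqVneq (Om m) 0; last by rewrite /rz divfK.
rewrite E mulr0 [quad beta m]big1 ?mulr0// => j _.
have := Om_freq m j; rewrite E => h.
have : c0 * Num.sqrt (alpha j) * `|freq gamma m j| == 0.
  by rewrite eq_le h mulr_ge0// mulr_ge0 ?sqrtr_ge0// ltW.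
rewrite mulf_eq0 normr_eq0 mulf_eq0 (gt_eqF c0_gt0) sqrtr_eq0 leNgt alpha_gt0 /=.
by move=> /eqP ->; rewrite expr0n mulr0.
Qed.

Lemma Kz_ge0 : 0 <= Kz.
Proof. by apply: sumr_ge0 => j _; rewrite divr_ge0 ?sqrtr_ge0// mulr_ge0// ltW. Qed.

(** The multiplier has order one: in each square of a frequency component one factor is bounded by
    [Om], which cancels the denominator, and the other by [fsize]. *)
Lemma rz_le m : `|rz m| <= Kz * fsize m.
Proof.
have [E|N] := eqVneq (Om m) 0.
  by rewrite /rz E invr0 mulr0 normr0 mulr_ge0 ?Kz_ge0 ?fsize_ge0.
have Op : 0 < Om m by rewrite lt_neqAle eq_sym N Om_ge0.
rewrite /rz normrM normfV (gtr0_norm Op) ler_pdivrMr// normrM.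
rewrite ger0_norm ?sqr_ge0// /quad.
apply: (@le_trans _ _ (\sum_(j < d) c0 ^+ 2 * (`|beta j| * `|freq gamma m j| ^+ 2))).
  rewrite -mulr_sumr ler_wpM2l ?sqr_ge0//; apply: (le_trans (ler_norm_sum _ _ _)).
  by apply: ler_sum => j _; rewrite normrM normrX.
have -> : Kz * fsize m * Om m =
    \sum_(j < d) c0 * `|beta j| / Num.sqrt (alpha j) * fsize m * Om m.
  by rewrite /Kz -mulrA mulr_suml; apply: eq_bigr => j _; rewrite mulrA.
apply: ler_sum => j _.
have sa : 0 < Num.sqrt (alpha j) by rewrite sqrtr_gt0.
have -> : c0 ^+ 2 * (`|beta j| * `|freq gamma m j| ^+ 2) =
   c0 * `|beta j| / Num.sqrt (alpha j) * `|freq gamma m j| *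
   (c0 * Num.sqrt (alpha j) * `|freq gamma m j|).
  by field; rewrite gt_eqF.
apply: ler_pM => //.
- by rewrite mulr_ge0// divr_ge0 ?sqrtr_ge0// mulr_ge0// ltW.
- by rewrite mulr_ge0// mulr_ge0 ?sqrtr_ge0// ltW.
- by rewrite ler_wpM2l ?freq_le// divr_ge0 ?sqrtr_ge0// mulr_ge0// ltW.
- exact: Om_freq.
Qed.

Definition zmult m : C := - 'i%C * (rz m)%:C.

Lemma normc_zmult m : normc (zmult m) = `|rz m|.
Proof. by rewrite normcM normcN normc_i mul1r normc_real. Qed.

Definition nextU (Z U : nat -> seq term) a :=
  opL (fun=> - 'i%C * lambda) (convL (fun b => symL (Z b)) U a).
Definition nextZ (U : nat -> seq term) a :=
  opL zmult (symL (convL U (fun b => conjL (U b)) a)).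

Definition stepF (X : nat -> seq term * seq term) (a : nat) : seq term * seq term :=
  if a is a'.+1 then
    (duhL om a' (nextU (fun b => (X b).2) (fun b => (X b).1) a'),
     duhL Om a' (nextZ (fun b => (X b).1) a'))
  else (dataL om U0, dataL Om Z0).

(** The recursion is a course-of-values one: the term a + 1 uses all earlier terms. Since [stepF]
    reads only strictly smaller indices, n iterations from the empty family fix the entries of index
    below n. *)
Definition approx n := iter n stepF (fun=> ([::], [::])).
Definition Ul a := (approx a.+1 a).1.
Definition Zl a := (approx a.+1 a).2.

Lemma eq_convL (F F' G G' : nat -> seq term) a :
  (forall b, (b <= a)%N -> F b = F' b) -> (forall b, (b <= a)%N -> G b = G' b) ->
  convL F G a = convL F' G' a.
Proof.
move=> h h'; congr flatten; apply/eq_in_map => b; rewrite mem_iota add0n => /= ba.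
by rewrite h// h'// leq_subr.
Qed.

Lemma eq_stepF X Y a : (forall b, (b < a)%N -> X b = Y b) -> stepF X a = stepF Y a.
Proof.
case: a => [|a] h //=; congr (duhL _ _ _, duhL _ _ _).
  by congr opL; apply: eq_convL => b ba; rewrite h.
by congr (opL _ (symL _)); apply: eq_convL => b ba; rewrite h.
Qed.

Lemma approx_stable n a : (a < n)%N -> approx n.+1 a = approx n a.
Proof.
elim: n a => [|n IH] a // an; rewrite [LHS]/approx iterS [RHS]/approx iterS.
by apply: eq_stepF => b ba; apply: IH; exact: (leq_trans ba).
Qed.

Lemma approx_eq n a : (a < n)%N -> approx n a = approx a.+1 a.
Proof.
elim: n => [|n IH] //; rewrite ltnS leq_eqVlt => /orP[/eqP->//|an].
by rewrite approx_stable// IH.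
Qed.

Lemma UZ_step a : (Ul a.+1, Zl a.+1) = stepF (fun b => (Ul b, Zl b)) a.+1.
Proof.
rewrite /Ul /Zl -surjective_pairing {1}/approx iterS -/(approx a.+1).
by apply: eq_stepF => b ba; rewrite -surjective_pairing approx_eq.
Qed.

Lemma Ul0 : Ul 0 = dataL om U0. Proof. by []. Qed.
Lemma Zl0 : Zl 0 = dataL Om Z0. Proof. by []. Qed.
Lemma UlS a : Ul a.+1 = duhL om a (nextU Zl Ul a).
Proof. by have := UZ_step a; case. Qed.
Lemma ZlS a : Zl a.+1 = duhL Om a (nextZ Ul a).
Proof. by have := UZ_step a; case. Qed.

(** [rho] is the time scale on which the expansion is geometric. [B] bounds more than the wave data:
    by [smallZ] it also dominates the wave created by the Schroedinger data, so it may have to be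
    positive even when [Z0] is empty. *)
Context (kap A B rho : R).
Context (kap_ge0 : 0 <= kap) (A_ge0 : 0 <= A) (B_ge0 : 0 <= B) (rho_gt0 : 0 < rho).
Context (sizeU : forall x, x \in U0 -> fsize x.2 <= kap)
  (sizeZ : forall x, x \in Z0 -> fsize x.2 <= kap)
  (massU0 : \sum_(x <- U0) normc x.1 <= A) (massZ0 : \sum_(x <- Z0) normc x.1 <= B)
  (smallU : 8 * normc lambda * rho * B <= 1)
  (smallZ : 16 * Kz * kap * rho * A ^+ 2 <= B).

Lemma graded_UZ a : graded gamma a (a.+1%:R * kap) (Ul a) /\ graded gamma a (a.+1%:R * kap) (Zl a).
Proof.
have [n] := ubnP a; elim: n a => [|n IH] // [|a] an.
  by rewrite Ul0 Zl0 mul1r; split; apply: graded_data.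
rewrite ltnS in an.
have hU b : (b <= a)%N -> graded gamma b (b.+1%:R * kap) (Ul b).
  by move=> ba; apply: (IH b _).1; exact: (leq_ltn_trans ba an).
have hZ b : (b <= a)%N -> graded gamma b (b.+1%:R * kap) (Zl b).
  by move=> ba; apply: (IH b _).2; exact: (leq_ltn_trans ba an).
rewrite UlS ZlS; split; apply: graded_duh; apply: graded_op; last apply: graded_sym.
  by apply: graded_conv => // b ba; apply: graded_sym; exact: hZ.
by apply: graded_conv => // b ba; apply: graded_conj; exact: hU.
Qed.

Let mU a := mass (Ul a).
Let mZ a := mass (Zl a).
Let mU_ge0 a : 0 <= mU a. Proof. exact: mass_ge0 (graded_UZ a).1. Qed.
Let mZ_ge0 a : 0 <= mZ a. Proof. exact: mass_ge0 (graded_UZ a).2. Qed.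

Let mU_rec a : mU a.+1 <= 2 * normc lambda * \sum_(b < a.+1) mZ b * mU (a - b)%N.
Proof.
have gr : graded gamma a (a.+2%:R * kap) (convL (fun b => symL (Zl b)) Ul a).
  apply: graded_conv => b _; last exact: (graded_UZ b).1.
  by apply: graded_sym; exact: (graded_UZ b).2.
rewrite /mU UlS mass_duh.
have h := @mass_op _ _ _ (fun=> - 'i%C * lambda) (normc lambda) _ _ _ gr.
have {}h : mass (nextU Zl Ul a) <= normc lambda * mass (convL (fun b => symL (Zl b)) Ul a).
  by apply: h => l _; rewrite normcM normcN normc_i mul1r.
have S0 : 0 <= normc lambda * mass (convL (fun b => symL (Zl b)) Ul a).
  by rewrite mulr_ge0 ?normc_ge0// (mass_ge0 gr).
have a1 : 2 / a.+1%:R <= 2 :> R by rewrite ler_pdivrMr// ler_pMr// ler1n.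
apply: (@le_trans _ _ (2 * (normc lambda * mass (convL (fun b => symL (Zl b)) Ul a)))).
  apply: ler_pM => //.
  exact: (mass_ge0 (graded_op (mu := fun=> - 'i%C * lambda) gr)).
rewrite mass_conv mulrA ler_wpM2l ?mulr_ge0 ?normc_ge0//.
by apply: ler_sum => b _; rewrite mass_sym.
Qed.

(** The loss of derivative is recovered here. On frequencies at most (a + 2) kap the multiplier
    costs Kz (a + 2) kap, while the time integration gains 2 / (a + 1); the product 2 (a + 2) / (a +
    1) is at most 4 for every a. *)
Let mZ_rec a : mZ a.+1 <= 4 * Kz * kap * \sum_(b < a.+1) mU b * mU (a - b)%N.
Proof.
have gr : graded gamma a (a.+2%:R * kap) (symL (convL Ul (fun b => conjL (Ul b)) a)).
  apply: graded_sym; apply: graded_conv => b _; first exact: (graded_UZ b).1.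
  by apply: graded_conj; exact: (graded_UZ b).1.
rewrite /mZ ZlS mass_duh.
have h := @mass_op _ _ _ zmult (Kz * (a.+2%:R * kap)) _ _ _ gr.
have {}h : mass (nextZ Ul a) <= Kz * (a.+2%:R * kap) * \sum_(b < a.+1) mU b * mU (a - b)%N.
  apply: (le_trans (h _)).
    move=> l lL; rewrite normc_zmult (le_trans (rz_le _))// ler_wpM2l ?Kz_ge0//.
    by have [] := gr l lL.
  rewrite mass_sym mass_conv ler_wpM2l ?mulr_ge0 ?Kz_ge0//.
  by apply: ler_sum => b _; rewrite mass_conj.
apply: (@le_trans _ _ (2 / a.+1%:R * (Kz * (a.+2%:R * kap) * \sum_(b < a.+1) mU b * mU (a - b)%N))).
  by rewrite ler_wpM2l ?divr_ge0.
rewrite [leLHS]mulrA ler_wpM2r//; first by apply: sumr_ge0 => b _; rewrite mulr_ge0.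
have -> : 2 / a.+1%:R * (Kz * (a.+2%:R * kap)) = (2 * a.+2%:R / a.+1%:R) * (Kz * kap) by ring.
have -> : 4 * Kz * kap = 4 * (Kz * kap) by ring.
rewrite ler_wpM2r ?mulr_ge0 ?Kz_ge0// ler_pdivrMr//.
by rewrite -!natrM ler_nat !mulnS !mulSn; lia.
Qed.

(* The partial sums X, Y satisfy X <= A + c1 X Y and Y <= B + c2 X^2, which keeps
   them below 2A and 2B. *)
Lemma mass_sum_le n : \sum_(a < n) mass (Ul a) * rho ^+ a <= 2 * A /\
                      \sum_(a < n) mass (Zl a) * rho ^+ a <= 2 * B.
Proof.
pose x a := mU a * rho ^+ a; pose y a := mZ a * rho ^+ a.
have x0 a : 0 <= x a by rewrite mulr_ge0// exprn_ge0// ltW.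
have y0 a : 0 <= y a by rewrite mulr_ge0// exprn_ge0// ltW.
have sc (f g : nat -> R) a : (\sum_(b < a.+1) f b * g (a - b)%N) * rho ^+ a =
    \sum_(b < a.+1) (f b * rho ^+ b) * (g (a - b)%N * rho ^+ (a - b)).
  rewrite mulr_suml; apply: eq_bigr => b _.
  have ba : (b <= a)%N by rewrite -ltnS.
  have -> : rho ^+ a = rho ^+ b * rho ^+ (a - b) by rewrite -exprD subnKC.
  by rewrite mulrACA.
have rx a : x a.+1 <= 2 * normc lambda * rho * \sum_(b < a.+1) y b * x (a - b)%N.
  have -> : x a.+1 = rho * (mU a.+1 * rho ^+ a) by rewrite /x exprS; ring.
  have -> : 2 * normc lambda * rho * (\sum_(b < a.+1) y b * x (a - b)%N) =
    rho * (2 * normc lambda * (\sum_(b < a.+1) mZ b * mU (a - b)%N) * rho ^+ a).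
    by rewrite -[X in _ = rho * X]mulrA sc; ring.
  rewrite ler_wpM2l ?(ltW rho_gt0)//; apply: ler_wpM2r; last exact: mU_rec.
  by rewrite exprn_ge0// ltW.
have ry a : y a.+1 <= 4 * Kz * kap * rho * \sum_(b < a.+1) x b * x (a - b)%N.
  have -> : y a.+1 = rho * (mZ a.+1 * rho ^+ a) by rewrite /y exprS; ring.
  have -> : 4 * Kz * kap * rho * (\sum_(b < a.+1) x b * x (a - b)%N) =
    rho * (4 * Kz * kap * (\sum_(b < a.+1) mU b * mU (a - b)%N) * rho ^+ a).
    by rewrite -mulrA -[X in _ = rho * X]mulrA sc; ring.
  rewrite ler_wpM2l ?(ltW rho_gt0)//; apply: ler_wpM2r; last exact: mZ_rec.
  by rewrite exprn_ge0// ltW.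
rewrite -/(\sum_(a < n) x a) -/(\sum_(a < n) y a).
elim: n => [|n [IHx IHy]]; first by rewrite !big_ord0 !mulr_ge0.
have X0 : 0 <= \sum_(a < n) x a by exact: sumr_ge0.
have Y0 : 0 <= \sum_(a < n) y a by exact: sumr_ge0.
rewrite !big_ord_recl /=; split.
  have h1 : x 0%N <= A by rewrite /x expr0 mulr1 /mU Ul0 mass_data.
  have h2 : \sum_(a < n) x (bump 0 a) <= 2 * normc lambda * rho * (2 * B * (2 * A)).
    apply: (@le_trans _ _ (\sum_(a < n) 2 * normc lambda * rho * \sum_(b < a.+1) y b * x (a - b)%N)).
      by apply: ler_sum => a _; exact: rx.
    rewrite -mulr_sumr ler_wpM2l ?mulr_ge0 ?normc_ge0 ?(ltW rho_gt0)//.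
    by apply: (le_trans (sum_conv_le _ y0 x0)); apply: ler_pM.
  have h3 : 2 * normc lambda * rho * (2 * B * (2 * A)) <= A.
    have -> : 2 * normc lambda * rho * (2 * B * (2 * A)) = (8 * normc lambda * rho * B) * A by ring.
    by rewrite -[leRHS]mul1r ler_wpM2r.
  lra.
have h1 : y 0%N <= B by rewrite /y expr0 mulr1 /mZ Zl0 mass_data.
have h2 : \sum_(a < n) y (bump 0 a) <= 4 * Kz * kap * rho * (2 * A * (2 * A)).
  apply: (@le_trans _ _ (\sum_(a < n) 4 * Kz * kap * rho * \sum_(b < a.+1) x b * x (a - b)%N)).
    by apply: ler_sum => a _; exact: ry.
  rewrite -mulr_sumr ler_wpM2l ?mulr_ge0 ?Kz_ge0 ?(ltW rho_gt0)//.
  by apply: (le_trans (sum_conv_le _ x0 x0)); apply: ler_pM.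
have h3 : 4 * Kz * kap * rho * (2 * A * (2 * A)) <= B by apply: le_trans smallZ; lra.
lra.
Qed.

Lemma mass_UZ_le a : mass (Ul a) <= 2 * A / rho ^+ a /\ mass (Zl a) <= 2 * B / rho ^+ a.
Proof.
have [h1 h2] := mass_sum_le a.+1; have r0 : 0 < rho ^+ a by rewrite exprn_gt0.
rewrite !ler_pdivlMr//; split; [apply: le_trans h1|apply: le_trans h2];
  rewrite big_ord_recr/= lerDr; apply: sumr_ge0 => b _; rewrite mulr_ge0 ?exprn_ge0 ?(ltW rho_gt0)//.
  exact: mU_ge0.
exact: mZ_ge0.
Qed.

End Recursion.

(** * The expansion solves the Zakharov system *)

Section DerivativesOfLists.
Context {R : realType} {d : nat} (gamma : 'I_d -> {posnum R}) (tau : R).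
Local Notation C := R[i].
Local Notation lattice := {ffun 'I_d -> int}.
Local Notation term := ((R -> C) * R * lattice)%type.
Local Notation spacetime := (R * 'rV[R]_d)%type.
Local Notation Ev := (Ev gamma).
Local Notation derL := (derL gamma).
Local Notation tame := (tame gamma tau).
Local Notation slab := (@slab R d tau).
Local Notation Evs := (Evs gamma).
Implicit Types (L : seq term) (F G : nat -> seq term) (mu : lattice -> C)
  (phi : lattice -> R) (p v : spacetime).

Definition pbounded mu := exists k : R, exists e : nat,
  0 <= k /\ forall m, normc (mu m) <= k * (1 + fsize gamma m) ^+ e.

Lemma pboundedM mu nu : pbounded mu -> pbounded nu -> pbounded (fun m => mu m * nu m).
Proof.
move=> [k [e [k0 h]]] [k' [e' [k0' h']]]; exists (k * k'), (e + e')%N; split.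
  by rewrite mulr_ge0.
by move=> m; rewrite normcM exprD mulrACA; apply: ler_pM; rewrite ?normc_ge0.
Qed.

Lemma pbounded_cst (k : C) : pbounded (fun=> k).
Proof. by exists (normc k), 0%N; split; [exact: normc_ge0|move=> m; rewrite expr0 mulr1]. Qed.

Lemma pbounded_quad (a : 'I_d -> R) : pbounded (fun m => (quad gamma a m)%:C).
Proof.
exists (\sum_(j < d) `|a j|), 2; split; first exact: sumr_ge0.
move=> m; rewrite normc_real mulr_suml; apply: (le_trans (ler_norm_sum _ _ _)).
apply: ler_sum => j _; rewrite normrM ler_wpM2l// normrX.
apply: lerXn2r; rewrite ?nnegrE ?addr_ge0 ?fsize_ge0//.
by apply: (le_trans (freq_le _ _ _)); rewrite lerDr.
Qed.

Lemma pbounded_freq (j : 'I_d) : pbounded (fun m => 0 +i* freq gamma m j).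
Proof.
exists 1, 1%N; split=> // m; rewrite expr1 mul1r.
rewrite /normc expr0n/= add0r sqrtr_sqr; apply: (le_trans (freq_le _ _ _)).
by rewrite lerDr.
Qed.

Lemma pbounded_le mu nu : pbounded nu -> (forall m, normc (mu m) <= normc (nu m)) -> pbounded mu.
Proof. by move=> [k [e [k0 h]]] hm; exists k, e; split=> // m; exact: le_trans (h m). Qed.

Lemma tame_opp mu F : pbounded mu -> tame F -> tame (fun a => opL mu (F a)).
Proof. by move=> [k [e [k0 h]]]; exact: (tame_op k0 h). Qed.

Lemma Ev_op_derL_x mu j L p : Ev (opL mu (derL (dir_x j) L)) p =
  Ev (opL (fun m => mu m * (0 +i* freq gamma m j)) L) p.
Proof.
rewrite /Ev !big_map; apply: eq_bigr => l _ /=.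
by rewrite phase_e rmorph0 mul0r add0r !mulrA.
Qed.

Lemma Ev_derL_x j L p : Ev (derL (dir_x j) L) p = Ev (opL (fun m => 0 +i* freq gamma m j) L) p.
Proof.
rewrite -[LHS]Ev_op1 Ev_op_derL_x; congr (Ev (opL _ _) _).
by apply/funext => m; rewrite mul1r.
Qed.

Lemma phase0 (m : lattice) : phase gamma m 0 = 0.
Proof. by rewrite /phase big1// => j _; rewrite mxE mulr0. Qed.

Lemma Ev_op_derL_data mu phi D p :
  Ev (opL mu (derL (@dir_t R d) (dataL phi D))) p =
  Ev (opL (fun m => mu m * (0 -i* phi m)) (dataL phi D)) p.
Proof.
rewrite /Ev !big_map; apply: eq_bigr => x _ /=; rewrite phase0.
rewrite (cD_val (cDM (cDcis (- phi x.2) 0 p.1) (cDcst x.1 p.1))).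
by rewrite rmorph1 (_ : 0 +i* 0 = 0)//; ring.
Qed.

Lemma Ev_op_derL_duh mu phi a L p : smoothL L ->
  Ev (opL mu (derL (@dir_t R d) (duhL phi a L))) p =
  Ev (opL (fun m => mu m * (0 -i* phi m)) (duhL phi a L)) p + Ev (opL mu L) p.
Proof.
move=> sL; rewrite /Ev !big_map -big_split big_seq [RHS]big_seq.
apply: eq_bigr => l lL /=; rewrite phase0.
have [_ h] := duh_spec (phi l.2) (smn0 (sL l lL 0%N)).
rewrite (cD_val (h p.1)) rmorph1 (_ : 0 +i* 0 = 0)//; ring.
Qed.

Lemma Ev_derL_op v mu L p : smoothL L -> Ev (derL v (opL mu L)) p = Ev (opL mu (derL v L)) p.
Proof.
move=> sL; rewrite /Ev !big_map big_seq [RHS]big_seq.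
apply: eq_bigr => l lL /=.
have h := cdiffP (smn0 (sL l lL 0%N) p.1).
by rewrite (cD_val (cDM (cDcst (mu l.2) p.1) h)); ring.
Qed.

(** Each term solves its own linear equation, forced by the source of the previous grade. Summation
    over all grades shifts the index and restores the full source. *)
Lemma S_dt mu phi D F G p :
  F 0%N = dataL phi D -> (forall a, F a.+1 = duhL phi a (G a)) ->
  pbounded mu -> pbounded (fun m => 0 -i* phi m) -> tame F -> tame G -> slab p ->
  Evs (fun a => opL mu (derL (@dir_t R d) (F a))) p =
  Evs (fun a => opL (fun m => mu m * (0 -i* phi m)) (F a)) p + Evs (fun a => opL mu (G a)) p.
Proof.
move=> F0 FS bm bphi tF tG pt.
have t1 : tame (fun a => opL mu (derL (@dir_t R d) (F a))).
  by apply: tame_opp => //; exact: tame_der.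
have t2 : tame (fun a => opL (fun m => mu m * (0 -i* phi m)) (F a)).
  by apply: tame_opp => //; exact: pboundedM.
have t3 : tame (fun a => opL mu (G a)) by exact: tame_opp.
have t2' : tame (fun a => opL (fun m => mu m * (0 -i* phi m)) (F a.+1)) by exact: (tame_shift t2).
rewrite (S_recl t1 pt) (S_recl t2 pt) -addrA -(S_cat t2' t3 pt) F0 Ev_op_derL_data.
congr (_ + _); apply: eq_S => a; rewrite Ev_cat FS Ev_op_derL_duh//.
by case: tG => sG _ _; exact: sG.
Qed.

Lemma cderive_near v (f g : spacetime -> C) p :
  (\forall q \near p, f q = g q) -> cderive v f p = cderive v g p.
Proof.
move=> h; rewrite /cderive; congr (_ +i* _); apply: near_eq_derive;
  by apply: filterS h => q ->.
Qed.

Lemma cderive_S v F p : tame F -> slab p ->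
  cderive v (Evs F) p = Evs (fun a => derL v (F a)) p.
Proof.
by move=> tF pt; have [[_ e1] [_ e2]] := S_is_derive v tF pt;
  apply: complex_eq; rewrite /= ?e1 ?e2.
Qed.

Lemma derive_Re_S v F p : tame F -> slab p ->
  'D_v (fun q => complex.Re (Evs F q)) p = complex.Re (Evs (fun a => derL v (F a)) p).
Proof. by move=> tF pt; have [[_ e1] _] := S_is_derive v tF pt. Qed.

(** The induction carries polynomial boundedness of the partial sums of multipliers along with the
    identity, as it is what keeps the families tame. *)
Lemma S_op_sum (a : 'I_d -> C) (mu : 'I_d -> lattice -> C) F p :
  (forall j, pbounded (mu j)) -> tame F -> slab p ->
  \sum_(j < d) a j * Evs (fun b => opL (mu j) (F b)) p =
  Evs (fun b => opL (fun m => \sum_(j < d) a j * mu j m) (F b)) p.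
Proof.
move=> bm tF pt.
have gen (r : seq 'I_d) : pbounded (fun m => \sum_(j <- r) a j * mu j m) /\
   \sum_(j <- r) a j * Evs (fun b => opL (mu j) (F b)) p =
   Evs (fun b => opL (fun m => \sum_(j <- r) a j * mu j m) (F b)) p.
  elim: r => [|j r [[k [e [k0 hk]]] IH]].
    have E : (fun m => \sum_(j <- [::]) a j * mu j m) = fun=> 0.
      by apply/funext => m; rewrite big_nil.
    rewrite E; split; first exact: pbounded_cst.
    rewrite big_nil -[LHS](@csum0 R); congr csum; apply/funext => b.
    by rewrite Ev_op_cst mul0r.
  have E : (fun m => \sum_(j0 <- j :: r) a j0 * mu j0 m) =
      fun m => a j * mu j m + \sum_(j0 <- r) a j0 * mu j0 m.
    by apply/funext => m; rewrite big_cons.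
  have [k' [e' [k0' hk']]] : pbounded (fun m => a j * mu j m).
    by apply: pboundedM => //; exact: pbounded_cst.
  split; rewrite E.
    exists (k + k'), (e + e')%N; split; first by rewrite addr_ge0.
    move=> m; have s1 : 1 <= 1 + fsize gamma m by rewrite lerDl fsize_ge0.
    apply: (le_trans (le_normcD _ _)); rewrite addrC mulrDl; apply: lerD.
      by apply: (le_trans (hk m)); rewrite ler_wpM2l// ler_weXn2l// leq_addr.
    by apply: (le_trans (hk' m)); rewrite ler_wpM2l// ler_weXn2l// leq_addl.
  rewrite big_cons IH -(S_opZ (tau := tau))//; last by apply: tame_opp.
  rewrite -(S_cat (tau := tau))//; last 2 first.
  - by apply: tame_opp => //; exists k', e'.
  - by apply: tame_opp => //; exists k, e.
  by apply: eq_S => b; rewrite Ev_cat Ev_opD.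
by have [_ ->] := gen (index_enum 'I_d).
Qed.

Lemma S_derL_xx j F p :
  Evs (fun a => derL (dir_x j) (derL (dir_x j) (F a))) p =
  Evs (fun a => opL (fun m => - (freq gamma m j ^+ 2)%:C) (F a)) p.
Proof.
apply: eq_S => a; rewrite Ev_derL_x Ev_op_derL_x; congr (Ev (opL _ _) _).
by apply/funext => m; apply: complex_eq; rewrite ?Re_M ?Im_M/=; ring.
Qed.

Lemma pbounded_freq2 j : pbounded (fun m => - (freq gamma m j ^+ 2)%:C).
Proof.
apply: (pbounded_le (pboundedM (pbounded_freq j) (pbounded_freq j))) => m.
rewrite normcN normcM normc_real /normc expr0n/= add0r sqrtr_sqr.
by rewrite normrX expr2.
Qed.

Lemma quad_sumE (a : 'I_d -> R) :
  (fun m => \sum_(j < d) (a j)%:C * - (freq gamma m j ^+ 2)%:C) =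
  (fun m => - (quad gamma a m)%:C).
Proof.
apply/funext => m; rewrite /quad rmorph_sum -sumrN; apply: eq_bigr => j _.
by apply: complex_eq; rewrite ?Re_M ?Im_M/=; ring.
Qed.

Lemma claplacian_S (a : 'I_d -> R) F p : tame F -> slab p ->
  claplacian a (Evs F) p = Evs (fun b => opL (fun m => - (quad gamma a m)%:C) (F b)) p.
Proof.
move=> tF pt; rewrite /claplacian -quad_sumE -S_op_sum//; last exact: pbounded_freq2.
apply: eq_bigr => j _; congr (_ * _); rewrite -S_derL_xx.
rewrite -cderive_S//; last exact: tame_der.
apply: cderive_near; near=> q; apply: cderive_S => //.
by near: q; exact: slab_nbhs.
Unshelve. all: by end_near. Qed.

Lemma laplacian_S (a : 'I_d -> R) (f : spacetime -> R) F p : tame F -> slab p ->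
  (forall q, slab q -> f q = complex.Re (Evs F q)) ->
  laplacian a f p = - complex.Re (Evs (fun b => opL (fun m => (quad gamma a m)%:C) (F b)) p).
Proof.
move=> tF pt hf.
have -> : - complex.Re (Evs (fun b => opL (fun m => (quad gamma a m)%:C) (F b)) p) =
    complex.Re (Evs (fun b => opL (fun m => - (quad gamma a m)%:C) (F b)) p).
  have -> : (fun m => - (quad gamma a m)%:C) = (fun m => (-1) * (quad gamma a m)%:C).
    by apply/funext => m; rewrite mulN1r.
  rewrite (S_opZ (tau := tau))//; last by apply: tame_opp => //; exact: pbounded_quad.
  by rewrite mulN1r; case: (Evs _ p).
rewrite -quad_sumE -S_op_sum//; last exact: pbounded_freq2.
rewrite Re_sum; apply: eq_bigr => j _.
rewrite Re_M [complex.Im (a j)%:C]/= [complex.Re (a j)%:C]/= mul0r subr0; congr (_ * _).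
rewrite -S_derL_xx -derive_Re_S//; last exact: tame_der.
apply: near_eq_derive; near=> q.
have qt : slab q by near: q; exact: slab_nbhs.
rewrite -derive_Re_S//; apply: near_eq_derive; near=> q'; apply: hf.
by near: q'; exact: slab_nbhs.
Unshelve. all: by end_near. Qed.

End DerivativesOfLists.

Section Solution.
Context {R : realType} {d : nat} (gamma : 'I_d -> {posnum R}) (lambda : R[i])
  (c0 : R) (alpha beta : 'I_d -> R) (U0 Z0 : seq (R[i] * {ffun 'I_d -> int})).
Local Notation C := R[i].
Local Notation lattice := {ffun 'I_d -> int}.
Local Notation term := ((R -> C) * R * lattice)%type.
Local Notation spacetime := (R * 'rV[R]_d)%type.
Context (c0_gt0 : 0 < c0) (alpha_gt0 : forall j, 0 < alpha j).
Context (kap A B rho tau : R).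
Context (kap_ge0 : 0 <= kap) (A_ge0 : 0 <= A) (B_ge0 : 0 <= B) (rho_gt0 : 0 < rho).
Context (sizeU : forall x, x \in U0 -> fsize gamma x.2 <= kap)
  (sizeZ : forall x, x \in Z0 -> fsize gamma x.2 <= kap)
  (massU0 : \sum_(x <- U0) normc x.1 <= A) (massZ0 : \sum_(x <- Z0) normc x.1 <= B)
  (smallU : 8 * normc lambda * rho * B <= 1)
  (smallZ : 16 * Kz c0 alpha beta * kap * rho * A ^+ 2 <= B)
  (tau_le : tau <= rho / 2).

Local Notation Ul := (Ul gamma lambda c0 alpha beta U0 Z0).
Local Notation Zl := (Zl gamma lambda c0 alpha beta U0 Z0).
Local Notation om := (om gamma alpha).
Local Notation Om := (Om gamma c0 alpha).
Local Notation rz := (rz gamma c0 alpha beta).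
Local Notation tame := (tame gamma tau).
Local Notation slab := (@slab R d tau).
Local Notation Evs := (Evs gamma).
Local Notation nextU := (nextU lambda Zl Ul).
Local Notation nextZ := (nextZ gamma c0 alpha beta Ul).
Local Notation Q := (convL Ul (fun b => conjL (Ul b))).

Let gU a : graded gamma a (a.+1%:R * kap) (Ul a).
Proof. by have [] := graded_UZ lambda c0 alpha beta sizeU sizeZ a. Qed.
Let gZ a : graded gamma a (a.+1%:R * kap) (Zl a).
Proof. by have [] := graded_UZ lambda c0 alpha beta sizeU sizeZ a. Qed.
Let sU a : smoothL (Ul a). Proof. by move=> l lU; have [] := gU lU. Qed.
Let sZ a : smoothL (Zl a). Proof. by move=> l lZ; have [] := gZ lZ. Qed.
Let bU : fsize_bound gamma kap Ul.
Proof. by move=> a l lU; rewrite mulrC; have [] := gU lU. Qed.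
Let bZ : fsize_bound gamma kap Zl.
Proof. by move=> a l lZ; rewrite mulrC; have [] := gZ lZ. Qed.

Lemma Ev_UZ_le a (p : spacetime) :
  normc (Ev gamma (Ul a) p) <= 2 * A * (`|p.1| / rho) ^+ a /\
  normc (Ev gamma (Zl a) p) <= 2 * B * (`|p.1| / rho) ^+ a.
Proof.
have [h1 h2] := mass_UZ_le c0_gt0 alpha_gt0 kap_ge0 A_ge0 B_ge0 rho_gt0 sizeU sizeZ
  massU0 massZ0 smallU smallZ a.
have r0 : 0 < rho ^+ a by rewrite exprn_gt0.
split; apply: (le_trans (Ev_le _ _ _)).
  apply: (le_trans (NM0_graded _ (@gU a))); apply: (le_trans (ler_wpM2r _ h1)) => //.
  by rewrite expr_div_n mulrA mulrAC.
apply: (le_trans (NM0_graded _ (@gZ a))); apply: (le_trans (ler_wpM2r _ h2)) => //.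
by rewrite expr_div_n mulrA mulrAC.
Qed.

(** The condition [tau_le] turns (|t| / rho)^a into the geometric factor 2^(-a). *)
Let grow0 (F : nat -> seq term) (D : R) : 0 <= D -> (forall a, graded gamma a (a.+1%:R * kap) (F a)) ->
  (forall a, mass (F a) <= D / rho ^+ a) -> grow tau 0 F.
Proof.
move=> D0 gF mF; exists (fun a => D * 2^-1 ^+ a).
  by exists D, 2^-1; split=> //; [lra|move=> a; rewrite ger0_norm// mulr_ge0// exprn_ge0].
move=> a t tt; apply: (le_trans (NM0_graded _ (gF a))).
have r0 : 0 < rho ^+ a by rewrite exprn_gt0.
apply: (le_trans (ler_wpM2r _ (mF a))) => //.
rewrite -mulrA ler_wpM2l// mulrC ler_pdivrMr// -exprMn; apply: lerXn2r; rewrite ?nnegrE//.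
  by rewrite mulr_ge0// ltW.
by apply: ltW; apply: (lt_le_trans tt); apply: (le_trans tau_le); rewrite mulrC.
Qed.

Lemma pbounded_om : pbounded gamma (fun m => 0 -i* om m).
Proof.
apply: (pbounded_le (pbounded_quad gamma alpha)) => m.
by rewrite normc_real /normc expr0n/= add0r sqrtr_sqr normrN.
Qed.

Lemma pbounded_Om : pbounded gamma (fun m => 0 -i* Om m).
Proof.
have [k [e [k0 h]]] := pbounded_quad gamma alpha.
exists (c0 * (1 + k)), e; split; first by rewrite mulr_ge0 ?(ltW c0_gt0)// addr_ge0.
move=> m; rewrite /normc expr0n/= add0r sqrtr_sqr normrN ger0_norm; last exact: Om_ge0.
rewrite /Om -mulrA ler_wpM2l ?(ltW c0_gt0)//.
have o0 := om_ge0 gamma alpha_gt0 m.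
apply: (@le_trans _ _ (1 + om m)).
  rewrite -ler_sqr ?nnegrE ?sqrtr_ge0 ?addr_ge0// sqr_sqrtr//; nra.
rewrite mulrDl mul1r; apply: lerD.
  by rewrite exprn_ege1// lerDl fsize_ge0.
by apply: le_trans (h m); rewrite normc_real ler_norm.
Qed.

Lemma pbounded_rz : pbounded gamma (fun m => (rz m)%:C).
Proof.
exists (Kz c0 alpha beta), 1%N; split; first exact: Kz_ge0.
move=> m; rewrite normc_real expr1; apply: (le_trans (rz_le _ _ _ _ _)) => //.
by rewrite ler_wpM2l ?Kz_ge0// lerDr.
Qed.

Lemma pbounded_zmult : pbounded gamma (zmult gamma c0 alpha beta).
Proof.
by apply: pboundedM; [exact: pbounded_cst|exact: pbounded_rz].
Qed.

(** Order 0 comes from the masses. Then [NM_duh] trades one time derivative for a multiplier and the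
    source at order r; both unknowns go together since the sources couple them. *)
Let growUZ r : grow tau r Ul /\ grow tau r Zl.
Proof.
have hm a := mass_UZ_le c0_gt0 alpha_gt0 kap_ge0 A_ge0 B_ge0 rho_gt0 sizeU sizeZ
  massU0 massZ0 smallU smallZ a.
have g0U : grow tau 0 Ul.
  apply: (grow0 (D := 2 * A)) => [||a]; [by rewrite mulr_ge0|exact: gU|].
  by have [] := hm a.
have g0Z : grow tau 0 Zl.
  apply: (grow0 (D := 2 * B)) => [||a]; [by rewrite mulr_ge0|exact: gZ|].
  by have [] := hm a.
have gop mu (K : R) r' F : pbounded gamma mu -> 0 <= K -> (forall a, smoothL (F a)) ->
    fsize_bound gamma K F -> grow tau r' F -> grow tau r' (fun a => opL mu (F a)).
  by move=> [k [e [k0 h]]] K0; exact: (grow_op k0 K0 h).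
have sym_s a : smoothL (symL (Zl a)) by exact: smooth_sym.
have conj_s a : smoothL (conjL (Ul a)) by exact: smooth_conj.
elim: r => [|r [IHU IHZ]] //.
have shiftg r' (F : nat -> seq term) : grow tau r' F -> grow tau r' (fun a => F a.+1).
  by move=> [g gg hg]; exists (fun a => g a.+1); [exact: geo_shift|move=> a t tt; exact: hg].
have gsum (F G H K : nat -> seq term) : grow tau 0 F -> grow tau r G -> grow tau r H ->
   (forall a t, NM r.+1 (K a) t <= NM 0 (F a) t + NM r (G a) t + NM r (H a) t) ->
   grow tau r.+1 K.
  move=> [f gf hf] [g gg hg] [h gh hh] le.
  exists (fun a => f a + g a + h a); first by apply: geoD => //; exact: geoD.
  by move=> a t tt; apply: (le_trans (le a t)); rewrite !lerD ?hf ?hg ?hh.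
split; apply: grow_unshift; do ?exact: NM_data.
  apply: (gsum (fun a => Ul a.+1) (fun a => opL (fun m => 0 -i* om m) (Ul a.+1)) nextU).
  - exact: shiftg.
  - refine (@shiftg r (fun a => opL (fun m => 0 -i* om m) (Ul a)) _); apply: (gop _ kap) => //; exact: pbounded_om.
  - apply: (gop _ (kap + kap)); rewrite ?addr_ge0//; first exact: pbounded_cst.
    + by move=> a; exact: smooth_conv.
    + by apply: fsize_bound_conv => //; exact: fsize_bound_sym.
    + by apply: grow_conv => //; exact: grow_sym.
  - move=> a t; rewrite UlS; apply: NM_duh.
    by apply: smooth_op; exact: smooth_conv.
apply: (gsum (fun a => Zl a.+1) (fun a => opL (fun m => 0 -i* Om m) (Zl a.+1)) nextZ).
- exact: shiftg.
- refine (@shiftg r (fun a => opL (fun m => 0 -i* Om m) (Zl a)) _); apply: (gop _ kap) => //; exact: pbounded_Om.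
- apply: (gop _ (kap + kap)); rewrite ?addr_ge0//; first exact: pbounded_zmult.
  + by move=> a; apply: smooth_sym; exact: smooth_conv.
  + by apply: fsize_bound_sym; apply: fsize_bound_conv => //; exact: fsize_bound_conj.
  + apply: grow_sym; first by move=> a; exact: smooth_conv.
    by apply: grow_conv => //; exact: grow_conj.
- move=> a t; rewrite ZlS; apply: NM_duh.
  by apply: smooth_op; apply: smooth_sym; exact: smooth_conv.
Qed.

Lemma tame_U : tame Ul.
Proof.
split; [exact: sU|by exists kap; [exact: kap_ge0|exact: bU]|by move=> r; have [] := growUZ r].
Qed.

Lemma tame_Z : tame Zl.
Proof.
split; [exact: sZ|by exists kap; [exact: kap_ge0|exact: bZ]|by move=> r; have [] := growUZ r].
Qed.

Lemma tame_Q : tame Q.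
Proof. by apply: tame_conv; [exact: tame_U|apply: tame_conj; exact: tame_U]. Qed.

Definition uS : spacetime -> C := Evs Ul.
Definition nS (p : spacetime) : R := complex.Re (Evs Zl p).

Lemma tame_nextU : tame nextU.
Proof.
apply: tame_opp; first exact: pbounded_cst.
by apply: tame_conv; [apply: tame_sym; exact: tame_Z|exact: tame_U].
Qed.

Lemma tame_nextZ : tame nextZ.
Proof. by apply: tame_opp; [exact: pbounded_zmult|apply: tame_sym; exact: tame_Q]. Qed.

Lemma schroedinger p : slab p ->
  'i%C * cderive (@dir_t R d) uS p + claplacian alpha uS p =
  lambda * (nS p)%:C * uS p.
Proof.
move=> pt; have tU := tame_U; have tZ := tame_Z.
rewrite (claplacian_S (tau := tau))// (cderive_S (tau := tau))//.
have -> : Evs (fun a => derL gamma (@dir_t R d) (Ul a)) p =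
    Evs (fun a => opL (fun=> 1) (derL gamma (@dir_t R d) (Ul a))) p.
  by apply: eq_S => a; rewrite Ev_op1.
rewrite (S_dt (Ul0 gamma lambda c0 alpha beta U0 Z0) (UlS gamma lambda c0 alpha beta U0 Z0)
  (pbounded_cst gamma 1) pbounded_om tU tame_nextU pt).
have -> : (fun m => 1 * (0 -i* om m)) = (fun m => - 'i%C * (om m)%:C).
  by apply/funext => m; apply: complex_eq; rewrite ?Re_M ?Im_M/=; ring.
have -> : (fun m => - (quad gamma alpha m)%:C) = (fun m => (-1) * (om m)%:C).
  by apply/funext => m; rewrite mulN1r.
have tO : tame (fun a => opL (fun m => (om m)%:C) (Ul a)).
  by apply: tame_opp => //; exact: pbounded_quad.
rewrite !(S_opZ (tau := tau))//.
have -> : Evs (fun a => opL (fun=> 1) (nextU a)) p = - 'i%C * lambda * ((nS p)%:C * uS p).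
  rewrite -S_sym -(S_conv (tau := tau))//; last exact: tame_sym.
  rewrite -csumZ; last exact: (S_geo (tame_conv (tame_sym tZ) tU) pt).
  by congr csum; apply/funext => a; rewrite Ev_op1 Ev_op_cst.
have ii : 'i%C * 'i%C = -1 :> C by rewrite -expr2 sqr_i.
by rewrite mulrDr !mulrA !mulrN ii; ring.
Qed.

(** The source of z does not show in the time derivative of n: it is - i times a real even
    multiplier applied to the real function |u|^2, so its real part vanishes. *)
Lemma D_t_nS p : slab p -> 'D_(@dir_t R d) nS p =
  complex.Re (Evs (fun a => opL (fun m => 0 -i* Om m) (Zl a)) p).
Proof.
move=> pt; have tZ := tame_Z; have tQ := tame_Q.
rewrite (derive_Re_S (tau := tau))//.
have -> : Evs (fun a => derL gamma (@dir_t R d) (Zl a)) p =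
    Evs (fun a => opL (fun=> 1) (derL gamma (@dir_t R d) (Zl a))) p.
  by apply: eq_S => a; rewrite Ev_op1.
rewrite (S_dt (Zl0 gamma lambda c0 alpha beta U0 Z0) (ZlS gamma lambda c0 alpha beta U0 Z0)
  (pbounded_cst gamma 1) pbounded_Om tZ tame_nextZ pt).
have -> : (fun m => 1 * (0 -i* Om m)) = (fun m => 0 -i* Om m).
  by apply/funext => m; rewrite mul1r.
rewrite Re_D; set X := complex.Re _; rewrite -[RHS]addr0; congr (_ + _).
have -> : Evs (fun a => opL (fun=> 1) (nextZ a)) p =
    Evs (fun a => opL (zmult gamma c0 alpha beta) (symL (Q a))) p.
  by apply: eq_S => a; rewrite Ev_op1.
rewrite (S_opZ (tau := tau))//; last by apply: tame_opp; [exact: pbounded_rz|exact: tame_sym].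
rewrite S_op_sym; first by rewrite Re_M/=; ring.
by move=> m; rewrite rzN /conjc/= oppr0.
Qed.

(** At the second time derivative the source is multiplied by - i Om. The two factors - i and the
    identity [rz_Om] turn it into the real term - c0^2 b(D) |u|^2. *)
Lemma wave p : slab p ->
  (c0 ^+ 2)^-1 * 'D_(@dir_t R d) ('D_(@dir_t R d) nS) p - laplacian alpha nS p =
  laplacian beta (fun q => normc (uS q) ^+ 2) p.
Proof.
move=> pt; have tU := tame_U; have tZ := tame_Z; have tQ := tame_Q.
have tsQ := tame_sym tQ.
have sqE q : slab q -> normc (uS q) ^+ 2 = complex.Re (Evs (fun a => symL (Q a)) q).
  move=> qt; rewrite S_sym (S_conv (tau := tau))//; last exact: tame_conj.
  by rewrite (S_conj (tau := tau))// normcE_sqr Re_M Re_J Im_J/=; rewrite -/uS; ring.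
rewrite (laplacian_S beta tsQ pt sqE).
rewrite (laplacian_S alpha (f := nS) tZ pt (fun q _ => erefl)).
have tOZ : tame (fun a => opL (fun m => 0 -i* Om m) (Zl a)).
  by apply: tame_opp => //; exact: pbounded_Om.
have -> : 'D_(@dir_t R d) ('D_(@dir_t R d) nS) p =
    'D_(@dir_t R d) (fun q => complex.Re (Evs (fun a => opL (fun m => 0 -i* Om m) (Zl a)) q)) p.
  apply: near_eq_derive; near=> q; apply: D_t_nS.
  by near: q; exact: slab_nbhs.
rewrite (derive_Re_S (tau := tau))//.
have -> : Evs (fun a => derL gamma (@dir_t R d) (opL (fun m => 0 -i* Om m) (Zl a))) p =
    Evs (fun a => opL (fun m => 0 -i* Om m) (derL gamma (@dir_t R d) (Zl a))) p.
  by apply: eq_S => a; rewrite Ev_derL_op.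
rewrite (S_dt (Zl0 gamma lambda c0 alpha beta U0 Z0) (ZlS gamma lambda c0 alpha beta U0 Z0)
  pbounded_Om pbounded_Om tZ tame_nextZ pt).
have -> : (fun m => (0 -i* Om m) * (0 -i* Om m)) =
    (fun m => (- c0 ^+ 2)%:C * (quad gamma alpha m)%:C).
  apply/funext => m; rewrite -rmorphM mulNr -(Om_sqr gamma c0 alpha_gt0).
  by apply: complex_eq; rewrite ?Re_M ?Im_M/=; ring.
rewrite (S_opZ (tau := tau))//; last by apply: tame_opp => //; exact: pbounded_quad.
have -> : Evs (fun a => opL (fun m => 0 -i* Om m) (nextZ a)) p =
    Evs (fun a => opL (fun m => (- c0 ^+ 2)%:C * (quad gamma beta m)%:C) (symL (Q a))) p.
  apply: eq_S => a; rewrite Ev_op_op; congr (Ev _ (opL _ _) _); apply/funext => m.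
  rewrite -rmorphM mulNr -(rz_Om gamma beta c0_gt0 alpha_gt0) /zmult.
  by apply: complex_eq; rewrite ?Re_M ?Im_M/=; ring.
rewrite (S_opZ (tau := tau))//; last by apply: tame_opp => //; exact: pbounded_quad.
have c02 : c0 ^+ 2 != 0 by rewrite expf_neq0// gt_eqF.
rewrite Re_D !Re_M /= !mul0r !subr0 opprK -mulrDr mulrA mulrN mulVf// mulN1r.
by rewrite opprD addrAC addNr add0r.
Unshelve. all: by end_near. Qed.

Lemma S_periodic F (t : R) : torus_periodic gamma (fun x => Evs F (t, x)).
Proof.
move=> j x; congr csum; apply/funext => a; rewrite /Ev; apply: eq_bigr => l _; congr (_ * _).
rewrite /= addrC phase_line phase_e.
have -> : freq gamma l.2 j * (2 * pi * (gamma j)%:num) + phase gamma l.2 x =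
   phase gamma l.2 x + 2 * pi * (l.2 j)%:~R.
  by rewrite /freq addrC; congr (_ + _); field.
exact: cis_pi2.
Qed.

(** Every term with an interaction is a Duhamel integral and vanishes at time 0. *)
Lemma S_at0 (mu : lattice -> C) (phi : lattice -> R) F (G : nat -> seq term) D (x : 'rV[R]_d) :
  F 0%N = dataL phi D -> (forall a, F a.+1 = duhL phi a (G a)) ->
  (forall a, smoothL (G a)) -> tame (fun a => opL mu (F a)) -> 0 < tau ->
  Evs (fun a => opL mu (F a)) (0, x) = \sum_(y <- D) mu y.2 * y.1 * cis (phase gamma y.2 x).
Proof.
move=> F0 FS sG tF tau0; rewrite (S_recl tF); last by rewrite /= normr0.
rewrite F0 /Ev !big_map /=.
have -> : Evs (fun a => opL mu (F a.+1)) (0, x) = 0.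
  rewrite -[RHS](@csum0 R); congr csum; apply/funext => a; rewrite FS /Ev !big_map.
  rewrite big_seq big1// => l lG /=.
  by have [-> _] := duh_spec (phi l.2) (smn0 (sG a l lG 0%N)); rewrite mulr0 mul0r.
by rewrite addr0; apply: eq_bigr => y _; rewrite mulr0 addr0 cis0 mul1r.
Qed.

Definition u_init (x : 'rV[R]_d) : C := \sum_(y <- U0) y.1 * cis (phase gamma y.2 x).
Definition n_init (x : 'rV[R]_d) : R :=
  complex.Re (\sum_(y <- Z0) y.1 * cis (phase gamma y.2 x)).
Definition nt_init (x : 'rV[R]_d) : R :=
  complex.Re (\sum_(y <- Z0) (0 -i* Om y.2) * y.1 * cis (phase gamma y.2 x)).

Lemma zakharov_solution_S (T : R) : 0 < T -> T < tau ->
  zakharov_solution gamma lambda c0 alpha beta T u_init n_init nt_init uS nS.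
Proof.
move=> T0 Ttau; have tau0 : 0 < tau by exact: lt_trans Ttau.
have inA t x : t \in `[- T, T] -> slab (t, x).
  by rewrite in_itv/= -ler_norml /slab/= => h; exact: le_lt_trans Ttau.
have id1 (F : nat -> seq term) p : Evs F p = Evs (fun a => opL (fun=> 1) (F a)) p.
  by apply: eq_S => a; rewrite Ev_op1.
have tU := tame_U; have tZ := tame_Z.
have sNU a : smoothL (nextU a) by case: tame_nextU.
have sNZ a : smoothL (nextZ a) by case: tame_nextZ.
have t1 F : tame F -> tame (fun a => opL (fun=> 1) (F a)).
  by apply: tame_opp; exact: pbounded_cst.
have at0 mu := S_at0 (mu := mu).
split.
- exists tau => //; split.
  + exact: (smooth_S tame_U).
  + exact: (smooth_S tame_Z).1.
  + move=> t _; split; first exact: S_periodic.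
    by move=> j x; rewrite /nS; congr (complex.Re _); exact: S_periodic.
- by move=> t x /inA h; exact: schroedinger.
- by move=> t x /inA h; exact: wave.
- move=> x; split.
  + rewrite /uS id1 (at0 _ _ _ _ _ _ (Ul0 gamma lambda c0 alpha beta U0 Z0)
      (UlS gamma lambda c0 alpha beta U0 Z0) sNU)//; last exact: t1.
    by apply: eq_bigr => y _; rewrite mul1r.
  + rewrite /nS id1 (at0 _ _ _ _ _ _ (Zl0 gamma lambda c0 alpha beta U0 Z0)
      (ZlS gamma lambda c0 alpha beta U0 Z0) sNZ)//; last exact: t1.
    by congr complex.Re; apply: eq_bigr => y _; rewrite mul1r.
  + rewrite D_t_nS; last by rewrite /slab/= normr0.
    rewrite (at0 _ _ _ _ _ _ (Zl0 gamma lambda c0 alpha beta U0 Z0)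
      (ZlS gamma lambda c0 alpha beta U0 Z0) sNZ)//.
    by apply: tame_opp => //; exact: pbounded_Om.
Qed.

(** The tail a >= 2 is geometric of ratio at most 1 / 2 and starts with 2 A (|t| / rho)^2. Summation
    gives a factor 2, and the passage through real and imaginary parts another 2. *)
Lemma uS_expansion (p : spacetime) : `|p.1| < tau ->
  normc (uS p - Ev gamma (Ul 0%N ++ Ul 1%N) p) <= 8 * A * (`|p.1| / rho) ^+ 2.
Proof.
move=> pt; have tU := tame_U; have tU1 := tame_shift tU.
rewrite /uS (S_recl tU pt) (S_recl tU1 pt) Ev_cat.
have -> : forall x y z : C, x + (y + z) - (x + y) = z by move=> x y z; ring.
have r0 : 0 <= `|p.1| / rho by rewrite divr_ge0// ltW.
have -> : 8 * A * (`|p.1| / rho) ^+ 2 = 2 * (2 * A * (`|p.1| / rho) ^+ 2) / (1 - 2^-1).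
  have -> : 1 - 2^-1 = 2^-1 :> R by lra.
  by rewrite invrK; ring.
apply: csum_geometric_le => [|||a]; [|lra|lra|].
  by apply: mulr_ge0; [rewrite mulr_ge0|exact: exprn_ge0].
have [h _] := Ev_UZ_le a.+2 p; apply: (le_trans h).
rewrite -(add2n a) exprD [leLHS]mulrA ler_wpM2l//.
  by apply: mulr_ge0; [rewrite mulr_ge0|exact: exprn_ge0].
apply: lerXn2r; rewrite ?nnegrE//.
by rewrite ler_pdivrMr//; apply: ltW; apply: (lt_le_trans pt); rewrite mulrC.
Qed.

Lemma nS_expansion (p : spacetime) : `|p.1| < tau ->
  `|nS p - complex.Re (Ev gamma (Zl 0%N ++ Zl 1%N) p)| <= 8 * B * (`|p.1| / rho) ^+ 2.
Proof.
move=> pt; have tU := tame_Z; have tU1 := tame_shift tU.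
have -> : nS p - complex.Re (Ev gamma (Zl 0%N ++ Zl 1%N) p) =
    complex.Re (Evs Zl p - Ev gamma (Zl 0%N ++ Zl 1%N) p).
  by rewrite /nS; case: (Evs Zl p) => a b; case: (Ev _ _ _).
apply: (le_trans (Re_le_normc _)).
rewrite (S_recl tU pt) (S_recl tU1 pt) Ev_cat.
have -> : forall x y z : C, x + (y + z) - (x + y) = z by move=> x y z; ring.
have r0 : 0 <= `|p.1| / rho by rewrite divr_ge0// ltW.
have -> : 8 * B * (`|p.1| / rho) ^+ 2 = 2 * (2 * B * (`|p.1| / rho) ^+ 2) / (1 - 2^-1).
  have -> : 1 - 2^-1 = 2^-1 :> R by lra.
  by rewrite invrK; ring.
apply: csum_geometric_le => [|||a]; [|lra|lra|].
  by apply: mulr_ge0; [rewrite mulr_ge0|exact: exprn_ge0].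
have [_ h] := Ev_UZ_le a.+2 p; apply: (le_trans h).
rewrite -(add2n a) exprD [leLHS]mulrA ler_wpM2l//.
  by apply: mulr_ge0; [rewrite mulr_ge0|exact: exprn_ge0].
apply: lerXn2r; rewrite ?nnegrE//.
by rewrite ler_pdivrMr//; apply: ltW; apply: (lt_le_trans pt); rewrite mulrC.
Qed.

End Solution.

(** * Fourier coefficients *)

Section BoxIntegral.
Context {R : realType}.

Definition lip {d : nat} (K : R) (f : 'rV[R]_d -> R) := forall x y, `|f x - f y| <= K * `|x - y|.

Lemma rV_norm_le {d : nat} (x : 'rV[R]_d) (e : R) : 0 <= e ->
  (forall j, `|x ord0 j| <= e) -> `|x| <= e.
Proof.
move=> e0 h; rewrite [leLHS]mx_normrE; apply: bigmax_le => // [[i j] _] /=.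
by rewrite ord1.
Qed.

Lemma row_mx0E {d : nat} (t : R) (y : 'rV[R]_d) :
  (row_mx (t%:M : 'rV_1) y : 'rV_(d.+1)) ord0 ord0 = t.
Proof.
have -> : ord0 = lshift d (ord0 : 'I_1) :> 'I_(d.+1) by apply: val_inj.
by rewrite (row_mxEl (t%:M : 'rV_1) y) mxE eqxx mulr1n.
Qed.

Lemma row_mxSE {d : nat} (t : R) (y : 'rV[R]_d) (j : 'I_d) :
  (row_mx (t%:M : 'rV_1) y : 'rV_(d.+1)) ord0 (lift ord0 j) = y ord0 j.
Proof.
have -> : lift ord0 j = rshift 1 j :> 'I_(d.+1) by apply: val_inj.
by rewrite (row_mxEr (t%:M : 'rV_1) y).
Qed.

Lemma row_mx_dist {d : nat} (t t' : R) (y y' : 'rV[R]_d) (e : R) :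
  `|t - t'| <= e -> `|y - y'| <= e ->
  `|(row_mx (t%:M : 'rV_1) y : 'rV_(d.+1)) - row_mx (t'%:M : 'rV_1) y'| <= e.
Proof.
move=> h1 h2; apply: rV_norm_le; first exact: le_trans h1.
move=> j; rewrite mxE [X in _ + X]mxE; case: (unliftP ord0 j) => [j' ->|->].
  rewrite !row_mxSE; apply: le_trans h2.
  by have := coord_le_norm (y - y') j'; rewrite !mxE.
by rewrite !row_mx0E.
Qed.

Lemma lip_slice {d : nat} (K : R) (f : 'rV[R]_d.+1 -> R) (t : R) : 0 <= K -> lip K f ->
  lip K (fun y : 'rV[R]_d => f (row_mx (t%:M : 'rV_1) y)).
Proof.
move=> K0 h x y; apply: (le_trans (h _ _)); rewrite ler_wpM2l//.
by apply: row_mx_dist => //; rewrite subrr normr0.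
Qed.

Lemma lipD {d : nat} (K K' : R) (f g : 'rV[R]_d -> R) : lip K f -> lip K' g ->
  lip (K + K') (fun x => f x + g x).
Proof.
move=> h h' x y; rewrite opprD addrACA; apply: (le_trans (ler_normD _ _)).
by rewrite mulrDl lerD ?h ?h'.
Qed.

Lemma lipZ {d : nat} (K k : R) (f : 'rV[R]_d -> R) : lip K f ->
  lip (`|k| * K) (fun x => k * f x).
Proof. by move=> h x y; rewrite -mulrBr normrM -mulrA ler_wpM2l. Qed.

Lemma lip_integrable (K a b : R) (F : R -> R) : (forall t t', `|F t - F t'| <= K * `|t - t'|) ->
  lebesgue_measure.-integrable `[a, b] (EFin \o F).
Proof.
move=> h; apply: continuous_compact_integrable; first exact: segment_compact.
have K0 : 0 <= K.
  by have := h 0 1; rewrite sub0r normrN normr1 mulr1; apply: le_trans.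
apply: continuous_subspaceT => x; apply/cvgrPdist_le => /= e e0; near=> y.
apply: (le_trans (h _ _)).
have : `|x - y| < e / (K + 1).
  near: y; apply: cvgr_dist_lt; last by rewrite divr_gt0// ltr_wpDl.
  exact: cvg_id.
rewrite ltr_pdivlMr ?ltr_wpDl// => /ltW; apply: le_trans.
by rewrite mulrC ler_wpM2l// lerDl.
Unshelve. all: by end_near. Qed.

Lemma fine_itv (l : R) : 0 <= l -> fine (lebesgue_measure (`[0, l] : set R)) = l.
Proof.
move=> l0; rewrite lebesgue_measure_itv/= lte_fin.
have [->|ln] := eqVneq l 0; first by rewrite ltxx.
by rewrite lt_neqAle eq_sym ln l0 /= subr0.
Qed.

Lemma Rintegral_bound (l M : R) (F : R -> R) : 0 <= l ->
  lebesgue_measure.-integrable `[0, l] (EFin \o F) ->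
  (forall t, `|F t| <= M) -> `|\int[lebesgue_measure]_(t in `[0, l]) F t| <= l * M.
Proof.
move=> l0 hi hM; apply: (le_trans (le_normr_Rintegral _ hi)) => //.
have -> : l * M = \int[lebesgue_measure]_(t in `[0, l]) (fun=> M) t.
  by rewrite Rintegral_cst// fine_itv// mulrC.
apply: le_Rintegral => //.
- by have := integrable_norm hi.
- apply: (@lip_integrable 0 _ _ (fun=> M)) => t t'.
  by rewrite subrr normr0 mul0r.
Qed.

(** An iterated integral is linear as long as all partial integrals are integrable. Lipschitz
    functions form a class that closes the induction: slices are Lipschitz, and so is the inner
    integral as a function of the outer variable. That last fact uses all three properties in
    dimension d, so they are proved together. *)
Lemma box_integral_props (d : nat) (L : 'I_d -> R) : (forall j, 0 <= L j) ->
  [/\ forall K M (f : 'rV[R]_d -> R), lip K f -> 0 <= K -> (forall x, `|f x| <= M) ->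
       `|box_integral L f| <= M * \prod_(j < d) L j,
      forall K K' (f g : 'rV[R]_d -> R), lip K f -> lip K' g -> 0 <= K -> 0 <= K' ->
       box_integral L (fun x => f x + g x) = box_integral L f + box_integral L g &
      forall K k (f : 'rV[R]_d -> R), lip K f -> 0 <= K ->
       box_integral L (fun x => k * f x) = k * box_integral L f].
Proof.
elim: d L => [|d IH] L L0.
  by split=> // K M f _ _ fM; rewrite big_ord0 mulr1 /=.
pose L' j := L (lift ord0 j).
have [IHb IHD IHZ] := IH L' (fun j => L0 _).
pose sl (f : 'rV[R]_d.+1 -> R) (t : R) (y : 'rV[R]_d) := f (row_mx (t%:M : 'rV_1) y).
have boxS f : box_integral L f =
  \int[lebesgue_measure]_(t in `[0, L ord0]) box_integral L' (sl f t) by [].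
have P0 : 0 <= \prod_(j < d) L' j by apply: prodr_ge0 => j _; exact: L0.
have inner K f : lip K f -> 0 <= K -> forall t t',
    `|box_integral L' (sl f t) - box_integral L' (sl f t')| <= (K * \prod_(j < d) L' j) * `|t - t'|.
  move=> lf K0 t t'.
  have l1 := lip_slice t K0 lf; have l2 := lip_slice t' K0 lf.
  have -> : box_integral L' (sl f t) - box_integral L' (sl f t') =
      box_integral L' (fun x => sl f t x + (-1) * sl f t' x).
    rewrite (IHD K (`|-1| * K) _ _ l1 (lipZ (-1) l2))//.
      by rewrite (IHZ K)// mulN1r.
    by rewrite mulr_ge0.
  rewrite mulrAC; apply: (IHb (K + `|-1| * K)).
  - by apply: lipD => //; exact: lipZ.
  - by rewrite addr_ge0// mulr_ge0.
  - move=> x; rewrite mulN1r; apply: (le_trans (lf _ _)); rewrite ler_wpM2l//.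
    by apply: row_mx_dist => //; rewrite subrr normr0.
have hi K f : lip K f -> 0 <= K ->
    lebesgue_measure.-integrable `[0, L ord0] (EFin \o (fun t => box_integral L' (sl f t))).
  by move=> lf K0; apply: lip_integrable (inner K f lf K0).
split.
- move=> K M f lf K0 fM; rewrite boxS big_ord_recl.
  have -> : M * (L ord0 * \prod_(i < d) L (lift ord0 i)) = L ord0 * (M * \prod_(j < d) L' j).
    by rewrite mulrCA.
  apply: Rintegral_bound => //; first exact: hi lf K0.
  move=> t; apply: IHb (lip_slice t K0 lf) K0 _ => y; exact: fM.
- move=> K K' f g lf lg K0 K0'; rewrite !boxS.
  rewrite -RintegralD//; [|exact: hi lf K0|exact: hi lg K0'].
  apply: eq_Rintegral => t _.
  exact: (IHD _ _ _ _ (lip_slice t K0 lf) (lip_slice t K0' lg)).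
- move=> K k f lf K0; rewrite !boxS -RintegralZl//; last exact: hi lf K0.
  by apply: eq_Rintegral => t _; exact: (IHZ _ _ _ (lip_slice t K0 lf)).
Qed.

Lemma Rintegral_cos (w a l : R) (k : int) : 0 < l -> w * l = 2 * pi * k%:~R ->
  \int[lebesgue_measure]_(t in `[0, l]) cos (a + w * t) = if w == 0 then l * cos a else 0.
Proof.
move=> l0 wl; have [->|w0] := eqVneq w 0.
  under eq_Rintegral do rewrite mul0r addr0.
  by rewrite Rintegral_cst// fine_itv ?ltW// mulrC.
pose F t := w^-1 * sin (a + w * t).
have Fd (x : R) : is_derive x 1 F (cos (a + w * x)).
  have h : is_derive x 1 (fun s : R => a + w * s) w.
    rewrite (_ : (fun s => _) = cst a + w \*: (@id R)); last first.
      by apply/funext => s; rewrite !fctE.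
    by apply: is_derive_eq; rewrite add0r /GRing.scale/= mulr1.
  have h' := is_derive_sin (a + w * x).
  rewrite (_ : F = w^-1 \*: (sin \o (fun s => a + w * s)))//.
  by apply: is_derive_eq; rewrite /GRing.scale/= mulrCA mulVf// mulr1.
have fc : continuous (fun t : R => cos (a + w * t)).
  move=> x; apply: continuous_comp; last exact: continuous_cos.
  apply: cvgD; first exact: cvg_cst.
  by apply: cvgM; [exact: cvg_cst|exact: cvg_id].
have Fc := within_is_derive_continuous (fun x (_ : x \in `[0, l]) => Fd x).
have Fc' : derivable_oo_LRcontinuous F 0 l.
  have cF : continuous F by move=> x; exact: is_derive_continuous (Fd x).
  split; first by move=> x _; case: (Fd x).
    by apply: cvg_at_right_filter; exact: cF.
  by apply: cvg_at_left_filter; exact: cF.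
rewrite /Rintegral (continuous_FTC2 l0 (continuous_subspaceT fc) Fc'); last first.
  by move=> x _; rewrite derive1E; case: (Fd x).
rewrite -EFinB /= /F mulr0 addr0 wl -mulrBr.
have -> : sin (a + 2 * pi * k%:~R) = sin a.
  by have := cis_pi2 k a; case.
by rewrite subrr mulr0.
Qed.

(** The free phase a lets the induction run on cosines alone: the contribution of the outer variable
    is moved into it. *)
Lemma box_integral_cos (d : nat) (L w : 'I_d -> R) (k : 'I_d -> int) (a : R) :
  (forall j, 0 < L j) -> (forall j, w j * L j = 2 * pi * (k j)%:~R) ->
  box_integral L (fun x => cos (a + \sum_(j < d) w j * x ord0 j)) =
  if [forall j, w j == 0] then cos a * \prod_(j < d) L j else 0.
Proof.
elim: d L w k a => [|d IH] L w k a L0 wL.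
  rewrite /= !big_ord0 addr0 mulr1; case: ifPn => // /forallPn[[]] //.
pose L' j := L (lift ord0 j); pose w' j := w (lift ord0 j).
have E : box_integral L (fun x => cos (a + \sum_(j < d.+1) w j * x ord0 j)) =
    \int[lebesgue_measure]_(t in `[0, L ord0])
     ((if [forall j, w' j == 0] then \prod_(j < d) L' j else 0) * cos (a + w ord0 * t)).
  apply: eq_Rintegral => t _.
  transitivity (box_integral L' (fun y : 'rV[R]_d =>
      cos ((a + w ord0 * t) + \sum_(j < d) w' j * y ord0 j))).
    congr box_integral; apply/funext => y; congr cos; rewrite big_ord_recl row_mx0E addrA; congr (_ + _).
    by apply: eq_bigr => j _; rewrite row_mxSE.
  rewrite (IH L' w' (fun j => k (lift ord0 j))) => [|j|j]; [|exact: L0|exact: wL].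
  by case: ifP => _; [rewrite mulrC|rewrite mul0r].
rewrite E RintegralZl//; last first.
  apply: continuous_compact_integrable; first exact: segment_compact.
  apply: continuous_subspaceT => x; apply: continuous_comp; last exact: continuous_cos.
  apply: cvgD; first exact: cvg_cst.
  by apply: cvgM; [exact: cvg_cst|exact: cvg_id].
rewrite (Rintegral_cos _ (L0 ord0) (wL ord0)) big_ord_recl.
have fE : [forall j, w j == 0] = (w ord0 == 0) && [forall j, w' j == 0].
  apply/forallP/andP => [h|[h0 /forallP h] j].
    by split; [exact: h|apply/forallP => j; exact: h].
  by case: (unliftP ord0 j) => [j' ->|->] //; exact: h.
rewrite fE; case: (w ord0 == 0); case: ifP => _ /=; rewrite ?mulr0 ?mul0r//.
by rewrite -/L'; ring.
Qed.

End BoxIntegral.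

(** * Fourier coefficients of trigonometric sums on the torus *)

Section Fourier.
Context {R : realType} {d : nat} (gamma : 'I_d -> {posnum R}).
Local Notation C := R[i].
Local Notation lattice := {ffun 'I_d -> int}.
Local Notation phase := (phase gamma).
Implicit Types (f g : 'rV[R]_d -> C) (m : lattice).

Definition vol : R := \prod_(j < d) (2 * pi * (gamma j)%:num).

Lemma side_gt0 (j : 'I_d) : 0 < 2 * pi * (gamma j)%:num :> R.
Proof. by rewrite !mulr_gt0// pi_gt0. Qed.

Lemma vol_gt0 : 0 < vol.
Proof. by apply: prodr_gt0 => j _; exact: side_gt0. Qed.

Definition bounded_lip f := exists2 K : R, 0 <= K &
  (forall x, normc (f x) <= K) /\ forall x y, normc (f x - f y) <= K * `|x - y|.

Lemma bounded_lipD f g : bounded_lip f -> bounded_lip g -> bounded_lip (fun x => f x + g x).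
Proof.
move=> [K K0 [h1 h2]] [K' K0' [h1' h2']]; exists (K + K'); first by rewrite addr_ge0.
split=> [x|x y]; first by apply: (le_trans (le_normcD _ _)); rewrite lerD.
rewrite opprD addrACA; apply: (le_trans (le_normcD _ _)).
by rewrite mulrDl lerD ?h2 ?h2'.
Qed.

Lemma bounded_lipM f g : bounded_lip f -> bounded_lip g -> bounded_lip (fun x => f x * g x).
Proof.
move=> [K K0 [h1 h2]] [K' K0' [h1' h2']]; exists (K * K' + K * K').
  by rewrite addr_ge0// mulr_ge0.
split=> [x|x y].
  rewrite normcM; apply: (@le_trans _ _ (K * K')); last by rewrite lerDl mulr_ge0.
  by apply: ler_pM; rewrite ?normc_ge0.
have -> : f x * g x - f y * g y = f x * (g x - g y) + (f x - f y) * g y by ring.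
apply: (le_trans (le_normcD _ _)); rewrite !normcM mulrDl; apply: lerD.
  by rewrite -mulrA; apply: ler_pM; rewrite ?normc_ge0.
by rewrite mulrAC; apply: ler_pM; rewrite ?normc_ge0.
Qed.

Lemma bounded_lip_cst (k : C) : bounded_lip (fun=> k).
Proof.
exists (normc k); first exact: normc_ge0.
by split=> // x y; rewrite subrr normc0 mulr_ge0 ?normc_ge0.
Qed.

Lemma cis_lip (a b : R) : normc (cis a - cis b) <= 2 * `|a - b|.
Proof.
wlog ab : a b / b <= a => [H|].
  have [|/ltW ab] := leP b a; first exact: H.
  by rewrite -normcN opprB distrC; exact: H.
have [c _ e1] := MVT_closed ab (fun x _ => is_derive_cos x).
have [c' _ e2] := MVT_closed ab (fun x _ => is_derive_sin x).
apply: (le_trans (normc_le_ReIm _)).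
rewrite [complex.Re _]/= [complex.Im _]/= e1 e2 !normrM normrN -mulrDl ler_wpM2r//.
have h1 : `|sin c| <= 1 by rewrite ler_norml sin_geN1 sin_le1.
have h2 : `|cos c'| <= 1 by rewrite ler_norml cos_geN1 cos_le1.
lra.
Qed.

Lemma bounded_lip_cis m : bounded_lip (fun x => cis (phase m x)).
Proof.
exists (1 + 2 * fsize gamma m); first by rewrite addr_ge0// mulr_ge0// fsize_ge0.
split=> [x|x y]; first by rewrite normc_cis lerDl mulr_ge0// fsize_ge0.
apply: (le_trans (cis_lip _ _)).
have -> : phase m x - phase m y = phase m (x - y).
  by rewrite /phase -sumrB; apply: eq_bigr => j _; rewrite !mxE mulrBr.
apply: (@le_trans _ _ (2 * fsize gamma m * `|x - y|)).
  by rewrite -mulrA ler_wpM2l// phase_le.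
by rewrite ler_wpM2r// lerDr.
Qed.

Lemma eq_bounded_lip f g : f =1 g -> bounded_lip f -> bounded_lip g.
Proof. by move=> /funext ->. Qed.

Let Re_lip f : bounded_lip f -> exists2 K, 0 <= K &
  lip K (fun x => complex.Re (f x)) /\ lip K (fun x => complex.Im (f x)).
Proof.
have ReN z : complex.Re (- z : C) = - complex.Re z by case: z.
have ImN z : complex.Im (- z : C) = - complex.Im z by case: z.
move=> [K K0 [_ h]]; exists K => //; split=> x y.
  by rewrite -ReN -Re_D; apply: le_trans (Re_le_normc _) _.
by rewrite -ImN -Im_D; apply: le_trans (Im_le_normc _) _.
Qed.

Let side0 (j : 'I_d) : 0 <= 2 * pi * (gamma j)%:num :> R := ltW (side_gt0 j).

Lemma torus_integralD f g : bounded_lip f -> bounded_lip g ->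
  torus_integral gamma (fun x => f x + g x) = torus_integral gamma f + torus_integral gamma g.
Proof.
move=> /Re_lip[K K0 [h1 h2]] /Re_lip[K' K0' [h1' h2']].
have [_ D _] := box_integral_props side0.
apply: complex_eq; rewrite /torus_integral ?Re_D ?Im_D/=.
  rewrite -(D _ _ _ _ h1 h1' K0 K0'); congr box_integral; apply/funext => x.
  by rewrite Re_D.
rewrite -(D _ _ _ _ h2 h2' K0 K0'); congr box_integral; apply/funext => x.
by rewrite Im_D.
Qed.

Lemma torus_integral_le f (M : R) : bounded_lip f -> (forall x, normc (f x) <= M) ->
  normc (torus_integral gamma f) <= 2 * vol * M.
Proof.
move=> /Re_lip[K K0 [h1 h2]] hM.
have [B _ _] := box_integral_props side0.
apply: (le_trans (normc_le_ReIm _)); rewrite /torus_integral [complex.Re _]/= [complex.Im _]/=.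
have b1 := B _ M _ h1 K0 (fun x => le_trans (Re_le_normc _) (hM x)).
have b2 := B _ M _ h2 K0 (fun x => le_trans (Im_le_normc _) (hM x)).
by apply: (le_trans (lerD b1 b2)); rewrite -/vol; lra.
Qed.

Lemma torus_integral_exp (k : C) m :
  torus_integral gamma (fun x => k * cis (phase m x)) = if m == 0 then vol%:C * k else 0.
Proof.
have boxc (b : R) : box_integral (fun j => 2 * pi * (gamma j)%:num)
    (fun x : 'rV[R]_d => cos (b + phase m x)) = if m == 0 then cos b * vol else 0.
  have wL j : freq gamma m j * (2 * pi * (gamma j)%:num) = 2 * pi * (m j)%:~R.
    by rewrite /freq; field.
  rewrite (box_integral_cos b side_gt0 wL).
  rewrite (_ : [forall j, _] = (m == 0))//.
    apply/forallP/eqP => [h|-> j]; last by rewrite /freq ffunE mul0r.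
    apply/ffunP => j; move: (h j); rewrite /freq mulf_eq0 invr_eq0 => /orP[|/eqP g0].
      by rewrite intr_eq0 ffunE => /eqP.
    by have : 0 < (gamma j)%:num :> R by []; rewrite g0 ltxx.
have lipc (b : R) : lip (2 * fsize gamma m) (fun x : 'rV[R]_d => cos (b + phase m x)).
  move=> x y.
  have := cis_lip (b + phase m x) (b + phase m y).
  have -> : b + phase m x - (b + phase m y) = phase m (x - y).
    rewrite opprD addrACA subrr add0r.
    by rewrite /phase -sumrB; apply: eq_bigr => j _; rewrite !mxE mulrBr.
  move=> h; apply: (@le_trans _ _ (2 * `|phase m (x - y)|)).
    apply: le_trans h; apply: le_trans (Re_le_normc _).
    by [].
  by rewrite -mulrA ler_wpM2l// phase_le.
have K0 : 0 <= 2 * fsize gamma m by rewrite mulr_ge0// fsize_ge0.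
have [_ D Z] := box_integral_props side0.
(* Sines are cosines with a shifted phase, so both parts of the exponential reduce to
   [box_integral_cos]. *)
have sinE (x : R) : sin x = cos (- (pi / 2) + x).
  by rewrite addrC cosB cos_pihalf sin_pihalf mulr0 add0r mulr1.
have comb (a b : R) : box_integral (fun j => 2 * pi * (gamma j)%:num)
    (fun x : 'rV[R]_d => a * cos (0 + phase m x) + b * cos (- (pi / 2) + phase m x)) =
    if m == 0 then a * vol else 0.
  rewrite (D _ _ _ _ (lipZ a (lipc 0)) (lipZ b (lipc (- (pi / 2))))) ?mulr_ge0 ?fsize_ge0//.
  rewrite (Z _ _ _ (lipc 0) K0) (Z _ _ _ (lipc (- (pi / 2))) K0) !boxc.
  case: ifP => _; last by rewrite !mulr0 addr0.
  by rewrite cos0 cosN cos_pihalf mul0r mulr0 addr0 mul1r.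
apply: complex_eq; rewrite /torus_integral /=.
  have -> : (fun x : 'rV[R]_d => complex.Re (k * cis (phase m x))) =
     (fun x => complex.Re k * cos (0 + phase m x) + (- complex.Im k) * cos (- (pi / 2) + phase m x)).
    by apply/funext => x; rewrite Re_M /cis /= -sinE add0r mulNr.
  rewrite comb; case: ifP => _ //; rewrite Re_M/=; ring.
have -> : (fun x : 'rV[R]_d => complex.Im (k * cis (phase m x))) =
   (fun x => complex.Im k * cos (0 + phase m x) + complex.Re k * cos (- (pi / 2) + phase m x)).
  by apply/funext => x; rewrite Im_M /cis /= -sinE add0r; ring.
rewrite comb; case: ifP => _ //; rewrite Im_M/=; ring.
Qed.

Lemma fourierE f m : fourier gamma f m = torus_integral gamma (fun x => cis (phase (- m) x) * f x).
Proof.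
rewrite /fourier; congr torus_integral; apply/funext => x; congr (_ * _).
by rewrite phaseN cisN.
Qed.

Lemma fourierD f g m : bounded_lip f -> bounded_lip g ->
  fourier gamma (fun x => f x + g x) m = fourier gamma f m + fourier gamma g m.
Proof.
move=> hf hg; rewrite !fourierE -torus_integralD; last 2 first.
- by apply: bounded_lipM => //; exact: bounded_lip_cis.
- by apply: bounded_lipM => //; exact: bounded_lip_cis.
by congr torus_integral; apply/funext => x; rewrite mulrDr.
Qed.

Lemma fourier_le f m (M : R) : bounded_lip f -> (forall x, normc (f x) <= M) ->
  normc (fourier gamma f m) <= 2 * vol * M.
Proof.
move=> hf hM; rewrite fourierE; apply: torus_integral_le.
  by apply: bounded_lipM => //; exact: bounded_lip_cis.
by move=> x; rewrite normcM normc_cis mul1r.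
Qed.

Lemma fourier_exp (k : C) m m' :
  fourier gamma (fun x => k * cis (phase m' x)) m = if m' == m then vol%:C * k else 0.
Proof.
rewrite fourierE (_ : (fun x => _) = (fun x => k * cis (phase (m' - m) x))).
  by rewrite torus_integral_exp subr_eq0.
by apply/funext => x; rewrite phaseD cisD; ring.
Qed.

Lemma fourier0 m : fourier gamma (fun=> 0) m = 0.
Proof.
have := fourier_exp 0 m m; rewrite eqxx mulr0 => E; rewrite -[RHS]E; congr fourier.
by apply/funext => x; rewrite mul0r.
Qed.

Lemma bounded_lip_sum (I : Type) (r : seq I) (F : I -> C) (mm : I -> lattice) :
  bounded_lip (fun x => \sum_(i <- r) F i * cis (phase (mm i) x)).
Proof.
elim: r => [|i r IH].
  by apply: eq_bounded_lip (bounded_lip_cst 0) => x; rewrite big_nil.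
apply: (@eq_bounded_lip (fun x => F i * cis (phase (mm i) x) +
   \sum_(i <- r) F i * cis (phase (mm i) x))).
  by move=> x; rewrite big_cons.
apply: bounded_lipD => //; apply: bounded_lipM; [exact: bounded_lip_cst|].
exact: bounded_lip_cis.
Qed.

Lemma fourier_sum (I : Type) (r : seq I) (F : I -> C) (mm : I -> lattice) m :
  fourier gamma (fun x => \sum_(i <- r) F i * cis (phase (mm i) x)) m =
  vol%:C * \sum_(i <- r | mm i == m) F i.
Proof.
elim: r => [|i r IH].
  rewrite big_nil mulr0 -[RHS](fourier0 m); congr fourier.
  by apply/funext => x; rewrite big_nil.
have -> : (fun x => \sum_(j <- i :: r) F j * cis (phase (mm j) x)) =
  (fun x => F i * cis (phase (mm i) x) + \sum_(j <- r) F j * cis (phase (mm j) x)).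
  by apply/funext => x; rewrite big_cons.
rewrite fourierD; last 2 first.
- by apply: bounded_lipM; [exact: bounded_lip_cst|exact: bounded_lip_cis].
- exact: bounded_lip_sum.
rewrite IH fourier_exp big_cons; case: ifP => _; last by rewrite add0r.
by rewrite mulrDr.
Qed.

Lemma Re_sum_cis (I : Type) (r : seq I) (F : I -> C) (mm : I -> lattice) (x : 'rV[R]_d) :
  (complex.Re (\sum_(i <- r) F i * cis (phase (mm i) x)))%:C =
  2^-1%:C * \sum_(i <- r) F i * cis (phase (mm i) x) +
  2^-1%:C * \sum_(i <- r) (F i)^*%C * cis (phase (- mm i) x).
Proof.
have -> : \sum_(i <- r) (F i)^*%C * cis (phase (- mm i) x) =
    (\sum_(i <- r) F i * cis (phase (mm i) x))^*%C.
  by rewrite rmorph_sum; apply: eq_bigr => i _; rewrite phaseN cisN rmorphM.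
by set z := \sum_(i <- r) _; apply: complex_eq; rewrite ?Re_D ?Im_D ?Re_M ?Im_M ?Re_J ?Im_J /=; lra.
Qed.

(** Taking the real part feeds the mode m from the frequency m and, conjugated, from the frequency
    -m. *)
Lemma rfourier_sum (I : Type) (r : seq I) (F : I -> C) (mm : I -> lattice) m :
  rfourier gamma (fun x => complex.Re (\sum_(i <- r) F i * cis (phase (mm i) x))) m =
  2^-1%:C * vol%:C * (\sum_(i <- r | mm i == m) F i + (\sum_(i <- r | mm i == - m) F i)^*%C).
Proof.
rewrite /rfourier (_ : (fun x => _) = (fun x =>
  \sum_(i <- r) (2^-1%:C * F i) * cis (phase (mm i) x) +
  \sum_(i <- r) (2^-1%:C * (F i)^*%C) * cis (phase (- mm i) x))); last first.
  apply/funext => x; rewrite Re_sum_cis !mulr_sumr; congr (_ + _);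
    by apply: eq_bigr => i _; rewrite mulrA.
rewrite fourierD; [|exact: bounded_lip_sum|exact: (bounded_lip_sum r _ (fun i => - mm i))].
rewrite (fourier_sum r _ mm) (fourier_sum r _ (fun i => - mm i)).
rewrite -!mulr_sumr rmorph_sum mulrDr; congr (_ + _); first by ring.
rewrite [RHS]mulrAC [RHS]mulrC; congr (_ * (_ * _)).
by apply: eq_bigl => i; rewrite eqr_oppLR.
Qed.

End Fourier.

(** * Second-order terms of small solutions *)

Lemma pair0_continuous {R : realType} (V : normedModType R) (x : V) :
  {for x, continuous (fun y : V => ((0, y) : (R * V)%type))}.
Proof.
apply/cvgrPdist_le => e e0; near=> y.
have -> : `|((0, x) : (R * V)%type) - (0, y)| = `|x - y|.
  by rewrite prod_normE /= subrr normr0; apply/max_idPr.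
by near: y; apply: cvgr_dist_le => //; exact: cvg_id.
Unshelve. all: by end_near. Qed.

Section Slices.
Context {R : realType} {d : nat}.
Local Notation spacetime := (R * 'rV[R]_d)%type.

Lemma slice_line (v x : 'rV[R]_d) (h : R) :
  h *: ((0, v) : spacetime) + (0, x) = (0, h *: v + x).
Proof.
by rewrite -[LHS]/(h *: 0 + 0, h *: v + x) scaler0 addr0.
Qed.

Lemma derive_slice (f : spacetime -> R) (v x : 'rV[R]_d) :
  'D_v (fun y => f (0, y)) x = 'D_((0, v) : spacetime) f (0, x).
Proof.
rewrite /derive; set F := (X in lim (X @ _)); set G := (X in _ = lim (X @ _)).
suff -> : F = G by [].
by apply/funext => h; rewrite /F /G /= slice_line.
Qed.

Lemma derivable_slice (f : spacetime -> R) (v x : 'rV[R]_d) :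
  derivable f (0, x) ((0, v) : spacetime) -> derivable (fun y => f (0, y)) x v.
Proof.
rewrite /derivable; set F := (X in cvg (X @ _)); set G := (X in _ -> cvg (X @ _)).
suff -> : G = F by [].
by apply/funext => h; rewrite /F /G /= slice_line.
Qed.

Lemma iter_derive_slice (vs : seq 'rV[R]_d) (f : spacetime -> R) (x : 'rV[R]_d) :
  iter_derive vs (fun y => f (0, y)) x =
  iter_derive [seq ((0, v) : spacetime) | v <- vs] f (0, x).
Proof.
elim: vs x => [|v vs IH] x //=; rewrite -derive_slice.
by congr ('D_v _ x); apply/funext => y; exact: IH.
Qed.

Lemma smooth_on_slice (A : set spacetime) (f : spacetime -> R) :
  smooth_on A f -> (forall x, A (0, x)) -> smooth_on setT (fun x : 'rV[R]_d => f (0, x)).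
Proof.
move=> sf A0 vs x _; have [c dv] := sf [seq ((0, v) : spacetime) | v <- vs] (0, x) (A0 x).
have -> : iter_derive vs (fun y => f (0, y)) =
    fun y => iter_derive [seq ((0, v) : spacetime) | v <- vs] f (0, y).
  by apply/funext => y; exact: iter_derive_slice.
split; last by move=> v; apply: derivable_slice.
exact: (@continuous_comp _ _ _ (fun y : 'rV[R]_d => ((0, y) : spacetime)) _ x
  (@pair0_continuous R _ x) c).
Qed.

Lemma smooth_on_derive (A : set spacetime) (f : spacetime -> R) v :
  smooth_on A f -> smooth_on A ('D_v f).
Proof.
move=> sf vs x Ax; have := sf (rcons vs v) x Ax.
by rewrite /iter_derive foldr_rcons.
Qed.

(** The data are the traces at t = 0 of the solution and of its time derivative, so smoothness near
    that time slice passes to them. *)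
Lemma solution_smooth_data (gamma : 'I_d -> {posnum R}) lambda c0 alpha beta (T : R)
    (u0 : 'rV[R]_d -> R[i]) (n0 n1 : 'rV[R]_d -> R) u n : 0 < T ->
  zakharov_solution gamma lambda c0 alpha beta T u0 n0 n1 u n ->
  torus_periodic gamma n1 -> smooth_data gamma u0 n0 n1.
Proof.
move=> T0 [[T' TT' [[su1 su2] sn per]] _ _ init] pn1.
have A0 x : [set p : spacetime | `|p.1| < T'] (0, x).
  by rewrite /= normr0 (lt_trans T0).
have [pu pn] := per 0 (A0 0).
have Eu : u0 = fun x => u (0, x) by apply/funext => x; have [->] := init x.
have En : n0 = fun x => n (0, x) by apply/funext => x; have [_ ->] := init x.
have En1 : n1 = fun x => 'D_(@dir_t R d) n (0, x).
  by apply/funext => x; have [_ _ ->] := init x.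
split; [split| | |split => //].
- by rewrite Eu; exact: (smooth_on_slice su1).
- by rewrite Eu; exact: (smooth_on_slice su2).
- by rewrite En; exact: (smooth_on_slice sn).
- by rewrite En1; apply: (smooth_on_slice (smooth_on_derive (@dir_t R d) sn)).
- by rewrite Eu.
- by rewrite En.
Qed.

End Slices.

Section SmallData.
Context {R : realType} {d : nat} (gamma : 'I_d -> {posnum R}) (tau : R).
Local Notation C := R[i].
Local Notation lattice := {ffun 'I_d -> int}.
Local Notation term := ((R -> C) * R * lattice)%type.

Lemma S_bounded (F : nat -> seq term) : tame gamma tau F -> exists2 K : R, 0 <= K &
  forall p : R * 'rV[R]_d, `|p.1| < tau -> normc (Evs gamma F p) <= K.
Proof.
move=> tF; have [_ _ /(_ 0%N)[g [C0 [th [C00 th0 th1 hg]]] h]] := tF.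
have key p : `|p.1| < tau -> forall a, normc (Ev gamma (F a) p) <= C0 * th ^+ a.
  move=> pt a; apply: (le_trans (Ev_le _ _ _)); apply: (le_trans (h a _ pt)).
  exact: le_trans (ler_norm _) (hg a).
exists (2 * C0 / (1 - th)); first by rewrite divr_ge0 ?mulr_ge0// subr_ge0 ltW.
by move=> p pt; apply: csum_geometric_le => //; exact: key.
Qed.

Lemma bounded_lip_S (F : nat -> seq term) (t : R) : tame gamma tau F -> `|t| < tau ->
  bounded_lip (fun x : 'rV[R]_d => Evs gamma F (t, x)).
Proof.
move=> tF tt; have [K K0 hK] := S_bounded tF; have [L L0 hL] := S_lipschitz tF.
exists (K + L); first by rewrite addr_ge0.
split=> [x|x y]; first by apply: (le_trans (hK _ _)) => //; rewrite lerDl.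
apply: (le_trans (hL _ _ _ _)) => //.
have -> : `|((t, x) : R * 'rV[R]_d) - (t, y)| = `|x - y|.
  by rewrite prod_normE /= subrr normr0; apply/max_idPr.
by rewrite ler_wpM2r// lerDr.
Qed.

Lemma bounded_lip_Ev (L : seq term) (t : R) : bounded_lip (fun x : 'rV[R]_d => Ev gamma L (t, x)).
Proof. exact: (bounded_lip_sum gamma L (fun l => l.1.1 t) (fun l => l.2)). Qed.

Lemma bounded_lip_Re (f : 'rV[R]_d -> C) : bounded_lip f ->
  bounded_lip (fun x => (complex.Re (f x))%:C).
Proof.
move=> [K K0 [h1 h2]]; exists K => //; split=> [x|x y].
  by rewrite normc_real; apply: le_trans (Re_le_normc _) (h1 x).
rewrite -rmorphB normc_real; apply: le_trans (h2 x y).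
have -> : complex.Re (f x) - complex.Re (f y) = complex.Re (f x - f y).
  by case: (f x); case: (f y).
exact: Re_le_normc.
Qed.

End SmallData.

(** The interface between the expansion and the flow: an admissible solution on [-T, T] whose
    Fourier coefficients are those of the terms with at most one interaction, up to an error uniform
    in the mode. The constant 16 is the 8 of the expansion doubled by [fourier_le]. *)
Lemma small_data_solution {R : realType} {d : nat} (gamma : 'I_d -> {posnum R}) (lambda : R[i])
    (c0 : R) (alpha beta : 'I_d -> R) (U0 Z0 : seq (R[i] * {ffun 'I_d -> int}))
    (kap A B rho T : R) :
  0 < c0 -> (forall j, 0 < alpha j) -> 0 <= kap -> 0 <= A -> 0 <= B -> 0 < T -> 2 * T < rho ->
  (forall x, x \in U0 -> fsize gamma x.2 <= kap) ->
  (forall x, x \in Z0 -> fsize gamma x.2 <= kap) ->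
  \sum_(x <- U0) normc x.1 <= A -> \sum_(x <- Z0) normc x.1 <= B ->
  8 * normc lambda * rho * B <= 1 -> 16 * Kz c0 alpha beta * kap * rho * A ^+ 2 <= B ->
  exists u n,
   [/\ zakharov_solution gamma lambda c0 alpha beta T (u_init gamma U0)
         (n_init gamma Z0) (nt_init gamma c0 alpha Z0) u n,
       smooth_data gamma (u_init gamma U0) (n_init gamma Z0) (nt_init gamma c0 alpha Z0),
       forall t m, t \in `[- T, T] ->
         normc (fourier gamma (fun x => u (t, x)) m -
           (vol gamma)%:C * \sum_(l <- Ul gamma lambda c0 alpha beta U0 Z0 0 ++
             Ul gamma lambda c0 alpha beta U0 Z0 1 | l.2 == m) l.1.1 t) <=
         16 * vol gamma * A * (`|t| / rho) ^+ 2 &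
       forall t m, t \in `[- T, T] ->
         normc (rfourier gamma (fun x => n (t, x)) m -
           2^-1%:C * (vol gamma)%:C *
           (\sum_(l <- Zl gamma lambda c0 alpha beta U0 Z0 0 ++
              Zl gamma lambda c0 alpha beta U0 Z0 1 | l.2 == m) l.1.1 t +
            (\sum_(l <- Zl gamma lambda c0 alpha beta U0 Z0 0 ++
              Zl gamma lambda c0 alpha beta U0 Z0 1 | l.2 == - m) l.1.1 t)^*%C)) <=
         16 * vol gamma * B * (`|t| / rho) ^+ 2].
Proof.
move=> c0p ap kap0 A0 B0 T0 Trho sU sZ mU mZ smU smZ.
have rho0 : 0 < rho by lra.
pose tau := rho / 2.
have tau_le : tau <= rho / 2 by [].
have Ttau : T < tau by rewrite /tau; lra.
have tU := tame_U c0p ap kap0 A0 B0 rho0 sU sZ mU mZ smU smZ tau_le.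
have tZ := tame_Z c0p ap kap0 A0 B0 rho0 sU sZ mU mZ smU smZ tau_le.
have sol := zakharov_solution_S c0p ap kap0 A0 B0 rho0 sU sZ mU mZ smU smZ tau_le T0 Ttau.
have eU := uS_expansion c0p ap kap0 A0 B0 rho0 sU sZ mU mZ smU smZ tau_le.
have eZ := nS_expansion c0p ap kap0 A0 B0 rho0 sU sZ mU mZ smU smZ tau_le.
exists (uS gamma lambda c0 alpha beta U0 Z0), (nS gamma lambda c0 alpha beta U0 Z0); split => //.
- apply: (solution_smooth_data T0 sol) => j x; rewrite /nt_init; congr (complex.Re _).
  apply: eq_bigr => y _; congr (_ * _).
  rewrite addrC phase_line phase_e.
  have -> : freq gamma y.2 j * (2 * pi * (gamma j)%:num) + phase gamma y.2 x =
     phase gamma y.2 x + 2 * pi * (y.2 j)%:~R.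
    by rewrite /freq addrC; congr (_ + _); field.
  exact: cis_pi2.
- move=> t m; rewrite in_itv/= -ler_norml => tT.
  have tt : `|t| < tau by exact: le_lt_trans Ttau.
  set L := _ ++ _.
  have -> := esym (fourier_sum gamma L (fun l => l.1.1 t) (fun l => l.2) m).
  rewrite -[fourier gamma (fun x => \sum_(i <- L) _) m]/(fourier gamma (fun x => Ev gamma L (t, x)) m).
  pose r x := uS gamma lambda c0 alpha beta U0 Z0 (t, x) + (-1) * Ev gamma L (t, x).
  have lr : bounded_lip r.
    apply: bounded_lipD; first exact: (bounded_lip_S tU tt).
    by apply: bounded_lipM; [exact: bounded_lip_cst|exact: bounded_lip_Ev].
  have -> : (fun x => uS gamma lambda c0 alpha beta U0 Z0 (t, x)) =
     (fun x => r x + Ev gamma L (t, x)).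
    by apply/funext => x; rewrite /r; ring.
  rewrite fourierD//; last exact: bounded_lip_Ev.
  have -> : forall a b : R[i], a + b - b = a by move=> a b; ring.
  apply: (le_trans (fourier_le (M := 8 * A * (`|t| / rho) ^+ 2) _ _ lr _)).
    by move=> x; rewrite /r mulN1r; exact: eU.
  by rewrite le_eqVlt; apply/orP; left; apply/eqP; ring.
- move=> t m; rewrite in_itv/= -ler_norml => tT.
  have tt : `|t| < tau by exact: le_lt_trans Ttau.
  set L := _ ++ _.
  have E : _ = fourier gamma (fun x => (complex.Re (Ev gamma L (t, x)))%:C) m :=
    esym (rfourier_sum gamma L (fun l => l.1.1 t) (fun l => l.2) m).
  rewrite E {E}.
  pose N x := nS gamma lambda c0 alpha beta U0 Z0 (t, x).
  pose r x := (N x)%:C + (-1) * (complex.Re (Ev gamma L (t, x)))%:C.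
  have lr : bounded_lip r.
    apply: bounded_lipD; first by apply: bounded_lip_Re; exact: (bounded_lip_S tZ tt).
    by apply: bounded_lipM; [exact: bounded_lip_cst|apply: bounded_lip_Re; exact: bounded_lip_Ev].
  rewrite /rfourier.
  have -> : (fun x => (nS gamma lambda c0 alpha beta U0 Z0 (t, x))%:C) =
     (fun x => r x + (complex.Re (Ev gamma L (t, x)))%:C).
    by apply/funext => x; rewrite /r /N; ring.
  rewrite fourierD//; last by apply: bounded_lip_Re; exact: bounded_lip_Ev.
  have -> : forall a b : R[i], a + b - b = a by move=> a b; ring.
  apply: (le_trans (fourier_le (M := 8 * B * (`|t| / rho) ^+ 2) _ _ lr _)).
    move=> x; rewrite /r mulN1r -rmorphB normc_real; exact: eZ.
  by rewrite le_eqVlt; apply/orP; left; apply/eqP; ring.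
Qed.

Section OscillatoryIntegral.
Context {R : realType}.
Local Notation C := R[i].

(** The integral of exp(i Phi s) over [0, t]: the time factor of an interaction whose frequencies
    miss exact resonance by Phi. *)
Definition oscint (Phi t : R) : C :=
  prim (fun s => cos (Phi * s)) t +i* prim (fun s => sin (Phi * s)) t.

Lemma oscint_spec Phi : oscint Phi 0 = 0 /\ forall t, cD (oscint Phi) t (cis (Phi * t)).
Proof.
have [g1 g2] := @cdiff_continuous R (fun s => cis (Phi * s + 0)) (fun t => cD_diff (cDcis Phi 0 t)).
have E1 : (fun s => complex.Re (cis (Phi * s + 0))) = (fun s => cos (Phi * s)).
  by apply/funext => s; rewrite addr0.
have E2 : (fun s => complex.Im (cis (Phi * s + 0))) = (fun s => sin (Phi * s)).
  by apply/funext => s; rewrite addr0.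
rewrite E1 in g1; rewrite E2 in g2.
have [P0 P1] := prim_spec g1; have [Q0 Q1] := prim_spec g2.
by split; [rewrite /oscint P0 Q0|move=> t; split; [exact: P1|exact: Q1]].
Qed.

Lemma cD_unique (f g h : R -> C) : (forall t, cD f t (h t)) -> (forall t, cD g t (h t)) ->
  f 0 = g 0 -> forall t, f t = g t.
Proof.
move=> fh gh fg t.
have k (F G H : R -> R) : (forall t : R, is_derive t 1 F (H t)) -> (forall t : R, is_derive t 1 G (H t)) ->
    F 0 = G 0 -> F t = G t.
  move=> FH GH FG; apply/eqP; rewrite -subr_eq0; apply/eqP.
  have -> : 0 = (F - G) 0 by rewrite !fctE FG subrr.
  apply: (@is_derive_0_is_cst R (F - G)) => x.
  by rewrite -(subrr (H x)); apply: is_deriveB.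
apply: complex_eq.
  apply: (k (fun s => complex.Re (f s)) (fun s => complex.Re (g s)) (fun s => complex.Re (h s))).
  - by move=> s; case: (fh s).
  - by move=> s; case: (gh s).
  - by rewrite fg.
apply: (k (fun s => complex.Im (f s)) (fun s => complex.Im (g s)) (fun s => complex.Im (h s))).
- by move=> s; case: (fh s).
- by move=> s; case: (gh s).
- by rewrite fg.
Qed.

(** After multiplication by exp(i phi t) both sides vanish at 0 and have the same derivative. *)
Lemma duh_exp (phi psi : R) (k : C) t :
  duh phi (fun s => k * cis (- psi * s)) t = k * cis (- phi * t) * oscint (phi - psi) t.
Proof.
have cc (x : R) s : cD (fun s => cis (x * s)) s ((0 +i* x) * cis (x * s)).
  by apply: eq_cD (cDcis x 0 s) _ _ => [y|]; rewrite addr0.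
have fd s : cdiff (fun s => k * cis (- psi * s)) s.
  by apply: cD_diff (cDM (cDcst k s) (cc (- psi) s)).
have [D0 DD] := duh_spec phi fd; have [I0 II] := oscint_spec (phi - psi).
have key : forall s, cis (phi * s) * duh phi (fun s => k * cis (- psi * s)) s =
    k * oscint (phi - psi) s.
  apply: (@cD_unique _ _ (fun s => k * cis ((phi - psi) * s))) => [s|s|].
  - apply: eq_cD (cDM (cc phi s) (DD s)) _ _ => //.
    have -> : (0 -i* phi) = - (0 +i* phi) :> C by apply: complex_eq; rewrite /= ?oppr0.
    have -> : (phi - psi) * s = phi * s + - psi * s by ring.
    by rewrite cisD; ring.
  - by apply: eq_cD (cDM (cDcst k s) (II s)) _ _ => //; rewrite mul0r add0r.
  - by rewrite D0 I0 !mulr0.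
have e : cis (- phi * t) * cis (phi * t) = 1 :> C by rewrite -cisD mulNr addNr cis0.
rewrite -[LHS]mul1r -e -mulrA key; ring.
Qed.

Lemma cos_ge_half (x : R) : `|x| <= 2^-1 -> 2^-1 <= cos x.
Proof.
move=> hx; have := cis_lip x 0; rewrite subr0 => h.
wlog x0 : x hx {h} / 0 <= x => [H|].
  have [x0|/ltW x0] := leP 0 x; first exact: H.
  by rewrite -cosN; apply: H; rewrite ?normrN ?oppr_ge0.
have [c _] := MVT_closed x0 (fun y _ => is_derive_cos y).
rewrite cos0 subr0 => E.
have h2 : - sin c * x >= - x.
  rewrite mulNr lerN2 -[leRHS]mul1r ler_wpM2r//; exact: sin_le1.
have := ler_norm x; lra.
Qed.

(** As long as the phase stays below 1 / 2 the cosine stays above 1 / 2, so nothing cancels and the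
    integral grows linearly. *)
Lemma oscint_ge (Phi t : R) : 0 <= t -> `|Phi| * t <= 2^-1 -> t / 2 <= normc (oscint Phi t).
Proof.
move=> t0 h; apply: le_trans (Re_le_normc _); apply: le_trans (ler_norm _).
have [I0 II] := oscint_spec Phi.
have Id (x : R) : is_derive x 1 (fun s => 2^-1 * s : R) 2^-1.
  rewrite (_ : (fun s => _) = 2^-1 \*: (@id R))//.
  by apply: is_derive_eq; rewrite /GRing.scale/= mulr1.
have := @is_derive_le R (fun s => 2^-1 * s) (fun=> 2^-1)
  (fun s => complex.Re (oscint Phi s)) (fun s => complex.Re (cis (Phi * s))) 0 t t0
  (fun x _ => Id x) (fun x _ => (II x).1).
rewrite I0 /= mulr0 !subr0 mulrC; apply => x; rewrite in_itv/= => /andP[x0 xt].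
apply: cos_ge_half; rewrite normrM (ger0_norm x0); apply: le_trans h.
by rewrite ler_wpM2l.
Qed.

Lemma oscintE (Phi t : R) : Phi != 0 -> oscint Phi t = (cis (Phi * t) - 1) / (0 +i* Phi).
Proof.
move=> P0; have [I0 II] := oscint_spec Phi.
have i0 : (0 +i* Phi) != 0 :> C by rewrite eq_complex /= eqxx.
apply: (@cD_unique (oscint Phi) (fun s => (cis (Phi * s) - 1) / (0 +i* Phi)) _ II) => [s|]; last by rewrite I0 mulr0 cis0 subrr mul0r.
have h : cD (fun s => cis (Phi * s)) s ((0 +i* Phi) * cis (Phi * s)).
  by apply: eq_cD (cDcis Phi 0 s) _ _ => [y|]; rewrite addr0.
apply: eq_cD (cDM (cDD h (cDcst (-1) s)) (cDcst (0 +i* Phi)^-1 s)) _ _ => //.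
by rewrite mulr0 !addr0 mulrAC divff// mul1r.
Qed.

Lemma oscint_le (Phi t : R) : Phi != 0 -> normc (oscint Phi t) <= 2 / `|Phi|.
Proof.
move=> P0; rewrite oscintE// normcM normcV.
have -> : normc (0 +i* Phi) = `|Phi| by rewrite /normc expr0n/= add0r sqrtr_sqr.
rewrite ler_wpM2r ?invr_ge0//; apply: (le_trans (le_normcD _ _)).
by rewrite normc_cis normcN normc1.
Qed.

Lemma oscintJ (Phi t : R) : (oscint Phi t)^*%C = oscint (- Phi) t.
Proof.
have [I0 II] := oscint_spec Phi; have [J0 JJ] := oscint_spec (- Phi).
apply: (@cD_unique (fun s => (oscint Phi s)^*%C) _ (fun s => cis (- Phi * s))) => [s|//|].
  by apply: eq_cD (cDJ (II s)) _ _ => //; rewrite -cisN mulNr.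
by rewrite I0 J0 rmorph0.
Qed.

End OscillatoryIntegral.

(** * Explicit interaction of two modes *)

Section SecondOrder.
Context {R : realType} {d : nat} (gamma : 'I_d -> {posnum R}) (lambda : R[i])
  (c0 : R) (alpha beta : 'I_d -> R).
Local Notation C := R[i].
Local Notation lattice := {ffun 'I_d -> int}.
Local Notation om := (om gamma alpha).
Local Notation Om := (Om gamma c0 alpha).
Local Notation rz := (rz gamma c0 alpha beta).
Implicit Types (p k : lattice).

Lemma lattice_double k : k + k = 0 -> k = 0.
Proof.
move=> h; apply/ffunP => j; have := congr1 (fun f : lattice => f j) h.
by rewrite /= !ffunE => /eqP; rewrite -mulr2n mulrn_eq0 => /eqP.
Qed.

(** The lattice has no 2-torsion, so the contributions of the modes k and -k of a real wave can be
    told apart. *)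
Lemma oppr_neq k : k != 0 -> (- k == k) = false.
Proof.
move=> k0; apply/negP => /eqP h; case/negP: k0; apply/eqP/lattice_double.
by rewrite -{1}h addNr.
Qed.

(** The free evolution lives on p and the interaction on p + k and p - k. As k and -k differ and are
    nonzero, a single term survives; its factor 1 / 2 is the weight of [symL]. *)
Lemma Ul_second (A0 B0 : C) p k t : k != 0 ->
  \sum_(l <- Ul gamma lambda c0 alpha beta [:: (A0, p)] [:: (B0, k)] 0 ++
    Ul gamma lambda c0 alpha beta [:: (A0, p)] [:: (B0, k)] 1 | l.2 == p + k) l.1.1 t =
  (- 'i%C * lambda * (2^-1)%:C * A0 * B0) * cis (- om (p + k) * t) *
    oscint (om (p + k) - (om p + Om k)) t.
Proof.
move=> k0; rewrite UlS /nextU /convL [iota 0 1]/= [map _ _]/= ?subn0 Zl0 Ul0 /dataL /symL /mulL /=.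
rewrite !big_cons big_nil /=.
have -> : (p == p + k) = false by rewrite -[X in X == _]addr0 (inj_eq (addrI p)) eq_sym (negbTE k0).
have -> : (- k + p == p + k) = false by rewrite addrC (inj_eq (addrI p)) oppr_neq.
rewrite (addrC k p) eqxx addr0 -duh_exp; congr (duh _ _ _); apply/funext => s.
by rewrite !addr0 opprD mulrDl cisD; ring.
Qed.

(** The product of u and its conjugate has the modes 0, k and -k. Both k and -k are computed because
    the mode k of Re z sees the first one and the conjugate of the second. *)
Lemma Zl_second (A0 A1 : C) p k t : k != 0 ->
  \sum_(l <- Zl gamma lambda c0 alpha beta [:: (A0, p); (A1, p + k)] [::] 0 ++
    Zl gamma lambda c0 alpha beta [:: (A0, p); (A1, p + k)] [::] 1 | l.2 == k) l.1.1 t =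
  (- 'i%C * (rz k)%:C * (A1 * A0^*%C)) * cis (- Om k * t) *
    oscint (Om k - (om (p + k) - om p)) t /\
  \sum_(l <- Zl gamma lambda c0 alpha beta [:: (A0, p); (A1, p + k)] [::] 0 ++
    Zl gamma lambda c0 alpha beta [:: (A0, p); (A1, p + k)] [::] 1 | l.2 == - k) l.1.1 t =
  (- 'i%C * (rz k)%:C * (A1 * A0^*%C)^*%C) * cis (- Om k * t) *
    oscint (Om k + (om (p + k) - om p)) t.
Proof.
move=> k0; rewrite ZlS /nextZ /convL [iota 0 1]/= [map _ _]/= ?subn0 Zl0 Ul0 /dataL /symL /mulL /=.
rewrite !big_cons !big_nil /=.
have e1 : p + - (p + k) = - k by rewrite opprD addrA subrr add0r.
have e2 : p + k - p = k by rewrite addrC addrA addNr add0r.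
have e3 : (0 == k) = false by rewrite eq_sym (negbTE k0).
have e4 : (0 == - k) = false by rewrite eq_sym oppr_eq0 (negbTE k0).
have e5 : (k == - k) = false by rewrite eq_sym oppr_neq.
rewrite !subrr !e1 !e2 !oppr0 !opprK e3 e4 e5 oppr_neq// !eqxx !addr0.
have JM (x y : C) : (x * y)^*%C = x^*%C * y^*%C by exact: rmorphM.
have half (z : C) : (2^-1)%:C * z + (2^-1)%:C * z = z.
  by rewrite -mulrDl -rmorphD (_ : 2^-1 + 2^-1 = 1 :> R) ?mul1r//; lra.
(* [symL] yields the same coefficient twice with weight 1 / 2, once from the product and once as the
   conjugate of the opposite mode. *)
have hd (phi psi : R) (z : C) s (f g : R -> C) :
   (forall x, f x = (2^-1)%:C * z * cis (- psi * x)) ->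
   (forall x, g x = (2^-1)%:C * z * cis (- psi * x)) ->
   duh phi f s + duh phi g s = z * cis (- phi * s) * oscint (phi - psi) s.
  move=> /funext -> /funext ->; rewrite duh_exp -[RHS]half; ring.
rewrite /zmult /rz !OmN !quadN -/(rz k).
split.
  apply: hd => x; rewrite !JM ?conjcK !addr0.
    rewrite (_ : - (om (p + k) - om p) * x = - om (p + k) * x + (- (- om p * x))); last by ring.
    by rewrite cisD [cis (- (- om p * x))]cisN; ring.
  rewrite (_ : - (om (p + k) - om p) * x = - om (p + k) * x + (- (- om p * x))); last by ring.
  by rewrite cisD [cis (- (- om p * x))]cisN; ring.
have -> : Om k + (om (p + k) - om p) = Om k - (om p - om (p + k)) by ring.
apply: hd => x; rewrite !JM ?conjcK !addr0.
  rewrite (_ : - (om p - om (p + k)) * x = (- (- om (p + k) * x)) + - om p * x); last by ring.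
  by rewrite cisD [cis (- (- om (p + k) * x))]cisN; ring.
rewrite (_ : - (om p - om (p + k)) * x = (- (- om (p + k) * x)) + - om p * x); last by ring.
by rewrite cisD [cis (- (- om (p + k) * x))]cisN; ring.
Qed.

(* the time factor of the mode k of n created by the modes p and p + k of u *)
Definition nmain p k (t : R) : C :=
  cis (- Om k * t) * oscint (Om k - (om (p + k) - om p)) t -
  cis (Om k * t) * oscint (- (Om k + (om (p + k) - om p))) t.

Lemma Zl_main (A0 A1 : C) p k t : k != 0 ->
  2^-1%:C * (vol gamma)%:C *
  (\sum_(l <- Zl gamma lambda c0 alpha beta [:: (A0, p); (A1, p + k)] [::] 0 ++
    Zl gamma lambda c0 alpha beta [:: (A0, p); (A1, p + k)] [::] 1 | l.2 == k) l.1.1 t +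
  (\sum_(l <- Zl gamma lambda c0 alpha beta [:: (A0, p); (A1, p + k)] [::] 0 ++
    Zl gamma lambda c0 alpha beta [:: (A0, p); (A1, p + k)] [::] 1 | l.2 == - k) l.1.1 t)^*%C) =
  2^-1%:C * (vol gamma)%:C * (- 'i%C * (rz k)%:C * (A1 * A0^*%C)) * nmain p k t.
Proof.
move=> k0; have [-> ->] := Zl_second A0 A1 p t k0.
have iJ : ('i%C : C)^*%C = - 'i%C by apply: complex_eq; rewrite /= ?oppr0.
rewrite /nmain -[RHS]mulrA; congr (_ * _).
have JM (x y : C) : (x * y)^*%C = x^*%C * y^*%C by exact: rmorphM.
have JN (x : C) : (- x)^*%C = - x^*%C by exact: rmorphN.
rewrite !JM !JN iJ !conjcK !conjc_real oscintJ -cisN ![- Om k * t]mulNr !opprK; ring.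
Qed.

Lemma normc_subr_ge (z w : C) : normc z - normc w <= normc (z - w).
Proof. by rewrite lerBlDr; have := le_normcD (z - w) w; rewrite subrK. Qed.

(** The nearly resonant half contributes at least t / 2; the other half has a large phase and stays
    bounded. *)
Lemma nmain_resonant p k (t : R) : 0 <= t -> 0 < Om k + (om (p + k) - om p) ->
  `|Om k - (om (p + k) - om p)| * t <= 2^-1 ->
  t / 2 - 2 / (Om k + (om (p + k) - om p)) <= normc (nmain p k t).
Proof.
move=> t0 s0 h; apply: le_trans (normc_subr_ge _ _).
rewrite !normcM !normc_cis !mul1r; apply: lerB; first exact: oscint_ge.
have n0 : - (Om k + (om (p + k) - om p)) != 0 by rewrite oppr_eq0 gt_eqF.
by apply: (le_trans (oscint_le _ n0)); rewrite normrN gtr0_norm.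
Qed.

(** At this time Om(k) t = pi / 2, so the boundary terms combine into one fraction whose numerator
    is the difference of a number of modulus 2 D and one of modulus 2 O. Its modulus is at least 2
    (D - O) whatever the remaining phase D t is, and the factor D - O of the denominator cancels. *)
Lemma nmain_nonresonant p k : 0 < Om k -> Om k < om (p + k) - om p ->
  2 / (Om k + (om (p + k) - om p)) <= normc (nmain p k (pi / (2 * Om k))).
Proof.
move=> O0; rewrite /nmain; set O := Om k; set D := om (p + k) - om p => OD.
set t := pi / (2 * O).
have Ot : O * t = pi / 2 by rewrite /t; field; rewrite gt_eqF.
have n1 : O - D != 0 by rewrite subr_eq0 lt_eqF.
have D0 : 0 < O + D by rewrite addr_gt0// (lt_trans O0).
have n2 : - (O + D) != 0 by rewrite oppr_eq0 gt_eqF.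
rewrite mulNr Ot !oscintE// -/O -/D.
have -> : (O - D) * t = pi / 2 + - (D * t) by rewrite -Ot; ring.
have -> : - (O + D) * t = - (pi / 2) + - (D * t) by rewrite -Ot; ring.
have c1 : cis (pi / 2) = 'i%C :> C by rewrite /cis cos_pihalf sin_pihalf.
have iJ : ('i%C : C)^*%C = - 'i%C by apply: complex_eq; rewrite /= ?oppr0.
rewrite !cisD [cis (- (pi / 2))]cisN c1 iJ; set e := cis _.
have i0 : ('i%C : C) != 0 by rewrite eq_complex /= oner_eq0 andbF.
have ii : ('i%C : C) ^+ 2 = -1 by exact: sqr_i.
have iC (x : R) : 0 +i* x = 'i%C * x%:C :> C.
  by apply: complex_eq; rewrite ?Re_M ?Im_M/=; ring.
rewrite (iC (O - D)) (iC (- (O + D))); set x := (O - D)%:C; set y := (- (O + D))%:C.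
have x0 : x != 0 by rewrite /x (inj_eq (@complexI R) _ 0).
have y0 : y != 0 by rewrite /y (inj_eq (@complexI R) _ 0).
have -> : - 'i%C * (('i%C * e - 1) / ('i%C * x)) - 'i%C * ((- 'i%C * e - 1) / ('i%C * y)) =
    ((x + y) - 'i%C * e * (y - x)) / (x * y).
  have gen (I e' x' y' : C) : I != 0 -> x' != 0 -> y' != 0 ->
      - I * ((I * e' - 1) / (I * x')) - I * ((- I * e' - 1) / (I * y')) =
      ((x' + y') - I * e' * (y' - x')) / (x' * y').
    by move=> I0 x0' y0'; field; rewrite I0 x0' y0'.
  exact: gen.
rewrite normcM normcV.
have -> : x + y = (- (2 * D))%:C by rewrite -rmorphD; congr (_%:C); ring.
have -> : y - x = (- (2 * O))%:C by rewrite -rmorphB; congr (_%:C); ring.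
have -> : normc (x * y) = (D - O) * (O + D).
  by rewrite normcM !normc_real normrN (gtr0_norm D0) distrC gtr0_norm// subr_gt0.
have DO : 0 < D - O by rewrite subr_gt0.
rewrite ler_pdivlMr ?mulr_gt0//.
have -> : 2 / (O + D) * ((D - O) * (O + D)) = 2 * D - 2 * O by field; rewrite gt_eqF.
apply: le_trans (normc_subr_ge _ _).
rewrite !normcM normc_i normc_cis !normc_real !normrN !mul1r.
by rewrite !ger0_norm// mulr_ge0// ltW// (lt_trans O0).
Qed.

End SecondOrder.

(** * Sobolev data and second differences of the flow *)

Section SobolevElements.
Context {R : realType} {d : nat} (gamma : 'I_d -> {posnum R}).
Local Notation C := R[i].
Local Notation lattice := {ffun 'I_d -> int}.
Local Notation coefs := (lattice -> Rcomplex R).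
Implicit Types (m : lattice) (s : R).

Definition dirac_coef (a : C) m : coefs := fun m' => if m' == m then (a : Rcomplex R) else 0.

Lemma sobolev_sum_dirac s (a : C) m :
  sobolev_sum gamma s (dirac_coef a m) = (bracket gamma m `^ (2 * s) * normc a ^+ 2)%:E.
Proof.
rewrite /sobolev_sum.
pose f m' := (bracket gamma m' `^ (2 * s) * `|dirac_coef a m m'| ^+ 2)%:E.
have -> : \esum_(m' in setT) f m' = \esum_(m' in [set m]) f m'.
  rewrite [RHS]esum_mkcond; apply: eq_esum => m' _.
  case: ifPn => // h; rewrite /f /dirac_coef; case: eqP => [E|_].
    by case/negP: h; rewrite E; apply/mem_set.
  by rewrite normr0 expr0n/= mulr0.
rewrite esum_set1; last by rewrite lee_fin mulr_ge0 ?powR_ge0.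
by rewrite /f /dirac_coef eqxx.
Qed.

(** Only an upper bound, because the two modes may coincide: one-mode data are encoded with m1 = m2
    and a2 = 0. *)
Lemma sobolev_sum_pair s (a1 a2 : C) m1 m2 :
  (sobolev_sum gamma s (dirac_coef a1 m1 + dirac_coef a2 m2)%R <=
   (2 * (bracket gamma m1 `^ (2 * s) * normc a1 ^+ 2 + bracket gamma m2 `^ (2 * s) * normc a2 ^+ 2))%:E)%E.
Proof.
apply: (le_trans (@sobolev_sumD R d gamma s 1 _ _ ltr01)).
rewrite !sobolev_sum_dirac -!EFinM -EFinD lee_fin invr1; lra.
Qed.

Lemma pair_in_sobolev b s (a1 a2 : C) m1 m2 :
  hermitian_if b (dirac_coef a1 m1 + dirac_coef a2 m2) ->
  (dirac_coef a1 m1 + dirac_coef a2 m2 : coefs) \in sobolev_pred gamma b s.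
Proof.
move=> h; apply/sobolev_predP; split=> //.
by apply: (le_lt_trans (sobolev_sum_pair _ _ _ _ _)); exact: ltry.
Qed.

Definition pairH s (a1 a2 : C) m1 m2 : sobolev gamma false s :=
  Sobolev (@pair_in_sobolev false s a1 a2 m1 m2 (fun h => False_ind _ (elimF idP erefl h))).

Lemma hermitian_pair (a : C) m : hermitian_if true (dirac_coef a m + dirac_coef a^*%C (- m)).
Proof.
move=> _ m'; rewrite -[LHS]/(dirac_coef a m (- m') + dirac_coef a^*%C (- m) (- m')).
rewrite -[RHS]/((dirac_coef a m m' + dirac_coef a^*%C (- m) m' : C)^*%C).
rewrite /dirac_coef eqr_opp eqr_oppLR.
have J0 : (0 : C)^*%C = 0 by exact: conjc0.
have JD (x y : C) : (x + y)^*%C = x^*%C + y^*%C by exact: rmorphD.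
rewrite JD; case: (m' == - m); case: (m' == m); rewrite ?conjcK ?J0 ?addr0 ?add0r//.
by rewrite addrC.
Qed.

Definition hermH l (a : C) m : sobolev gamma true l :=
  Sobolev (pair_in_sobolev l (hermitian_pair a m)).

Definition Cg : R := Num.sqrt (2 * (\prod_(j < d) (gamma j)%:num)^-1).
Definition Cg' : R := Num.sqrt (\prod_(j < d) (gamma j)%:num).

Lemma Cg_ge0 : 0 <= Cg. Proof. exact: sqrtr_ge0. Qed.
Lemma Cg'_ge0 : 0 <= Cg'. Proof. exact: sqrtr_ge0. Qed.

Lemma powR_sqr (x s : R) : (x `^ s) ^+ 2 = x `^ (2 * s).
Proof. by rewrite [2 * s]mulrC powRrM powR_mulrn// powR_ge0. Qed.

Let norm_pair_le b s (a1 a2 : C) m1 m2 (f : sobolev gamma b s) :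
  coef f = dirac_coef a1 m1 + dirac_coef a2 m2 ->
  `|f| <= Cg * (bracket gamma m1 `^ s * normc a1 + bracket gamma m2 `^ s * normc a2).
Proof.
move=> E; set x := bracket gamma m1 `^ s * _; set y := bracket gamma m2 `^ s * _.
have x0 : 0 <= x by rewrite mulr_ge0 ?powR_ge0 ?normc_ge0.
have y0 : 0 <= y by rewrite mulr_ge0 ?powR_ge0 ?normc_ge0.
rewrite -[`|f|]/(sobolev_norm f).
rewrite -ler_sqr ?nnegrE ?mulr_ge0 ?addr_ge0 ?sqrtr_ge0//.
rewrite sobolev_norm_sqr exprMn sqr_sqrtr ?mulr_ge0 ?(ltW (gprod_gt0 gamma))//.
have := sobolev_sum_pair s a1 a2 m1 m2; rewrite -E sobolev_fin lee_fin -!powR_sqr -!exprMn -/x -/y => h.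
rewrite [2 * _]mulrC -mulrA ler_wpM2l ?(ltW (gprod_gt0 gamma))//.
apply: (le_trans h); rewrite ler_wpM2l// sqrrD -addrA lerD2l lerDr mulrn_wge0// mulr_ge0//.
Qed.

Lemma norm_pairH s (a1 a2 : C) m1 m2 :
  `|pairH s a1 a2 m1 m2| <=
  Cg * (bracket gamma m1 `^ s * normc a1 + bracket gamma m2 `^ s * normc a2).
Proof. exact: norm_pair_le. Qed.

Lemma bracketN m : bracket gamma (- m) = bracket gamma m.
Proof.
by rewrite /bracket; congr (Num.sqrt (_ + _)); apply: eq_bigr => j _; rewrite freqN sqrrN.
Qed.

Lemma norm_hermH l (a : C) m :
  `|hermH l a m| <= Cg * (2 * (bracket gamma m `^ l * normc a)).
Proof.
apply: (le_trans (@norm_pair_le _ _ a a^*%C m (- m) _ _)) => //.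
by rewrite bracketN normc_conj ler_wpM2l ?Cg_ge0//; lra.
Qed.

(** One term of the sum is at most the sum. The coefficient at m becomes a functional whose norm is
    the inverse weight, and lower bounds on the flow are read through it. *)
Lemma coef_le_norm b s (f : sobolev gamma b s) m :
  bracket gamma m `^ s * normc (coef f m) <= Cg' * `|f|.
Proof.
rewrite -[`|f|]/(sobolev_norm f).
have P0 : 0 < \prod_(j < d) (gamma j)%:num :> R by apply: prodr_gt0.
rewrite -ler_sqr ?nnegrE ?mulr_ge0 ?powR_ge0 ?normc_ge0 ?sqrtr_ge0//.
rewrite [leRHS]exprMn sobolev_norm_sqr /Cg' sqr_sqrtr ?(ltW P0)// mulrA divff ?gt_eqF// mul1r.
rewrite exprMn powR_sqr -lee_fin -sobolev_fin; apply: esum_ge.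
by exists [set m]; [split|rewrite fsbig_set1].
Qed.

End SobolevElements.

(** * Second differences of C^2 maps at the origin *)

Section SecondDifference.
Context {R : realType} {V W : normedModType R}.

Definition bounded_functional (K : R) (ell : W -> R) :=
  [/\ forall x y, ell (x - y) = ell x - ell y,
      forall (k : R) x, ell (k *: x) = k * ell x & forall x, `|ell x| <= K * `|x|].

Lemma is_derive_functional (K : R) (ell : W -> R) (F : V -> W) (h : V) (s : R) :
  0 <= K -> bounded_functional K ell -> differentiable F (s *: h) ->
  is_derive s 1 (fun r : R => ell (F (r *: h))) (ell ('d F (s *: h) h)).
Proof.
move=> K0 [eB eZ eK] dF.
have [c E] : derivable F (s *: h) h /\ 'D_h F (s *: h) = 'd F (s *: h) h.
  by split; [exact: diff_derivable|exact: deriveE].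
have cv : k^-1 *: (F (k *: h + s *: h) - F (s *: h)) @[k --> 0^'] --> ('d F (s *: h) h : W).
  by rewrite -E; exact: c.
have cv2 : k^-1 *: (ell (F ((k *: (1 : R) + s) *: h)) - ell (F (s *: h))) @[k --> 0^'] -->
    (ell ('d F (s *: h) h) : R).
  apply/cvgrPdist_le => e e0.
  have e1 : 0 < e / (K + 1) by rewrite divr_gt0// ltr_wpDl.
  move/cvgrPdist_le : cv => /(_ _ e1); apply: filterS => k hk.
  have -> : (k *: (1 : R) + s) *: h = k *: h + s *: h.
    by rewrite scalerDl [k *: 1]mulr1.
  have -> : ell ('d F (s *: h) h) - k^-1 *: (ell (F (k *: h + s *: h)) - ell (F (s *: h))) =
      ell ('d F (s *: h) h - k^-1 *: (F (k *: h + s *: h) - F (s *: h))).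
    by rewrite eB eZ eB.
  apply: (le_trans (eK _)).
  apply: (@le_trans _ _ (K * (e / (K + 1)))); first by rewrite ler_wpM2l.
  by rewrite mulrCA ler_piMr ?(ltW e0)// ler_pdivrMr ?ltr_wpDl// mul1r lerDl.
apply: DeriveDef; first by apply/cvg_ex; exists (ell ('d F (s *: h) h)).
by apply: cvg_lim => //; exact: Rhausdorff.
Qed.

(** The map is composed with a real functional so that the mean value theorem applies on [0, e] and
    on [e, 2 e]. The two increments of the differential are then compared with its value at 0. The
    constant does not depend on h or [ell]; only the admissible step depends on h. *)
Lemma C2_second_difference (U : set V) (F : V -> W) : open_nbhs 0 U -> C2_on U F ->
  exists2 M : R, 0 <= M & forall h : V, exists2 e0 : R, 0 < e0 &
  forall (ell : W -> R) (K e : R), 0 <= K -> bounded_functional K ell -> 0 < e -> e < e0 ->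
    `|ell (F ((2 * e) *: h)) - 2 * ell (F (e *: h)) + ell (F 0)| <= K * M * `|h| ^+ 2 * e ^+ 2.
Proof.
move=> [oU U0] [D2 C2]; have [dF0 linD [M0 hM0] near0 _] := C2 0 U0.
(* [M0] bounds the second differential at 0 and the + 1 is the Frechet error with tolerance 1. The
   factor 4 counts two increments of the differential, each at a point at most 2 e h away. *)
pose M := 4 * (`|M0| + 1).
exists M; first by rewrite mulr_ge0// addr_ge0.
have nU : \forall y \near (0 : V), U y by exact: open_nbhs_nbhs.
have nn : \forall y \near (0 : V), U y /\ forall k,
    `|'d F (0 + y) k - 'd F 0 k - D2 0 y k| <= 1 * `|y| * `|k|.
  exact: filterI nU (near0 1 ltr01).
have [dl dl0 hdl] : exists2 dl : R, 0 < dl & forall y, ball (0 : V) dl y -> U y /\ forall k,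
    `|'d F (0 + y) k - 'd F 0 k - D2 0 y k| <= 1 * `|y| * `|k|.
  by move/nbhs_ballP: nn => [dl dl0 hdl]; exists dl.
move=> h; pose e0 := dl / (2 * (`|h| + 1)).
have h1 : 0 < `|h| + 1 by rewrite ltr_wpDl.
have e00 : 0 < e0 by rewrite divr_gt0// mulr_gt0.
exists e0 => // ell K e K0 bl ep ee0.
have [eB eZ eK] := bl.
have inB (r : R) : 0 <= r -> r <= 2 * e -> ball (0 : V) dl (r *: h).
  move=> r0 re; rewrite -ball_normE /ball_/= sub0r normrN normrZ (ger0_norm r0).
  apply: (@le_lt_trans _ _ (2 * e * (`|h| + 1))).
    by apply: ler_pM => //; rewrite lerDl.
  have : 2 * e < dl / (`|h| + 1).
    by move: ee0; rewrite /e0 ltr_pdivlMr ?mulr_gt0// => ee; rewrite ltr_pdivlMr//; lra.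
  by rewrite ltr_pdivlMr.
pose g (r : R) := ell (F (r *: h)).
pose g' (r : R) := ell ('d F (r *: h) h).
have gd (r : R) : 0 <= r -> r <= 2 * e -> is_derive r 1 g (g' r).
  move=> r0 re; apply: is_derive_functional K0 bl _.
  by have [Ur _] := hdl _ (inB r r0 re); have [] := C2 _ Ur.
have dist (r : R) : 0 <= r -> r <= 2 * e -> `|g' r - g' 0| <= K * ((`|M0| + 1) * (2 * e) * `|h| ^+ 2).
  move=> r0 re; rewrite /g' -eB; apply: (le_trans (eK _)); rewrite ler_wpM2l// scale0r.
  have [_ hb] := hdl _ (inB r r0 re); have := hb h; rewrite add0r mul1r => hn.
  have hD := hM0 (r *: h) h.
  have -> : 'd F (r *: h) h - 'd F 0 h = ('d F (r *: h) h - 'd F 0 h - D2 0 (r *: h) h) + D2 0 (r *: h) h.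
    by rewrite subrK.
  apply: (le_trans (ler_normD _ _)); apply: (le_trans (lerD hn hD)).
  rewrite !normrZ (ger0_norm r0).
  have M01 := ler_norm M0.
  have hh : 0 <= `|h| * `|h| by rewrite mulr_ge0.
  have a1 : r * `|h| * `|h| <= 2 * e * (`|h| * `|h|) by rewrite -mulrA ler_wpM2r.
  have a2 : M0 * (r * `|h|) * `|h| <= `|M0| * (2 * e * (`|h| * `|h|)).
    have -> : M0 * (r * `|h|) * `|h| = M0 * (r * (`|h| * `|h|)) by ring.
    apply: (@le_trans _ _ (`|M0| * (r * (`|h| * `|h|)))); first by rewrite ler_wpM2r ?mulr_ge0.
    by rewrite ler_wpM2l// ler_wpM2r.
  rewrite expr2; lra.
have [c1 c1i E1] : exists2 c, c \in `[0, e] & g e - g 0 = g' c * (e - 0).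
  apply: MVT_closed; first exact: ltW.
  by move=> x; rewrite in_itv/= => /andP[x0 xe]; apply: gd => //; lra.
have [c2 c2i E2] : exists2 c, c \in `[e, 2 * e] & g (2 * e) - g e = g' c * (2 * e - e).
  apply: MVT_closed; first by lra.
  by move=> x; rewrite in_itv/= => /andP[x0 xe]; apply: gd => //; lra.
move: c1i c2i; rewrite !in_itv/= => /andP[c10 c11] /andP[c20 c21].
have d1 : `|g' c1 - g' 0| <= K * ((`|M0| + 1) * (2 * e) * `|h| ^+ 2) by apply: dist => //; lra.
have d2 : `|g' c2 - g' 0| <= K * ((`|M0| + 1) * (2 * e) * `|h| ^+ 2) by apply: dist => //; lra.
have -> : ell (F ((2 * e) *: h)) - 2 * ell (F (e *: h)) + ell (F 0) =
    e * ((g' c2 - g' 0) - (g' c1 - g' 0)).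
  rewrite -[F 0](congr1 F (scale0r h)) -/(g _) -/(g _) -/(g 0).
  have -> : g (2 * e) - 2 * g e + g 0 = (g (2 * e) - g e) - (g e - g 0) by ring.
  by rewrite E1 E2; ring.
rewrite normrM (gtr0_norm ep).
have -> : K * M * `|h| ^+ 2 * e ^+ 2 =
  e * (K * ((`|M0| + 1) * (2 * e) * `|h| ^+ 2) + K * ((`|M0| + 1) * (2 * e) * `|h| ^+ 2)).
  by rewrite /M; ring.
rewrite ler_wpM2l ?(ltW ep)//; apply: (le_trans (ler_normB _ _)); exact: lerD.
Qed.

End SecondDifference.

Section ComplexFunctional.
Context {R : realType} {V W : normedModType R}.
Local Notation C := R[i].

Definition complex_functional (K : R) (ell : W -> C) :=
  [/\ forall x y, ell (x - y) = ell x - ell y,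
      forall (k : R) x, ell (k *: x) = k%:C * ell x & forall x, normc (ell x) <= K * `|x|].

Lemma Re_B (z w : C) : complex.Re (z - w) = complex.Re z - complex.Re w.
Proof. by case: z; case: w. Qed.
Lemma Im_B (z w : C) : complex.Im (z - w) = complex.Im z - complex.Im w.
Proof. by case: z; case: w. Qed.

Lemma Re_RM (k : R) (z : C) : complex.Re (k%:C * z) = k * complex.Re z.
Proof. by rewrite Re_M/= mul0r subr0. Qed.
Lemma Im_RM (k : R) (z : C) : complex.Im (k%:C * z) = k * complex.Im z.
Proof. by rewrite Im_M/= mul0r addr0. Qed.

Lemma Re_functional K ell : complex_functional K ell ->
  bounded_functional K (fun w => complex.Re (ell w)).
Proof.
move=> [eB eZ eK]; split=> [x y|k x|x]; first by rewrite eB Re_B.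
  by rewrite eZ Re_M/= mul0r subr0.
exact: le_trans (Re_le_normc _) (eK x).
Qed.

Lemma Im_functional K ell : complex_functional K ell ->
  bounded_functional K (fun w => complex.Im (ell w)).
Proof.
move=> [eB eZ eK]; split=> [x y|k x|x]; first by rewrite eB Im_B.
  by rewrite eZ Im_M/= mul0r addr0.
exact: le_trans (Im_le_normc _) (eK x).
Qed.

Lemma le_of_small (a b c e : R) : 0 < e -> 0 <= c ->
  (forall x, 0 < x -> x < e -> a <= b + c * x) -> a <= b.
Proof.
move=> e0 c0 h; rewrite leNgt; apply/negP => ba.
pose x := Num.min (e / 2) ((a - b) / (2 * (c + 1))).
have c1 : 0 < c + 1 by lra.
have x0 : 0 < x by rewrite lt_min !divr_gt0 ?subr_gt0// mulr_gt0.
have xe : x < e by rewrite /x gt_min; apply/orP; left; lra.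
have := h x x0 xe.
have : (c + 1) * x <= (a - b) / 2.
  have : x <= (a - b) / (2 * (c + 1)) by rewrite /x ge_min lexx orbT.
  rewrite ler_pdivlMr ?mulr_gt0//; lra.
nra.
Qed.

(** The second difference of e^2 Q is (4 - 2) e^2 Q, and the constants of the cubic error disappear
    as e tends to 0. The bound depends on the functional and the direction only through K and |h|,
    which permits letting both vary with N. *)
Lemma second_order_bound (U : set V) (F : V -> W) : open_nbhs 0 U -> C2_on U F ->
  exists2 M : R, 0 <= M & forall (h : V) (ell : W -> C) (K : R) (Q : C) (D e1 : R),
   0 <= K -> complex_functional K ell -> 0 < e1 -> 0 <= D -> ell (F 0) = 0 ->
   (forall e, 0 < e -> e < e1 -> U (e *: h) ->
      normc (ell (F (e *: h)) - (e ^+ 2)%:C * Q) <= D * e ^+ 3) ->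
   normc Q <= K * M * `|h| ^+ 2.
Proof.
move=> oU C2; have [M M0 hM] := C2_second_difference oU C2.
exists M => // h ell K Q D e1 K0 cf e10 D0 F0 happ.
have [e0 e00 hd] := hM h.
have nU : \forall y \near (0 : V), U y by exact: open_nbhs_nbhs.
have [dl dl0 hdl] : exists2 dl : R, 0 < dl & forall y, ball (0 : V) dl y -> U y.
  by move/nbhs_ballP: nU => [dl dl0 hdl]; exists dl.
pose e2 := Num.min (Num.min e0 (e1 / 2)) (dl / (2 * (`|h| + 1))).
have h1 : 0 < `|h| + 1 by rewrite ltr_wpDl.
have e20 : 0 < e2 by rewrite !lt_min e00 !divr_gt0// mulr_gt0.
have inU (r e : R) : 0 < e -> e < e2 -> 0 <= r -> r <= 2 * e -> U (r *: h).
  move=> ep ee r0 re; apply: hdl; rewrite -ball_normE /ball_/= sub0r normrN normrZ (ger0_norm r0).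
  apply: (@le_lt_trans _ _ (2 * e * (`|h| + 1))).
    by apply: ler_pM => //; rewrite lerDl.
  have : e < dl / (2 * (`|h| + 1)) by apply: (lt_le_trans ee); rewrite /e2 ge_min lexx orbT.
  by rewrite ltr_pdivlMr ?mulr_gt0//; lra.
have part (f : C -> R) : bounded_functional K (fun w => f (ell w)) ->
    (forall z w, f (z - w) = f z - f w) -> (forall (k : R) z, f (k%:C * z) = k * f z) ->
    (forall z, `|f z| <= normc z) -> 2 * `|f Q| <= K * M * `|h| ^+ 2.
  move=> bf fB fZ fn.
  (* The cubic errors at 2 e and e contribute D (2 e)^3 + 2 D e^3 = 10 D e^3. *)
  apply: (@le_of_small _ _ (10 * D) e2) => //; first by rewrite mulr_ge0.
  move=> e ep ee.
  have ee0 : e < e0 by apply: (lt_le_trans ee); rewrite /e2 !ge_min lexx.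
  have ee1 : 2 * e < e1.
    have : e < e1 / 2 by apply: (lt_le_trans ee); rewrite /e2 !ge_min lexx orbT.
    lra.
  have s := hd _ K e K0 bf ep ee0.
  have U1 : U (e *: h) by apply: (inU e e) => //; lra.
  have U2 : U ((2 * e) *: h) by apply: (inU (2 * e) e) => //; lra.
  have a1 := le_trans (fn _) (happ e ep (ltac:(lra)) U1).
  have a2 := le_trans (fn _) (happ (2 * e) (ltac:(lra)) ee1 U2).
  rewrite fB fZ in a1; rewrite fB fZ in a2; rewrite F0 in s.
  have f0 : f 0 = 0 by have := fB 0 0; rewrite subr0 subrr.
  rewrite f0 addr0 in s.
  set x := f (ell (F ((2 * e) *: h))) in s a2; set y := f (ell (F (e *: h))) in s a1.
  have t1 : `|2 * (e ^+ 2 * f Q)| <= (K * M * `|h| ^+ 2 + 10 * D * e) * e ^+ 2.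
    have -> : 2 * (e ^+ 2 * f Q) = (x - 2 * y) - ((x - (2 * e) ^+ 2 * f Q) - 2 * (y - e ^+ 2 * f Q)).
      by ring.
    apply: (le_trans (ler_normB _ _)).
    have b1 : `|x - (2 * e) ^+ 2 * f Q - 2 * (y - e ^+ 2 * f Q)| <= D * (2 * e) ^+ 3 + 2 * (D * e ^+ 3).
      apply: (le_trans (ler_normB _ _)); apply: lerD => //.
      by rewrite normrM ger0_norm// ler_wpM2l.
    apply: (le_trans (lerD s b1)); rewrite le_eqVlt; apply/orP; left; apply/eqP; ring.
  have e2p : 0 < e ^+ 2 by rewrite exprn_gt0.
  have E2 : `|2 * (e ^+ 2 * f Q)| = 2 * `|f Q| * e ^+ 2.
    rewrite normrM [`|e ^+ 2 * _|]normrM (ger0_norm (ltW e2p)) (ger0_norm (ler0n _ 2)); ring.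
  by move: t1; rewrite E2 ler_pM2r.
have r1 := part (fun z => complex.Re z) (Re_functional cf) Re_B
  Re_RM Re_le_normc.
have r2 := part (fun z => complex.Im z) (Im_functional cf) Im_B
  Im_RM Im_le_normc.
have := normc_le_ReIm Q; lra.
Qed.

End ComplexFunctional.

(** * Consequences of a C^2 extension for single Fourier modes *)

Section FlowBounds.
Context {R : realType} {d : nat} (gamma : 'I_d -> {posnum R}) (lambda : R[i])
  (c0 : R) (alpha beta : 'I_d -> R) (T s l : R).
Local Notation C := R[i].
Local Notation lattice := {ffun 'I_d -> int}.
Local Notation PS := (path_space gamma T s l).
Context (c0_gt0 : 0 < c0) (alpha_gt0 : forall j, 0 < alpha j) (T_gt0 : 0 < T).

Definition ell_u (t : R) (m : lattice) (w : PS) : C := coef (w.1.1 t) m.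
Definition ell_n (t : R) (m : lattice) (w : PS) : C := coef (w.1.2 t) m.

Let Cgp := Cg' gamma.

Let sob_coefB b r (f g : sobolev gamma b r) m : (coef (f - g) m : C) = coef f m - coef g m.
Proof.
exact: (congr1 (fun h : lattice -> Rcomplex R => h m) (@raddfB _ _ (val : sobolev gamma b r -> (lattice -> Rcomplex R)) f g)).
Qed.

Let sob_coefZ b r (k : R) (f : sobolev gamma b r) m : (coef (k *: f) m : C) = k%:C * coef f m.
Proof.
have -> := congr1 (fun h : lattice -> Rcomplex R => h m) (Defs.coefZ k f).
rewrite -[LHS]/(k *: coef f m : Rcomplex R); case: (coef f m) => x y.
by apply: complex_eq; rewrite ?Re_M ?Im_M /=; ring.
Qed.

Let cpathB (X : normedModType R) (f g : cpath T X) t : (f - g) t = f t - g t.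
Proof.
exact: (congr1 (fun h : R -> X => h t) (@raddfB _ _ (val : cpath T X -> (R -> X)) f g)).
Qed.

Let cpathZ (X : normedModType R) (k : R) (f : cpath T X) t : (k *: f) t = k *: f t.
Proof. exact: (congr1 (fun h : R -> X => h t) (pathZ k f)). Qed.

Lemma ell_u_functional t m :
  complex_functional (Cgp / bracket gamma m `^ s) (ell_u t m).
Proof.
have b0 : 0 < bracket gamma m `^ s by rewrite powR_gt0// bracket_gt0.
split=> [x y|k x|x].
- exact: (etrans (congr1 (fun f => coef f m) (cpathB x.1.1 y.1.1 t)) (sob_coefB _ _ _)).
- exact: (etrans (congr1 (fun f => coef f m) (cpathZ k x.1.1 t)) (sob_coefZ _ _ _)).
- rewrite mulrAC ler_pdivlMr// mulrC; apply: (le_trans (coef_le_norm _ _)).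
  rewrite ler_wpM2l ?Cg'_ge0//; apply: (le_trans (le_path_norm x.1.1 t)).
  by rewrite [leRHS]prod_normE le_max [`|x.1|]prod_normE le_max lexx.
Qed.

Lemma ell_n_functional t m :
  complex_functional (Cgp / bracket gamma m `^ l) (ell_n t m).
Proof.
have b0 : 0 < bracket gamma m `^ l by rewrite powR_gt0// bracket_gt0.
split=> [x y|k x|x].
- exact: (etrans (congr1 (fun f => coef f m) (cpathB x.1.2 y.1.2 t)) (sob_coefB _ _ _)).
- exact: (etrans (congr1 (fun f => coef f m) (cpathZ k x.1.2 t)) (sob_coefZ _ _ _)).
- rewrite mulrAC ler_pdivlMr// mulrC; apply: (le_trans (coef_le_norm _ _)).
  rewrite ler_wpM2l ?Cg'_ge0//; apply: (le_trans (le_path_norm x.1.2 t)).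
  by rewrite [leRHS]prod_normE le_max [`|x.1|]prod_normE le_max lexx orbT.
Qed.

(* exact solutions with data e * h, whose mode m at time t is e^2 Q + O(e^3) *)
Definition quadratic_u (h : data_space gamma s l) (t : R) (m : lattice) (Q : C) :=
  exists D e1 : R, [/\ 0 <= D, 0 < e1 & forall e, 0 < e -> e < e1 ->
    exists u0 n0 n1 u n, [/\ smooth_data gamma u0 n0 n1,
      zakharov_solution gamma lambda c0 alpha beta T u0 n0 n1 u n,
      [/\ coef (e *: h).1.1 = fourier gamma u0, coef (e *: h).1.2 = rfourier gamma n0 &
        coef (e *: h).2 = rfourier gamma n1] &
      normc (fourier gamma (fun x => u (t, x)) m - (e ^+ 2)%:C * Q) <= D * e ^+ 3]].

Definition quadratic_n (h : data_space gamma s l) (t : R) (m : lattice) (Q : C) :=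
  exists D e1 : R, [/\ 0 <= D, 0 < e1 & forall e, 0 < e -> e < e1 ->
    exists u0 n0 n1 u n, [/\ smooth_data gamma u0 n0 n1,
      zakharov_solution gamma lambda c0 alpha beta T u0 n0 n1 u n,
      [/\ coef (e *: h).1.1 = fourier gamma u0, coef (e *: h).1.2 = rfourier gamma n0 &
        coef (e *: h).2 = rfourier gamma n1] &
      normc (rfourier gamma (fun x => n (t, x)) m - (e ^+ 2)%:C * Q) <= D * e ^+ 3]].

(** The value at 0 is read off the constructed solution with empty data: for A = B = 0 the error of
    the expansion is 0, so all its Fourier coefficients vanish. *)
Lemma flow_at_0 U (F : data_space gamma s l -> PS) (t : R) m : U 0 ->
  extends_flow lambda c0 alpha beta U F -> t \in `[- T, T] ->
  ell_u t m (F 0) = 0 /\ ell_n t m (F 0) = 0.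
Proof.
move=> U0 [_ ext] tT.
have nil_size (x : C * lattice) : x \in [::] -> fsize gamma x.2 <= 0 by [].
have nil_mass : \sum_(x <- ([::] : seq (C * lattice))) normc x.1 <= 0 by rewrite big_nil.
have T2 : 2 * T < 2 * T + 1 by rewrite ltrDl.
have small1 : 8 * normc lambda * (2 * T + 1) * 0 <= 1 by rewrite mulr0.
have small2 : 16 * Kz c0 alpha beta * 0 * (2 * T + 1) * 0 ^+ 2 <= 0 by rewrite mulr0 !mul0r.
have [u [n [sol sm hu hn]]] := @small_data_solution R d gamma lambda c0 alpha beta
  [::] [::] 0 0 0 (2 * T + 1) T c0_gt0 alpha_gt0 (lexx 0) (lexx 0) (lexx 0) T_gt0 T2
  nil_size nil_size nil_mass nil_mass small1 small2.
have u0 : fourier gamma (u_init gamma [::]) = fun=> 0.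
  apply/funext => k; rewrite -[RHS](fourier0 gamma k); congr fourier.
  by apply/funext => x; rewrite /u_init big_nil.
have n0 : rfourier gamma (n_init gamma [::]) = fun=> 0.
  apply/funext => k; rewrite -[RHS](fourier0 gamma k) /rfourier; congr fourier.
  by apply/funext => x; rewrite /n_init big_nil.
have n1 : rfourier gamma (nt_init gamma c0 alpha [::]) = fun=> 0.
  apply/funext => k; rewrite -[RHS](fourier0 gamma k) /rfourier; congr fourier.
  by apply/funext => x; rewrite /nt_init big_nil.
have [E1 E2] := ext _ _ _ u n 0 U0 sm sol (ltac:(by split; rewrite ?u0 ?n0 ?n1)) t tT.
rewrite /ell_u /ell_n E1 E2.
have := hu t m tT; have := hn t m tT.
rewrite UlS ZlS /nextU /nextZ /convL /= !big_nil conjc0 addr0 !mulr0 !subr0 !mul0r.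
move=> h1 h2; split; apply: eq0_normc; apply/eqP; rewrite eq_le normc_ge0 andbT //.
Qed.

Lemma flow_C2_bound : flow_extends_C2 gamma lambda c0 alpha beta T s l ->
  exists2 M : R, 0 <= M & forall (h : data_space gamma s l) t m Q, t \in `[- T, T] ->
   (quadratic_u h t m Q -> bracket gamma m `^ s * normc Q <= M * `|h| ^+ 2) /\
   (quadratic_n h t m Q -> bracket gamma m `^ l * normc Q <= M * `|h| ^+ 2).
Proof.
move=> [U [F [oU ext C2]]]; have [M M0 hM] := second_order_bound oU C2.
have [_ U0] := oU.
exists (Cgp * M); first by rewrite mulr_ge0 ?Cg'_ge0.
move=> h t m Q tT; have [Fu Fn] := flow_at_0 m U0 ext tT.
have bs r : 0 < bracket gamma m `^ r by rewrite powR_gt0// bracket_gt0.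
have fin r : normc Q <= Cgp / bracket gamma m `^ r * M * `|h| ^+ 2 ->
    bracket gamma m `^ r * normc Q <= Cgp * M * `|h| ^+ 2.
  have -> : Cgp / bracket gamma m `^ r * M * `|h| ^+ 2 =
     (Cgp * M * `|h| ^+ 2) / bracket gamma m `^ r by ring.
  by rewrite ler_pdivlMr// mulrC.
have K0 r : 0 <= Cgp / bracket gamma m `^ r by rewrite divr_ge0 ?Cg'_ge0// ltW.
split=> -[D [e1 [D0 e10 happ]]]; apply: fin.
  apply: (hM h _ _ Q D e1 (K0 s) (ell_u_functional t m) e10 D0 Fu) => e ep ee Ue.
  have [u0 [n0 [n1 [u [n [sm sol cf bd]]]]]] := happ e ep ee.
  have [_ ext2] := ext; have [E1 _] := ext2 _ _ _ _ _ _ Ue sm sol cf t tT.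
  by rewrite /ell_u E1.
apply: (hM h _ _ Q D e1 (K0 l) (ell_n_functional t m) e10 D0 Fn) => e ep ee Ue.
have [u0 [n0 [n1 [u [n [sm sol cf bd]]]]]] := happ e ep ee.
have [_ ext2] := ext; have [_ E1] := ext2 _ _ _ _ _ _ Ue sm sol cf t tT.
by rewrite /ell_n E1.
Qed.

End FlowBounds.

Section QuadraticData.
Context {R : realType} {d : nat} (gamma : 'I_d -> {posnum R}) (lambda : R[i])
  (c0 : R) (alpha beta : 'I_d -> R) (T s l : R).
Local Notation C := R[i].
Local Notation lattice := {ffun 'I_d -> int}.
Local Notation om := (om gamma alpha).
Local Notation Om := (Om gamma c0 alpha).
Local Notation rz := (rz gamma c0 alpha beta).
Local Notation Ul := (Ul gamma lambda c0 alpha beta).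
Local Notation Zl := (Zl gamma lambda c0 alpha beta).
Local Notation br := (bracket gamma).
Implicit Types (p q k m : lattice) (D : seq (C * lattice)) (e : R).
Context (c0_gt0 : 0 < c0) (alpha_gt0 : forall j, 0 < alpha j) (T_gt0 : 0 < T).

Definition scaleD e D : seq (C * lattice) := [seq (e%:C * x.1, x.2) | x <- D].

Lemma mass_scaleD e D : 0 <= e ->
  \sum_(x <- scaleD e D) normc x.1 = e * \sum_(x <- D) normc x.1.
Proof.
move=> e0; rewrite big_map mulr_sumr; apply: eq_bigr => x _ /=.
by rewrite normcM normc_real ger0_norm.
Qed.

Lemma fsize_le_sum D x : x \in D -> fsize gamma x.2 <= \sum_(y <- D) fsize gamma y.2.
Proof.
by move=> xD; rewrite (big_rem x)//= lerDl sumr_ge0// => y _; exact: fsize_ge0.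
Qed.

Lemma sum_fsize_ge0 D : 0 <= \sum_(y <- D) fsize gamma y.2.
Proof. by apply: sumr_ge0 => y _; exact: fsize_ge0. Qed.

(** For data of size e the time scale can be taken proportional to 1 / e; the error, a mass of size
    e times (t / rho)^2, is then of order e^3. *)
Lemma scaled_solution (U0 Z0 : seq (C * lattice)) : exists D e1 : R,
  [/\ 0 <= D, 0 < e1 & forall e, 0 < e -> e < e1 -> exists u n,
   [/\ zakharov_solution gamma lambda c0 alpha beta T (u_init gamma (scaleD e U0))
         (n_init gamma (scaleD e Z0)) (nt_init gamma c0 alpha (scaleD e Z0)) u n,
       smooth_data gamma (u_init gamma (scaleD e U0)) (n_init gamma (scaleD e Z0))
         (nt_init gamma c0 alpha (scaleD e Z0)),
       forall t m, t \in `[- T, T] ->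
         normc (fourier gamma (fun x => u (t, x)) m -
           (vol gamma)%:C * \sum_(l <- Ul (scaleD e U0) (scaleD e Z0) 0 ++
             Ul (scaleD e U0) (scaleD e Z0) 1 | l.2 == m) l.1.1 t) <= D * e ^+ 3 &
       forall t m, t \in `[- T, T] ->
         normc (rfourier gamma (fun x => n (t, x)) m -
           2^-1%:C * (vol gamma)%:C *
           (\sum_(l <- Zl (scaleD e U0) (scaleD e Z0) 0 ++
              Zl (scaleD e U0) (scaleD e Z0) 1 | l.2 == m) l.1.1 t +
            (\sum_(l <- Zl (scaleD e U0) (scaleD e Z0) 0 ++
              Zl (scaleD e U0) (scaleD e Z0) 1 | l.2 == - m) l.1.1 t)^*%C)) <= D * e ^+ 3]].
Proof.
(* The + 1 gives b >= 1, which [s2] needs even for empty wave data. *)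
pose a := \sum_(x <- U0) normc x.1; pose b := \sum_(x <- Z0) normc x.1 + 1.
pose kap := \sum_(y <- U0) fsize gamma y.2 + \sum_(y <- Z0) fsize gamma y.2.
have Kz0 := @Kz_ge0 R d c0 alpha beta c0_gt0.
set kz := Kz c0 alpha beta in Kz0.
(* With rho = 1 / (e K) each of the two smallness conditions bounds one summand by K; the + 1 makes
   K positive. *)
pose K := 8 * normc lambda * b + 16 * kz * kap * a ^+ 2 + 1.
have a0 : 0 <= a by apply: sumr_ge0 => x _; exact: normc_ge0.
have b1 : 1 <= b by rewrite lerDr; apply: sumr_ge0 => x _; exact: normc_ge0.
have b0 : 0 < b := lt_le_trans ltr01 b1.
have kap0 : 0 <= kap by rewrite addr_ge0 ?sum_fsize_ge0.
have t1 : 0 <= 8 * normc lambda * b by rewrite !mulr_ge0 ?normc_ge0// ltW.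
have t2 : 0 <= 16 * kz * kap * a ^+ 2 by rewrite mulr_ge0 ?exprn_ge0// !mulr_ge0.
have K0 : 0 < K by rewrite /K; lra.
pose V := vol gamma.
have V0 : 0 < V := vol_gt0 gamma.
exists (16 * V * (a + b) * (T * K) ^+ 2), (1 / (2 * T * K)); split.
- apply: mulr_ge0; last exact: sqr_ge0.
  apply: mulr_ge0; [apply: mulr_ge0 => //; exact: ltW|apply: addr_ge0 => //; exact: ltW].
- by rewrite divr_gt0// !mulr_gt0.
move=> e e0 ee1.
have sU x : x \in scaleD e U0 -> fsize gamma x.2 <= kap.
  by case/mapP => y yU -> /=; apply: (le_trans (fsize_le_sum yU)); rewrite lerDl sum_fsize_ge0.
have sZ x : x \in scaleD e Z0 -> fsize gamma x.2 <= kap.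
  by case/mapP => y yU -> /=; apply: (le_trans (fsize_le_sum yU)); rewrite lerDr sum_fsize_ge0.
have mU : \sum_(x <- scaleD e U0) normc x.1 <= e * a by rewrite mass_scaleD// ltW.
have mZ : \sum_(x <- scaleD e Z0) normc x.1 <= e * b.
  by rewrite mass_scaleD ?(ltW e0)// ler_wpM2l ?(ltW e0)// lerDl.
have eK0 : 0 < e * K by rewrite mulr_gt0.
pose rho := (e * K)^-1.
have rho0 : 0 < rho by rewrite invr_gt0.
have Trho : 2 * T < rho.
  rewrite /rho -[(e * K)^-1]mul1r ltr_pdivlMr//.
  by move: ee1; rewrite ltr_pdivlMr ?mulr_gt0//; lra.
have s1 : 8 * normc lambda * rho * (e * b) <= 1.
  have -> : 8 * normc lambda * rho * (e * b) = (8 * normc lambda * b) / K.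
    by rewrite /rho; field; rewrite !gt_eqF.
  by rewrite ler_pdivrMr// mul1r /K; lra.
have s2 : 16 * kz * kap * rho * (e * a) ^+ 2 <= e * b.
  have -> : 16 * kz * kap * rho * (e * a) ^+ 2 = e * ((16 * kz * kap * a ^+ 2) / K).
    by rewrite /rho; field; rewrite !gt_eqF.
  rewrite ler_wpM2l ?(ltW e0)//; apply: le_trans b1.
  by rewrite ler_pdivrMr// mul1r /K; lra.
have ea0 : 0 <= e * a by rewrite mulr_ge0// ltW.
have eb0 : 0 <= e * b by rewrite mulr_ge0// ltW.
have [u [n [sol sm hu hn]]] := @small_data_solution R d gamma lambda c0 alpha beta _ _
  kap (e * a) (e * b) rho T c0_gt0 alpha_gt0 kap0 ea0 eb0 T_gt0 Trho sU sZ mU mZ s1 s2.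
have err (t c : R) : t \in `[- T, T] -> 0 <= c -> c <= a + b ->
    16 * V * (e * c) * (`|t| / rho) ^+ 2 <= 16 * V * (a + b) * (T * K) ^+ 2 * e ^+ 3.
  rewrite in_itv/= -ler_norml => tT cc0 cab.
  have -> : 16 * V * (a + b) * (T * K) ^+ 2 * e ^+ 3 = 16 * V * (e * (a + b)) * (T * (e * K)) ^+ 2 by ring.
  rewrite /rho invrK; apply: ler_pM.
  - by rewrite !mulr_ge0// ?ltW.
  - by rewrite exprn_ge0// mulr_ge0// ltW.
  - by rewrite ler_wpM2l ?mulr_ge0 ?(ltW V0)// ler_wpM2l// ltW.
  - apply: lerXn2r; rewrite ?nnegrE.
    + by apply: mulr_ge0 => //; exact: ltW.
    + by apply: mulr_ge0; exact: ltW.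
    + by rewrite ler_pM2r.
exists u, n; split => // t m tT.
  by apply: (le_trans (hu t m tT)); apply: err => //; rewrite lerDl ltW.
by apply: (le_trans (hn t m tT)); apply: err => //; [exact: ltW|rewrite lerDr].
Qed.

Let coefZE b r (e : R) (f : sobolev gamma b r) m : (coef (e *: f) m : C) = e%:C * coef f m.
Proof.
have -> := congr1 (fun h : lattice -> Rcomplex R => h m) (Defs.coefZ e f).
rewrite -[LHS]/(e *: coef f m : Rcomplex R); case: (coef f m) => x y.
by apply: complex_eq; rewrite ?Re_M ?Im_M /=; ring.
Qed.

Let pairHE (r : R) (a1 a2 : C) p q m :
  (coef (pairH gamma r a1 a2 p q) m : C) = (if p == m then a1 else 0) + (if q == m then a2 else 0).
Proof. by rewrite ![_ == m]eq_sym. Qed.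

Let hermHE (r : R) (a : C) k m : (coef (hermH gamma r a k) m : C) =
  (if k == m then a else 0) + (if k == - m then a^*%C else 0).
Proof. by rewrite -(eqr_oppLR k) ![_ == m]eq_sym. Qed.

Lemma coef_u_init e (r : R) (A0 A1 : C) p q :
  coef (e *: pairH gamma r ((vol gamma)%:C * A0) ((vol gamma)%:C * A1) p q) =
  fourier gamma (u_init gamma (scaleD e [:: (A0, p); (A1, q)])).
Proof.
apply/funext => m; rewrite [LHS]coefZE pairHE /u_init.
rewrite [RHS](fourier_sum gamma _ (fun y : C * lattice => y.1) (fun y => y.2)).
rewrite big_map big_mkcond /= !big_cons big_nil /= addr0.
by case: ifP => _; case: ifP => _; ring.
Qed.

Lemma coef_u_init1 e (r : R) (A0 : C) p :
  coef (e *: pairH gamma r ((vol gamma)%:C * A0) 0 p p) =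
  fourier gamma (u_init gamma (scaleD e [:: (A0, p)])).
Proof.
apply/funext => m; rewrite [LHS]coefZE pairHE /u_init.
rewrite [RHS](fourier_sum gamma _ (fun y : C * lattice => y.1) (fun y => y.2)).
rewrite big_map big_mkcond /= !big_cons big_nil /= addr0.
by case: ifP => _; ring.
Qed.

Lemma coef_n_init e (r : R) (B0 : C) k :
  coef (e *: hermH gamma r (2^-1%:C * (vol gamma)%:C * B0) k) =
  rfourier gamma (n_init gamma (scaleD e [:: (B0, k)])).
Proof.
apply/funext => m; rewrite [LHS]coefZE hermHE /n_init.
rewrite [RHS](rfourier_sum gamma _ (fun y : C * lattice => y.1) (fun y => y.2)).
rewrite !big_map ![\sum_(_ <- _ | _) _]big_mkcond /= !big_cons !big_nil /= !addr0.
have JM (x y : C) : (x * y)^*%C = x^*%C * y^*%C by exact: rmorphM.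
case: ifP => _; case: ifP => _; rewrite ?JM ?conjc_real ?conjc0; ring.
Qed.

Lemma coef_nt_init e (r : R) (B0 : C) k :
  coef (e *: hermH gamma r (2^-1%:C * (vol gamma)%:C * ((0 -i* Om k) * B0)) k) =
  rfourier gamma (nt_init gamma c0 alpha (scaleD e [:: (B0, k)])).
Proof.
rewrite coef_n_init; congr rfourier; apply/funext => x; congr complex.Re.
by rewrite !big_map !big_cons !big_nil /= !addr0; ring.
Qed.

Lemma coef_zero_init r : coef (0 : sobolev gamma true r) = rfourier gamma (n_init gamma [::]) /\
  coef (0 : sobolev gamma true r) = rfourier gamma (nt_init gamma c0 alpha [::]).
Proof.
have z0 (f : 'rV[R]_d -> R) : (forall x, f x = 0) -> coef (0 : sobolev gamma true r) = rfourier gamma f.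
  move=> h; apply: etrans (raddf0 (val : sobolev gamma true r -> (lattice -> Rcomplex R))) _.
  apply/funext => m'; rewrite (_ : f = fun=> 0) ?[RHS](fourier0 gamma m')//.
  by apply/funext => x; rewrite h.
by split; apply: z0 => x; rewrite /n_init /nt_init big_nil.
Qed.

(** The velocity is tied to the displacement so that z consists of the single mode k, a wave
    travelling in one direction. *)
Definition data_u (A0 B0 : C) p k : data_space gamma s l :=
  (pairH gamma s ((vol gamma)%:C * A0) 0 p p,
   hermH gamma l (2^-1%:C * (vol gamma)%:C * B0) k,
   hermH gamma (l - 1) (2^-1%:C * (vol gamma)%:C * ((0 -i* Om k) * B0)) k).

Definition data_n (A0 A1 : C) p q : data_space gamma s l :=
  (pairH gamma s ((vol gamma)%:C * A0) ((vol gamma)%:C * A1) p q, 0, 0).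

Lemma quadratic_data_u (A0 B0 : C) p k (t : R) : k != 0 -> t \in `[- T, T] ->
  quadratic_u lambda c0 alpha beta T (data_u A0 B0 p k) t (p + k)
   ((vol gamma)%:C * ((- 'i%C * lambda * (2^-1)%:C * A0 * B0) * cis (- om (p + k) * t) *
    oscint (om (p + k) - (om p + Om k)) t)).
Proof.
move=> k0 tT; have [D [e1 [D0 e10 h]]] := scaled_solution [:: (A0, p)] [:: (B0, k)].
exists D, e1; split => // e ep ee; have [u [n [sol sm hu _]]] := h e ep ee.
do 3 eexists; exists u, n; split; [exact: sm|exact: sol| |].
  by split; [exact: coef_u_init1|exact: coef_n_init|exact: coef_nt_init].
move: (hu t (p + k) tT); rewrite Ul_second//.
rewrite (_ : (vol gamma)%:C * _ = (e ^+ 2)%:C * ((vol gamma)%:C *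
  (- 'i%C * lambda * 2^-1%:C * A0 * B0 * cis (- om (p + k) * t) *
   oscint (om (p + k) - (om p + Om k)) t)))//.
by rewrite /= expr2 realCM; ring.
Qed.

Lemma quadratic_data_n (A0 A1 : C) p k (t : R) : k != 0 -> t \in `[- T, T] ->
  quadratic_n lambda c0 alpha beta T (data_n A0 A1 p (p + k)) t k
   (2^-1%:C * (vol gamma)%:C * (- 'i%C * (rz k)%:C * (A1 * A0^*%C)) * nmain gamma c0 alpha p k t).
Proof.
move=> k0 tT; have [D [e1 [D0 e10 h]]] := scaled_solution [:: (A0, p); (A1, p + k)] [::].
exists D, e1; split => // e ep ee; have [u [n [sol sm _ hn]]] := h e ep ee.
do 3 eexists; exists u, n; split; [exact: sm|exact: sol| |].
  split; first exact: coef_u_init.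
    rewrite -[(e *: _).1.2]/(e *: 0) scaler0; exact: (coef_zero_init l).1.
  rewrite -[(e *: _).2]/(e *: 0) scaler0; exact: (coef_zero_init (l - 1)).2.
move: (hn t k tT); rewrite Zl_main//.
rewrite (_ : 2^-1%:C * _ * _ * _ = (e ^+ 2)%:C * (2^-1%:C * (vol gamma)%:C *
  (- 'i%C * (rz k)%:C * (A1 * A0^*%C)) * nmain gamma c0 alpha p k t))//.
have JM (x y : C) : (x * y)^*%C = x^*%C * y^*%C by exact: rmorphM.
by rewrite /= expr2 realCM JM conjc_real; ring.
Qed.

Lemma powRN_mul (x r : R) : 0 < x -> x `^ r * x `^ (- r) = 1.
Proof. by move=> x0; rewrite powRN divff// gt_eqF// powR_gt0. Qed.

Lemma data_norm (h : data_space gamma s l) (K : R) :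
  `|h.1.1| <= K -> `|h.1.2| <= K -> `|h.2| <= K -> `|h| <= K.
Proof. by move=> h1 h2 h3; rewrite prod_normE ge_max h3 andbT prod_normE ge_max h1 h2. Qed.

Definition sumalpha : R := \sum_(j < d) alpha j.

Lemma Om_le_bracket k : Om k <= c0 * Num.sqrt sumalpha * br k.
Proof.
rewrite -mulrA ler_wpM2l ?(ltW c0_gt0)// -sqrtrM; last first.
  by apply: sumr_ge0 => j _; exact: ltW.
apply: ler_wsqrtr; rewrite /sumalpha mulr_suml; apply: ler_sum => j _.
rewrite ler_wpM2l ?(ltW (alpha_gt0 j))//.
apply: (@le_trans _ _ (\sum_(i < d) freq gamma k i ^+ 2)); last by rewrite lerDr.
by rewrite (bigD1 j)//= lerDl sumr_ge0// => i _; exact: sqr_ge0.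
Qed.

Let cancel_weights (X q a a' b b' K : R) : 0 < q -> 0 <= a -> 0 <= b ->
  a * a' = 1 -> b * b' = 1 -> X * (q * (a' * b')) <= K -> X <= K / q * (a * b).
Proof.
move=> q0 a0 b0 aa bb h; rewrite [leRHS]mulrAC ler_pdivlMr//.
have -> : X * q = X * (q * (a' * b')) * (a * b).
  transitivity (X * q * (a * a') * (b * b')); first by rewrite aa bb !mulr1.
  by ring.
by apply: ler_wpM2r => //; exact: mulr_ge0.
Qed.

(** Amplitudes equal to the inverse weights give data of norm bounded uniformly in p and k. The
    uniform bound on the quadratic term then becomes an inequality between weights; [lambda != 0]
    keeps the interaction from vanishing. *)
Lemma C2_estimate_u : lambda != 0 -> flow_extends_C2 gamma lambda c0 alpha beta T s l ->
  exists2 M : R, 0 <= M & forall p k (t : R), k != 0 -> t \in `[- T, T] ->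
    br (p + k) `^ s * normc (oscint (om (p + k) - (om p + Om k)) t) <=
    M * (br p `^ s * br k `^ l).
Proof.
move=> la0 C2; have [M M0 hM] := flow_C2_bound c0_gt0 alpha_gt0 T_gt0 C2.
pose V := vol gamma; have V0 : 0 < V := vol_gt0 gamma.
pose K := Cg gamma * V * (1 + c0 * Num.sqrt sumalpha).
have la1 : 0 < normc lambda by rewrite lt_neqAle eq_sym normc_eq0 la0 normc_ge0.
exists (M * K ^+ 2 / (V * normc lambda / 2)).
  apply: divr_ge0; first by apply: mulr_ge0 => //; exact: sqr_ge0.
  by apply: divr_ge0 => //; apply: mulr_ge0; [exact: ltW|exact: normc_ge0].
move=> p k t k0 tT.
have bp : 0 < br p by exact: bracket_gt0.
have bk : 0 < br k by exact: bracket_gt0.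
pose A0 : C := (br p `^ (- s))%:C; pose B0 : C := (br k `^ (- l))%:C.
have nA : normc A0 = br p `^ (- s) by rewrite normc_real ger0_norm// powR_ge0.
have nB : normc B0 = br k `^ (- l) by rewrite normc_real ger0_norm// powR_ge0.
have sa0 : 0 <= c0 * Num.sqrt sumalpha by rewrite mulr_ge0 ?sqrtr_ge0 ?(ltW c0_gt0).
have CV0 : 0 <= Cg gamma * V by rewrite mulr_ge0 ?Cg_ge0 ?(ltW V0).
have nV : normc V%:C = V by rewrite normc_real gtr0_norm.
have n2 : normc (2^-1%:C : C) = 2^-1 by rewrite normc_real ger0_norm.
have hn : `|data_u A0 B0 p k| <= K.
  apply: data_norm => /=.
  - apply: (le_trans (norm_pairH _ _ _ _ _ _)).
    rewrite normcM nV nA normc0 mulr0 addr0. 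
    rewrite (_ : _ * _ = Cg gamma * V * (br p `^ s * br p `^ (- s))); last by ring.
    rewrite powRN_mul// ler_wpM2l//.
    by rewrite lerDl.
  - apply: (le_trans (norm_hermH _ _ _ _)).
    rewrite !normcM n2 nV nB.
    rewrite (_ : _ * _ = Cg gamma * V * (br k `^ l * br k `^ (- l))); last by field.
    by rewrite powRN_mul// ler_wpM2l// lerDl.
  - apply: (le_trans (norm_hermH _ _ _ _)).
    rewrite !normcM n2 nV nB.
    (* The velocity is measured in H^(l-1), and the missing weight is made up by [Om], which is
       bounded by a multiple of the bracket. *)
    have -> : normc (0 -i* Om k) = Om k.
      by rewrite /normc expr0n add0r sqrrN sqrtr_sqr ger0_norm// Om_ge0.
    rewrite (_ : _ * _ = Cg gamma * V * (Om k * (br k `^ (l - 1) * br k `^ (- l)))); last by field.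
    rewrite -powRD ?(gt_eqF bk) ?implybT// (_ : l - 1 - l = - 1); last by ring.
    rewrite ler_wpM2l// powR_inv1 ?(ltW bk)//.
    by apply: (@le_trans _ _ (c0 * Num.sqrt sumalpha)); [rewrite ler_pdivrMr// Om_le_bracket|rewrite lerDr].
have K0 : 0 <= K by rewrite mulr_ge0// addr_ge0.
have [/(_ (quadratic_data_u A0 B0 p k0 tT)) hq _] := hM (data_u A0 B0 p k) t (p + k)
  ((vol gamma)%:C * ((- 'i%C * lambda * (2^-1)%:C * A0 * B0) * cis (- om (p + k) * t) *
    oscint (om (p + k) - (om p + Om k)) t)) tT.
have h2 : M * `|data_u A0 B0 p k| ^+ 2 <= M * K ^+ 2.
  by rewrite ler_wpM2l// lerXn2r ?nnegrE.
move: (le_trans hq h2); rewrite !normcM normcN normc_i normc_cis nV n2 nA nB.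
set osc := normc (oscint _ _); set x := br (p + k) `^ s => hh.
have ps0 : 0 < br p `^ s by rewrite powR_gt0.
have kl0 : 0 < br k `^ l by rewrite powR_gt0.
have VL : 0 < V * normc lambda / 2 by rewrite divr_gt0// mulr_gt0.
have alg (y v L o a' b' : R) :
    y * (v * (1 * L * 2^-1 * a' * b' * 1 * o)) = y * o * (v * L / 2 * (a' * b')) by field.
rewrite alg in hh.
exact: cancel_weights VL (ltW ps0) (ltW kl0) (powRN_mul s bp) (powRN_mul l bk) hh.
Qed.

Lemma C2_estimate_n : flow_extends_C2 gamma lambda c0 alpha beta T s l ->
  exists2 M : R, 0 <= M & forall p k (t : R), k != 0 -> t \in `[- T, T] ->
    br k `^ l * `|rz k| * normc (nmain gamma c0 alpha p k t) <=
    M * (br p `^ s * br (p + k) `^ s).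
Proof.
move=> C2; have [M M0 hM] := flow_C2_bound c0_gt0 alpha_gt0 T_gt0 C2.
pose V := vol gamma; have V0 : 0 < V := vol_gt0 gamma.
pose K := Cg gamma * V * 2.
have CV0 : 0 <= Cg gamma * V by rewrite mulr_ge0 ?Cg_ge0 ?(ltW V0).
have K0 : 0 <= K by rewrite mulr_ge0.
exists (M * K ^+ 2 / (V / 2)).
  apply: divr_ge0; first by apply: mulr_ge0 => //; exact: sqr_ge0.
  by apply: divr_ge0 => //; exact: ltW.
move=> p k t k0 tT.
have bp : 0 < br p by exact: bracket_gt0.
have bq : 0 < br (p + k) by exact: bracket_gt0.
pose A0 : C := (br p `^ (- s))%:C; pose A1 : C := (br (p + k) `^ (- s))%:C.
have nA : normc A0 = br p `^ (- s) by rewrite normc_real ger0_norm// powR_ge0.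
have nB : normc A1 = br (p + k) `^ (- s) by rewrite normc_real ger0_norm// powR_ge0.
have nV : normc V%:C = V by rewrite normc_real gtr0_norm.
have n2 : normc (2^-1%:C : C) = 2^-1 by rewrite normc_real ger0_norm.
have hn : `|data_n A0 A1 p (p + k)| <= K.
  apply: data_norm => /=; rewrite ?normr0//.
  apply: (le_trans (norm_pairH _ _ _ _ _ _)).
  have -> : normc (V%:C * A0) = V * br p `^ (- s) by rewrite normcM nV nA.
  have -> : normc (V%:C * A1) = V * br (p + k) `^ (- s) by rewrite normcM nV nB.
  have alg (g v a a' b b' : R) : g * (a * (v * a') + b * (v * b')) = g * v * (a * a' + b * b') by ring.
  by rewrite alg !powRN_mul.
have [_ /(_ (quadratic_data_n A0 A1 p k0 tT)) hq] := hM (data_n A0 A1 p (p + k)) t k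
  (2^-1%:C * (vol gamma)%:C * (- 'i%C * (rz k)%:C * (A1 * A0^*%C)) * nmain gamma c0 alpha p k t) tT.
have h2 : M * `|data_n A0 A1 p (p + k)| ^+ 2 <= M * K ^+ 2.
  by rewrite ler_wpM2l// lerXn2r ?nnegrE.
move: (le_trans hq h2); rewrite !normcM normcN normc_i nV n2 normc_conj nA nB normc_real.
set osc := normc (nmain _ _ _ _ _ _); set x := br k `^ l => hh.
have ps0 : 0 < br p `^ s by rewrite powR_gt0.
have qs0 : 0 < br (p + k) `^ s by rewrite powR_gt0.
have V2 : 0 < V / 2 by rewrite divr_gt0.
have alg (y v r o a' b' : R) :
    y * (2^-1 * v * (1 * r * (b' * a')) * o) = y * r * o * (v / 2 * (a' * b')) by field.
rewrite alg in hh.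
exact: cancel_weights V2 (ltW ps0) (ltW qs0) (powRN_mul s bp) (powRN_mul s bq) hh.
Qed.

End QuadraticData.

(** * Resonant and nonresonant frequencies *)

Section Comparison.
Context {R : realType}.

Definition comparable_with (c : R) (x y : R) := x <= c * y /\ y <= c * x.

(** The sum of the two powers of c serves both signs of r at once. *)
Lemma powR_comparable (c r : R) : 0 < c -> exists2 K : R, 0 < K &
  forall x y : R, 0 < x -> 0 < y -> comparable_with c x y -> x `^ r <= K * y `^ r.
Proof.
move=> c0; exists (c `^ r + c `^ (- r)); first by rewrite addr_gt0// powR_gt0.
move=> x y x0 y0 [xy yx].
have [r0|r0] := leP 0 r.
  apply: (@le_trans _ _ (c `^ r * y `^ r)).
    by rewrite -powRM ?(ltW c0) ?(ltW y0)// ge0_ler_powR// ?nnegrE ?ltW// mulr_gt0.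
  by rewrite ler_wpM2r ?powR_ge0// lerDl powR_ge0.
apply: (@le_trans _ _ (c `^ (- r) * y `^ r)).
  have h : y `^ (- r) <= c `^ (- r) * x `^ (- r).
    by rewrite -powRM ?(ltW c0) ?(ltW x0)// ge0_ler_powR// ?nnegrE ?ltW ?mulr_gt0// oppr_gt0.
  have x1 : 0 < x `^ r by rewrite powR_gt0.
  have y1 : 0 < y `^ r by rewrite powR_gt0.
  move: h; rewrite ![_ `^ (- r)]powRN; set C := (c `^ r)^-1.
  rewrite ler_pdivlMr// -[(y `^ r)^-1]mul1r mulrAC ler_pdivrMr// mul1r.
  by [].
by rewrite ler_wpM2r ?powR_ge0// lerDr powR_ge0.
Qed.

Lemma powR_unbounded (a K : R) (N0 : nat) : 0 < a -> exists2 N : nat, (N0 <= N)%N & K < N%:R `^ a.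
Proof.
move=> a0; pose y := (`|K| + 1) `^ a^-1.
pose N := maxn N0 (Num.bound y).
exists N; first exact: leq_maxl.
have K1 : 0 < `|K| + 1 by rewrite ltr_wpDl.
have yN : y < N%:R.
  apply: (@lt_le_trans _ _ (Num.bound y)%:R).
    by apply: archi_boundP; exact: powR_ge0.
  by rewrite ler_nat leq_maxr.
have : y `^ a < N%:R `^ a by rewrite gt0_ltr_powR// nnegrE ?powR_ge0.
rewrite /y -powRrM mulVf ?gt_eqF// powRr1 ?ltW//.
by have := ler_norm K; lra.
Qed.

Lemma no_powR_bound (a K : R) (N0 : nat) : 0 < a ->
  ~ (forall N : nat, (N0 <= N)%N -> N%:R `^ a <= K).
Proof.
by move=> a0 h; have [N N0N] := powR_unbounded K N0 a0; rewrite ltNge h.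
Qed.

End Comparison.

Section Frequencies.
Context {R : realType} {d : nat} (gamma : 'I_d -> {posnum R})
  (c0 : R) (alpha beta : 'I_d -> R) (j1 j2 : 'I_d).
Local Notation lattice := {ffun 'I_d -> int}.
Local Notation om := (om gamma alpha).
Local Notation Om := (Om gamma c0 alpha).
Local Notation rz := (rz gamma c0 alpha beta).
Local Notation br := (bracket gamma).
Context (c0_gt0 : 0 < c0) (alpha_gt0 : forall j, 0 < alpha j) (j12 : j1 != j2)
  (beta1 : beta j1 != 0).

Definition two_mode (x y : int) : lattice :=
  [ffun j => if j == j1 then x else if j == j2 then y else 0].

Lemma two_modeD x y x' y' : two_mode x y + two_mode x' y' = two_mode (x + x') (y + y').
Proof. by apply/ffunP => j; rewrite !ffunE; case: ifP => _ //; case: ifP. Qed.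

Lemma sum_two_mode (F : 'I_d -> R -> R) x y : (forall j, F j 0 = 0) ->
  \sum_(j < d) F j (freq gamma (two_mode x y) j) =
  F j1 (x%:~R / (gamma j1)%:num) + F j2 (y%:~R / (gamma j2)%:num).
Proof.
move=> F0; rewrite (bigD1 j1)//= (bigD1 j2) ?[j2 == j1]eq_sym//= big1 => [|j /andP[h1 h2]].
  by rewrite addr0 /freq !ffunE eqxx [j2 == j1]eq_sym (negbTE j12) eqxx.
by rewrite /freq ffunE (negbTE h1) (negbTE h2) mul0r.
Qed.

Definition freq_weight (a : 'I_d -> R) (j : 'I_d) : R := a j / (gamma j)%:num ^+ 2.

Lemma quad_two_mode a x y : quad gamma a (two_mode x y) = freq_weight a j1 * x%:~R ^+ 2 + freq_weight a j2 * y%:~R ^+ 2.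
Proof.
rewrite /quad (sum_two_mode (F := fun j z => a j * z ^+ 2)); last by move=> j; rewrite expr0n/= mulr0.
by rewrite /freq_weight !expr_div_n; field; rewrite !gt_eqF.
Qed.

Lemma fsize_two_mode x y : fsize gamma (two_mode x y) =
  `|x%:~R| / (gamma j1)%:num + `|y%:~R| / (gamma j2)%:num.
Proof.
rewrite /fsize (sum_two_mode (F := fun j z => `|z|)); last by move=> j; rewrite normr0.
by rewrite !normrM !normfV !(gtr0_norm (gt0 _)).
Qed.

Lemma bracket_le_fsize m : br m <= 1 + fsize gamma m.
Proof.
rewrite -ler_sqr ?nnegrE ?sqrtr_ge0 ?addr_ge0 ?fsize_ge0// sqr_sqrtr; last first.
  by rewrite addr_ge0// sumr_ge0// => j _; exact: sqr_ge0.
have key : \sum_(j < d) freq gamma m j ^+ 2 <= fsize gamma m ^+ 2.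
  rewrite expr2 {1}/fsize mulr_suml; apply: ler_sum => j _.
  by rewrite -real_normK ?num_real// expr2 ler_wpM2l// freq_le.
have -> : (1 + fsize gamma m) ^+ 2 = 1 + 2 * fsize gamma m + fsize gamma m ^+ 2 by ring.
have := fsize_ge0 gamma m; lra.
Qed.

Lemma freq_le_bracket m j : `|freq gamma m j| <= br m.
Proof.
rewrite -sqrtr_sqr; apply: ler_wsqrtr; rewrite (bigD1 j)//= addrCA lerDl.
by rewrite addr_ge0// sumr_ge0// => i _; exact: sqr_ge0.
Qed.

(** The component 2 N makes p and p + k opposite in direction j1, so their squares cancel in om(p +
    k) - om(p). The component 1 leaves a difference linear in P, tunable to Om(k). Direction j1 is
    one where beta does not vanish, so that [rz] grows like N. *)
Definition kf (N : nat) : lattice := two_mode (2 * N%:Z) 1.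

(* with this choice, om (p + k) - om p = freq_weight alpha j2 * (2 P + 1) is
   within freq_weight alpha j2 of Om k *)
Definition Pf (N : nat) : nat := Num.truncn (Om (kf N) / (2 * freq_weight alpha j2)).
Definition pf (N : nat) : lattice := two_mode (- N%:Z) (Pf N)%:Z.

Lemma pkf N : pf N + kf N = two_mode N%:Z (Pf N + 1)%:Z.
Proof.
by rewrite two_modeD PoszD; congr two_mode; ring.
Qed.

Lemma freq_weight_gt0 j : 0 < freq_weight alpha j.
Proof. by rewrite divr_gt0// exprn_gt0. Qed.

Lemma kf_neq0 N : kf N != 0.
Proof.
apply/eqP => h; have := congr1 (fun f : lattice => f j2) h.
by rewrite /= !ffunE [j2 == j1]eq_sym (negbTE j12) eqxx.
Qed.

Lemma om_kf N : om (kf N) = 4 * freq_weight alpha j1 * N%:R ^+ 2 + freq_weight alpha j2.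
Proof. by rewrite /om quad_two_mode expr1n mulr1 intrM -pmulrn; ring. Qed.

Definition Omc : R := c0 * (2 * Num.sqrt (freq_weight alpha j1) + Num.sqrt (freq_weight alpha j2)).

Lemma Om_kf_ge N : 2 * c0 * Num.sqrt (freq_weight alpha j1) * N%:R <= Om (kf N).
Proof.
have w1 := freq_weight_gt0 j1; have w2 := freq_weight_gt0 j2.
rewrite -ler_sqr ?nnegrE ?Om_ge0//; last by rewrite !mulr_ge0 ?sqrtr_ge0 ?(ltW c0_gt0).
rewrite Om_sqr// om_kf !exprMn sqr_sqrtr ?(ltW w1)// -subr_ge0.
have -> : c0 ^+ 2 * (4 * freq_weight alpha j1 * N%:R ^+ 2 + freq_weight alpha j2) -
  2 ^+ 2 * c0 ^+ 2 * freq_weight alpha j1 * N%:R ^+ 2 = c0 ^+ 2 * freq_weight alpha j2 by ring.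
by rewrite mulr_ge0 ?sqr_ge0// ltW.
Qed.

Lemma Om_kf_le N : (0 < N)%N -> Om (kf N) <= Omc * N%:R.
Proof.
move=> N0; have w1 := freq_weight_gt0 j1; have w2 := freq_weight_gt0 j2.
have N1 : 1 <= N%:R :> R by rewrite ler1n.
have s1 := sqrtr_ge0 (freq_weight alpha j1); have s2 := sqrtr_ge0 (freq_weight alpha j2).
rewrite -ler_sqr ?nnegrE ?Om_ge0//; last first.
  by rewrite !mulr_ge0 ?addr_ge0 ?mulr_ge0 ?(ltW c0_gt0).
rewrite Om_sqr// om_kf /Omc !exprMn -[leRHS]mulrA ler_wpM2l ?sqr_ge0//.
rewrite sqrrD exprMn !sqr_sqrtr ?(ltW w1) ?(ltW w2)//.
set a := Num.sqrt _ in s1 *; set b := Num.sqrt _ in s2 *; set x : R := N%:R in N1 *.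
have h1 : 0 <= 2 * a * b * x ^+ 2 by rewrite !mulr_ge0 ?sqr_ge0// (le_trans ler01).
have h2 : freq_weight alpha j2 <= freq_weight alpha j2 * x ^+ 2 by rewrite ler_peMr ?(ltW w2)// expr_ge1// (le_trans ler01).
by rewrite mulr2n; lra.
Qed.

Lemma om_pf_diff N : om (pf N + kf N) - om (pf N) = freq_weight alpha j2 * (2 * (Pf N)%:R + 1).
Proof.
rewrite pkf /om !quad_two_mode intrN sqrrN -!pmulrn natrD; ring.
Qed.

Lemma Pf_bounds N : 2 * freq_weight alpha j2 * (Pf N)%:R <= Om (kf N) /\
  Om (kf N) <= 2 * freq_weight alpha j2 * (Pf N)%:R + 2 * freq_weight alpha j2.
Proof.
have w2 := freq_weight_gt0 j2.
have y0 : 0 <= Om (kf N) / (2 * freq_weight alpha j2) by rewrite divr_ge0 ?Om_ge0// mulr_ge0// ltW.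
have /andP[h1 h2] := truncn_itv y0.
move: h1 h2; rewrite -/(Pf N) ler_pdivlMr ?mulr_gt0// ltr_pdivrMr ?mulr_gt0//.
rewrite -natr1 => h1 h2; split; lra.
Qed.

Lemma resonance N : `|Om (kf N) - (om (pf N + kf N) - om (pf N))| <= freq_weight alpha j2.
Proof.
have w2 := freq_weight_gt0 j2; have [h1 h2] := Pf_bounds N.
by rewrite om_pf_diff ler_norml; apply/andP; split; lra.
Qed.

Lemma frequency_sizes : exists2 c : R, 0 < c & forall N, (0 < N)%N ->
  [/\ comparable_with c (br (kf N)) N%:R, comparable_with c (br (pf N)) N%:R,
      comparable_with c (br (pf N + kf N)) N%:R,
      fsize gamma (pf N) <= c * N%:R & fsize gamma (pf N + kf N) <= c * N%:R].
Proof.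
pose g1 := (gamma j1)%:num; pose g2 := (gamma j2)%:num.
have g10 : 0 < g1 by rewrite /g1.
have g20 : 0 < g2 by rewrite /g2.
have w2 := freq_weight_gt0 j2.
have Oc : 0 <= Omc by rewrite mulr_ge0 ?addr_ge0 ?mulr_ge0 ?sqrtr_ge0 ?(ltW c0_gt0).
(* The term g1 serves the lower bounds, taken from the component j1; the 1 is that of the bracket;
   the rest bounds [fsize], with P at most a multiple of N. *)
pose c := g1 + 1 + 2 / g1 + (Omc / (2 * freq_weight alpha j2) + 1) / g2.
have t1 : 0 < 2 / g1 by rewrite divr_gt0.
have t2 : 0 <= Omc / (2 * freq_weight alpha j2) by rewrite divr_ge0// mulr_ge0// ltW.
have t3 : 0 <= (Omc / (2 * freq_weight alpha j2) + 1) / g2 by rewrite divr_ge0// ?addr_ge0// ltW.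
exists c; first by rewrite /c; lra.
move=> N N0; have N1 : 1 <= N%:R :> R by rewrite ler1n.
set x : R := N%:R in N1 *.
have x0 : 0 <= x by lra.
have Px : (Pf N)%:R <= Omc / (2 * freq_weight alpha j2) * x.
  have [h _] := Pf_bounds N.
  rewrite mulrAC ler_pdivlMr ?mulr_gt0// mulrC.
  exact: le_trans h (Om_kf_le N0).
have small (a : int) (b : int) : `|a%:~R| <= 2 * x -> `|b%:~R| <= (Omc / (2 * freq_weight alpha j2) + 1) * x ->
    fsize gamma (two_mode a b) <= (2 / g1 + (Omc / (2 * freq_weight alpha j2) + 1) / g2) * x.
  move=> ha hb; rewrite fsize_two_mode -/g1 -/g2 mulrDl; apply: lerD.
    by rewrite mulrAC ler_pM2r ?invr_gt0.
  by rewrite mulrAC ler_pM2r ?invr_gt0.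
have big (a b : int) : x <= `|a%:~R| -> x <= c * br (two_mode a b).
  move=> ha; apply: (@le_trans _ _ (g1 * br (two_mode a b))); last first.
    by rewrite ler_wpM2r ?sqrtr_ge0// /c; lra.
  have := freq_le_bracket (two_mode a b) j1.
  rewrite /freq ffunE eqxx normrM normfV [`|(gamma j1)%:num|]gtr0_norm// ler_pdivrMr// mulrC.
  exact: le_trans ha.
have sk : fsize gamma (kf N) <= (2 / g1 + (Omc / (2 * freq_weight alpha j2) + 1) / g2) * x.
  apply: small; first by rewrite intrM -pmulrn ger0_norm// mulr_ge0.
  rewrite normr1 mulrDl mul1r ler_wpDl// mulr_ge0//.
have sp : fsize gamma (pf N) <= (2 / g1 + (Omc / (2 * freq_weight alpha j2) + 1) / g2) * x.
  apply: small; first by rewrite intrN -pmulrn normrN ger0_norm// -/x; lra.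
  by rewrite -pmulrn ger0_norm// mulrDl mul1r ler_wpDr.
have spk : fsize gamma (pf N + kf N) <= (2 / g1 + (Omc / (2 * freq_weight alpha j2) + 1) / g2) * x.
  rewrite pkf; apply: small; first by rewrite -pmulrn ger0_norm// -/x; lra.
  by rewrite -pmulrn ger0_norm// natrD mulrDl mul1r lerD.
have fin m : fsize gamma m <= (2 / g1 + (Omc / (2 * freq_weight alpha j2) + 1) / g2) * x -> br m <= c * x.
  move=> h; apply: (le_trans (bracket_le_fsize m)).
  have h2 : 0 <= g1 * x by rewrite mulr_ge0// ltW.
  rewrite /c; lra.
have fin2 m : fsize gamma m <= (2 / g1 + (Omc / (2 * freq_weight alpha j2) + 1) / g2) * x -> fsize gamma m <= c * x.
  move=> h; have h2 : 0 <= g1 * x by rewrite mulr_ge0// ltW.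
  rewrite /c; lra.
split; [split; [exact: fin|apply: big]|split; [exact: fin|apply: big]|split; [exact: fin|rewrite pkf; apply: big]|exact: fin2|exact: fin2].
- by rewrite intrM -pmulrn ger0_norm ?mulr_ge0// -/x; lra.
- by rewrite intrN -pmulrn normrN ger0_norm.
- by rewrite -pmulrn ger0_norm.
Qed.

(** The coefficients of beta may have opposite signs; N must be large for the j1 part, of size N^2,
    to dominate the fixed j2 part. *)
Lemma rz_kf : exists2 c : R, 0 < c & exists N0 : nat, forall N, (N0 < N)%N -> c * N%:R <= `|rz (kf N)|.
Proof.
pose b1 := `|freq_weight beta j1|; pose b2 := `|freq_weight beta j2|.
have b10 : 0 < b1 by rewrite normr_gt0 mulf_neq0// invr_eq0 expf_eq0/= gt_eqF.
have b20 : 0 <= b2 by exact: normr_ge0.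
have w1 := freq_weight_gt0 j1; have w2 := freq_weight_gt0 j2.
have Oc : 0 < Omc.
  by rewrite mulr_gt0// addr_gt0// ?mulr_gt0// sqrtr_gt0.
exists (c0 ^+ 2 * b1 / Omc); first by rewrite divr_gt0// mulr_gt0// exprn_gt0.
exists (Num.bound (b2 / b1)) => N NN.
have N0 : (0 < N)%N by apply: leq_ltn_trans NN.
have N1 : 1 <= N%:R :> R by rewrite ler1n.
have bN : b2 <= b1 * N%:R.
  rewrite mulrC -ler_pdivrMr//; apply: (@le_trans _ _ (Num.bound (b2 / b1))%:R).
    by apply: ltW; apply: archi_boundP; rewrite divr_ge0// ltW.
  by rewrite ler_nat ltnW.
have O0 : 0 < Om (kf N).
  apply: lt_le_trans (Om_kf_ge N); rewrite !mulr_gt0 ?sqrtr_gt0//; lra.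
have q : b1 * N%:R ^+ 2 <= `|quad gamma beta (kf N)|.
  rewrite quad_two_mode expr1n mulr1 intrM -pmulrn.
  have h := lerB_normD (freq_weight beta j1 * (2 * N%:R) ^+ 2) (freq_weight beta j2).
  apply: le_trans h; rewrite normrM -/b1 -/b2 [`|(2 * _) ^+ 2|]ger0_norm ?sqr_ge0//.
  have : b1 * N%:R <= b1 * N%:R ^+ 2 by rewrite ler_pM2l// expr2 ler_peMl//; lra.
  rewrite exprMn; lra.
rewrite /rz normrM normrM normfV (gtr0_norm O0) (ger0_norm (sqr_ge0 _)).
rewrite ler_pdivlMr//.
apply: (@le_trans _ _ (c0 ^+ 2 * b1 / Omc * N%:R * (Omc * N%:R))).
  apply: ler_wpM2l; last exact: Om_kf_le.
  apply: mulr_ge0 => //; apply: divr_ge0; last exact: ltW.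
  by apply: mulr_ge0; [exact: sqr_ge0|exact: ltW].
have -> : c0 ^+ 2 * b1 / Omc * N%:R * (Omc * N%:R) = c0 ^+ 2 * (b1 * N%:R ^+ 2).
  by field; rewrite gt_eqF.
by rewrite ler_wpM2l// sqr_ge0.
Qed.

End Frequencies.

(** * Failure of C^2 regularity *)

Lemma no_powR_le {R : realType} (a b K : R) (N0 : nat) : b < a ->
  ~ (forall N : nat, (N0 < N)%N -> N%:R `^ a <= K * N%:R `^ b).
Proof.
move=> ba h; apply: (@no_powR_bound R (a - b) K N0.+1); first by rewrite subr_gt0.
move=> N NN; have N1 : 0 < N%:R :> R by rewrite ltr0n (leq_trans _ NN).
have := h N NN; rewrite powRB ?gt_eqF ?implybT// ler_pdivrMr// powR_gt0//.
Qed.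

Section NotC2.
Context {R : realType} {d : nat} (gamma : 'I_d -> {posnum R}) (lambda : R[i])
  (c0 : R) (alpha beta : 'I_d -> R) (T s l : R) (j1 j2 : 'I_d).
Local Notation C := R[i].
Local Notation lattice := {ffun 'I_d -> int}.
Local Notation om := (om gamma alpha).
Local Notation Om := (Om gamma c0 alpha).
Local Notation rz := (rz gamma c0 alpha beta).
Local Notation br := (bracket gamma).
Local Notation kf := (@kf d j1 j2).
Local Notation pf := (@pf R d gamma c0 alpha j1 j2).
Context (c0_gt0 : 0 < c0) (alpha_gt0 : forall j, 0 < alpha j) (T_gt0 : 0 < T)
  (j12 : j1 != j2) (beta1 : beta j1 != 0).

Lemma frequency_powers (r : R) : exists2 K : R, 0 < K & forall N, (0 < N)%N ->
  [/\ N%:R `^ r <= K * br (kf N) `^ r, br (kf N) `^ r <= K * N%:R `^ r,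
      br (pf N) `^ r <= K * N%:R `^ r, N%:R `^ r <= K * br (pf N + kf N) `^ r &
      br (pf N + kf N) `^ r <= K * N%:R `^ r].
Proof.
have [c c_gt0 hc] := frequency_sizes gamma c0_gt0 alpha_gt0 j12.
have [K K0 hK] := powR_comparable r c_gt0.
exists K => // N N0; have [hk hp hpk _ _] := hc N N0.
have X0 : 0 < N%:R :> R by rewrite ltr0n.
have b0 m : 0 < br m by exact: bracket_gt0.
have sym (x y : R) : comparable_with c x y -> comparable_with c y x by case.
by split; apply: hK => //; exact: sym.
Qed.

(* at this time the phase of the resonant interactions is still at most 1 / 2 *)
Definition tres : R := Num.min T (2 * freq_weight gamma alpha j2)^-1.

Lemma tres_gt0 : 0 < tres.
Proof. by rewrite lt_min T_gt0 invr_gt0 mulr_gt0// freq_weight_gt0. Qed.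

Lemma tres_in : tres \in `[- T, T].
Proof.
have h := tres_gt0; have h2 : tres <= T by rewrite ge_min lexx.
by rewrite in_itv/= h2 andbT; lra.
Qed.

Lemma resonance_tres N : `|Om (kf N) - (om (pf N + kf N) - om (pf N))| * tres <= 2^-1.
Proof.
have w2 := freq_weight_gt0 gamma alpha_gt0 j2; have h := resonance gamma c0_gt0 alpha_gt0 j12 N.
have t2 : tres <= (2 * freq_weight gamma alpha j2)^-1 by rewrite ge_min lexx orbT.
apply: (@le_trans _ _ (freq_weight gamma alpha j2 * (2 * freq_weight gamma alpha j2)^-1)).
  by apply: ler_pM => //; exact: ltW tres_gt0.
by rewrite le_eqVlt; apply/orP; left; apply/eqP; field; rewrite gt_eqF.
Qed.

(** The bounded half of [nmain] decays like 1 / N, so for large N it takes away at most half of the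
    main part tres / 2. *)
Lemma nmain_resonant_ge : exists N0 : nat, forall N, (N0 < N)%N ->
  tres / 4 <= normc (nmain gamma c0 alpha (pf N) (kf N) tres).
Proof.
have t0 := tres_gt0; have w1 := freq_weight_gt0 gamma alpha_gt0 j1; have w2 := freq_weight_gt0 gamma alpha_gt0 j2.
pose c1 := 2 * c0 * Num.sqrt (freq_weight gamma alpha j1).
have c10 : 0 < c1 by rewrite !mulr_gt0// sqrtr_gt0.
exists (Num.bound (8 / (c1 * tres))) => N NN.
have q0 : 0 < 8 / (c1 * tres) by rewrite divr_gt0// mulr_gt0.
have XN : 8 / (c1 * tres) <= N%:R.
  apply: (@le_trans _ _ (Num.bound (8 / (c1 * tres)))%:R).
    by apply: ltW; apply: archi_boundP; exact: ltW.
  by rewrite ler_nat ltnW.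
have O1 := Om_kf_ge gamma c0_gt0 alpha_gt0 j12 N.
have Dl : 0 < om (pf N + kf N) - om (pf N) by rewrite om_pf_diff// mulr_gt0// ltr_wpDl.
have big : 8 / tres <= Om (kf N) + (om (pf N + kf N) - om (pf N)).
  apply: (@le_trans _ _ (c1 * N%:R)); last by apply: (le_trans O1); rewrite lerDl ltW.
  have ct : 0 < c1 * tres by exact: mulr_gt0.
  have XN' : 8 <= N%:R * (c1 * tres) by rewrite -ler_pdivrMr.
  rewrite ler_pdivrMr//; lra.
have S0 : 0 < Om (kf N) + (om (pf N + kf N) - om (pf N)).
  by apply: lt_le_trans big; rewrite divr_gt0.
apply: le_trans (nmain_resonant (ltW t0) S0 (resonance_tres N)).
have : 2 / (Om (kf N) + (om (pf N + kf N) - om (pf N))) <= tres / 4.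
  rewrite ler_pdivrMr// -ler_pdivrMl ?divr_gt0//.
  by rewrite (_ : (tres / 4)^-1 * 2 = 8 / tres)//; field; rewrite gt_eqF.
lra.
Qed.

(** Resonant Schroedinger output at a time independent of N: N^s is bounded by N^s N^l. *)
Lemma not_C2_l_neg : lambda != 0 -> l < 0 -> ~ flow_extends_C2 gamma lambda c0 alpha beta T s l.
Proof.
move=> la0 l0 /(C2_estimate_u c0_gt0 alpha_gt0 T_gt0 la0)[M M0 hM].
have [Ks Ks0 hs] := frequency_powers s; have [Kl Kl0 hl] := frequency_powers l.
have t0 := tres_gt0.
apply: (@no_powR_le R 0 l (Ks * M * Ks * Kl * (2 / tres)) 0 l0) => N N0.
have X0 : 0 < N%:R :> R by rewrite ltr0n.
have [_ _ hp hpk _] := hs N N0; have [_ hk _ _ _] := hl N N0.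
have h := hM (pf N) (kf N) tres (kf_neq0 j12 N) tres_in.
have osc : tres / 2 <= normc (oscint (om (pf N + kf N) - (om (pf N) + Om (kf N))) tres).
  apply: oscint_ge; first exact: ltW.
  have -> : `|om (pf N + kf N) - (om (pf N) + Om (kf N))| = `|Om (kf N) - (om (pf N + kf N) - om (pf N))|.
    by rewrite -normrN; congr `|_|; ring.
  exact: resonance_tres.
rewrite powRr0.
have Xs : 0 < N%:R `^ s :> R by rewrite powR_gt0.
rewrite -(ler_pM2l Xs) mulr1 mulrA.
rewrite -(@ler_pM2r _ (tres / 2)) ?divr_gt0//.
apply: (@le_trans _ _ (Ks * (br (pf N + kf N) `^ s * normc (oscint (om (pf N + kf N) - (om (pf N) + Om (kf N))) tres)))).
  by rewrite [leRHS]mulrA; apply: ler_pM => //; apply: divr_ge0 => //; exact: ltW.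
apply: (@le_trans _ _ (Ks * (M * ((Ks * N%:R `^ s) * (Kl * N%:R `^ l))))).
  rewrite ler_pM2l//; apply: (le_trans h); rewrite ler_wpM2l//.
  by apply: ler_pM => //; exact: powR_ge0.
by rewrite le_eqVlt; apply/orP; left; apply/eqP; field; rewrite gt_eqF.
Qed.

(** Resonant wave output: the multiplier adds one power, and N^(l + 1) is bounded by N^(2 s). *)
Lemma not_C2_l_large : 2 * s - 1 < l -> ~ flow_extends_C2 gamma lambda c0 alpha beta T s l.
Proof.
move=> sl /(C2_estimate_n c0_gt0 alpha_gt0 T_gt0)[M M0 hM].
have [Ks Ks0 hs] := frequency_powers s; have [Kl Kl0 hl] := frequency_powers l.
have [c c_gt0 [N1 hc]] := rz_kf gamma c0_gt0 alpha_gt0 j12 beta1.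
have [N2 hN2] := nmain_resonant_ge.
have t0 := tres_gt0.
have sl' : s + s < l + 1 by lra.
apply: (@no_powR_le R (l + 1) (s + s) (Kl * M * Ks * Ks / c * (4 / tres)) (maxn N1 N2) sl') => N.
rewrite gtn_max => /andP[NN1 NN2].
have N0 : (0 < N)%N by apply: leq_ltn_trans NN1.
have X0 : 0 < N%:R :> R by rewrite ltr0n.
have Xn : (N%:R : R) != 0 by rewrite gt_eqF.
have [_ _ hp _ hpk] := hs N N0; have [hk _ _ _ _] := hl N N0.
have h := hM (pf N) (kf N) tres (kf_neq0 j12 N) tres_in.
have h1 := hc N NN1; have h2 := hN2 N NN2.
rewrite !powRD ?Xn ?implybT// powRr1 ?(ltW X0)//.
have cN0 : 0 <= c * N%:R by apply: mulr_ge0 => //; exact: ltW.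
have tr4 : 0 < tres / 4 by rewrite divr_gt0.
have ct : 0 < c * (tres / 4) by rewrite mulr_gt0// divr_gt0.
rewrite -(ler_pM2r ct).
apply: (@le_trans _ _ (Kl * (br (kf N) `^ l * `|rz (kf N)| * normc (nmain gamma c0 alpha (pf N) (kf N) tres)))).
  rewrite (_ : N%:R `^ l * N%:R * _ = N%:R `^ l * (c * N%:R) * (tres / 4)); last by ring.
  have m1 : N%:R `^ l * (c * N%:R) <= Kl * (br (kf N) `^ l * `|rz (kf N)|).
    by rewrite [leRHS]mulrA; apply: ler_pM => //; exact: powR_ge0.
  have m0 : 0 <= N%:R `^ l * (c * N%:R) by apply: mulr_ge0 => //; exact: powR_ge0.
  rewrite [leRHS]mulrA; apply: ler_pM => //; exact: ltW.
apply: (@le_trans _ _ (Kl * (M * ((Ks * N%:R `^ s) * (Ks * N%:R `^ s))))).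
  rewrite ler_pM2l//; apply: (le_trans h); rewrite ler_wpM2l//.
  by apply: ler_pM => //; exact: powR_ge0.
by rewrite le_eqVlt; apply/orP; left; apply/eqP; field; rewrite !gt_eqF.
Qed.

Let Csum := 4 * freq_weight gamma alpha j1 + freq_weight gamma alpha j2 + Omc gamma c0 alpha j1 j2.

Let Csum_gt0 : 0 < Csum.
Proof.
have w1 := freq_weight_gt0 gamma alpha_gt0 j1; have w2 := freq_weight_gt0 gamma alpha_gt0 j2.
have : 0 <= Omc gamma c0 alpha j1 j2.
  by rewrite mulr_ge0 ?addr_ge0 ?mulr_ge0 ?sqrtr_ge0 ?(ltW c0_gt0).
rewrite /Csum; lra.
Qed.

Lemma om_Om_le N : (0 < N)%N -> om (kf N) + Om (kf N) <= Csum * N%:R ^+ 2.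
Proof.
move=> N0; have h := Om_kf_le gamma c0_gt0 alpha_gt0 j12 N0.
have N1 : 1 <= N%:R :> R by rewrite ler1n.
have w2 := freq_weight_gt0 gamma alpha_gt0 j2.
have Oc : 0 <= Omc gamma c0 alpha j1 j2.
  by rewrite mulr_ge0 ?addr_ge0 ?mulr_ge0 ?sqrtr_ge0 ?(ltW c0_gt0).
rewrite om_kf// /Csum; set x : R := N%:R in N1 h *.
have h1 : freq_weight gamma alpha j2 <= freq_weight gamma alpha j2 * x ^+ 2 by rewrite ler_peMr ?(ltW w2)// expr_ge1//; lra.
have h2 : Omc gamma c0 alpha j1 j2 * x <= Omc gamma c0 alpha j1 j2 * x ^+ 2.
  by rewrite ler_wpM2l// expr2 ler_peMl//; lra.
lra.
Qed.

Lemma om0 : om 0 = 0.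
Proof. by rewrite /om /quad big1// => j _; rewrite /freq ffunE mul0r expr0n/= mulr0. Qed.

Lemma bracket0 r : br 0 `^ r = 1.
Proof.
rewrite /bracket big1 ?addr0 ?sqrtr1 ?powR1// => j _.
by rewrite /freq ffunE mul0r expr0n.
Qed.

(** Schroedinger output with p = 0. The phase has size at most N^2 up to a constant, so up to a time
    of order N^(-2) the integral still grows linearly: N^(s - 2) is bounded by N^l. *)
Lemma not_C2_s_large : lambda != 0 -> l < s - 2 -> ~ flow_extends_C2 gamma lambda c0 alpha beta T s l.
Proof.
move=> la0 ls /(C2_estimate_u c0_gt0 alpha_gt0 T_gt0 la0)[M M0 hM].
have [Ks Ks0 hs] := frequency_powers s; have [Kl Kl0 hl] := frequency_powers l.
have ls' : l + 2 < s by lra.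
(* The summand 1 / T keeps the chosen time within [-T, T] for every N >= 1. *)
pose c := Csum + T^-1.
have Ti : 0 < T^-1 by rewrite invr_gt0.
have C0 : 0 < c by have := Csum_gt0; rewrite /c; lra.
apply: (@no_powR_le R s (l + 2) (Ks * M * Kl * (4 * c)) 0 ls') => N N0.
have X1 : 1 <= N%:R :> R by rewrite ler1n.
have X0 : 0 < N%:R :> R by rewrite ltr0n.
have Xn : (N%:R : R) != 0 by rewrite gt_eqF.
have [hk1 _ _ _ _] := hs N N0; have [_ hk2 _ _ _] := hl N N0.
have X2 : 0 < N%:R ^+ 2 :> R by rewrite exprn_gt0.
pose t : R := (2 * c * N%:R ^+ 2)^-1.
have t0 : 0 < t by rewrite invr_gt0 !mulr_gt0.
have tT : t <= T.
  rewrite -[T]invrK lef_pV2 ?posrE ?mulr_gt0//.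
  apply: (@le_trans _ _ (2 * c)); first by have := Csum_gt0; rewrite /c; lra.
  by rewrite ler_peMr ?mulr_ge0 ?(ltW C0)// expr_ge1// ltW.
have tin : t \in `[- T, T] by rewrite in_itv/= tT andbT; lra.
have := hM 0 (kf N) t (kf_neq0 j12 N) tin.
rewrite add0r om0 add0r bracket0 mul1r => h.
have Phi : `|om (kf N) - Om (kf N)| * t <= 2^-1.
  have h1 : `|om (kf N) - Om (kf N)| <= c * N%:R ^+ 2.
    apply: (le_trans (ler_normB _ _)); rewrite !ger0_norm ?om_ge0 ?Om_ge0//.
    apply: (le_trans (om_Om_le N0)); rewrite ler_pM2r// /c; lra.
  apply: (@le_trans _ _ (c * N%:R ^+ 2 * t)); first by rewrite ler_pM2r.
  by rewrite le_eqVlt; apply/orP; left; apply/eqP; rewrite /t; field; rewrite Xn gt_eqF.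
have osc := oscint_ge (ltW t0) Phi.
rewrite powRD ?Xn ?implybT// (powR_mulrn 2) ?(ltW X0)//.
have t2 : 0 < t / 2 by rewrite divr_gt0.
rewrite -(ler_pM2r t2).
apply: (@le_trans _ _ (Ks * (br (kf N) `^ s * normc (oscint (om (kf N) - Om (kf N)) t)))).
  by rewrite [leRHS]mulrA; apply: ler_pM => //; exact: ltW.
apply: (@le_trans _ _ (Ks * (M * (Kl * N%:R `^ l)))).
  by rewrite ler_pM2l//; apply: (le_trans h); rewrite ler_wpM2l.
by rewrite le_eqVlt; apply/orP; left; apply/eqP; rewrite /t; field; rewrite Xn gt_eqF.
Qed.

(** Wave output with p = 0: the multiplier gives N and the nonresonant time factor N^(-2), so N^(l -
    1) is bounded by N^s. *)
Lemma not_C2_l_gt : s + 1 < l -> ~ flow_extends_C2 gamma lambda c0 alpha beta T s l.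
Proof.
move=> sl /(C2_estimate_n c0_gt0 alpha_gt0 T_gt0)[M M0 hM].
have [Ks Ks0 hs] := frequency_powers s; have [Kl Kl0 hl] := frequency_powers l.
have [c c_gt0 [N1 hc]] := rz_kf gamma c0_gt0 alpha_gt0 j12 beta1.
have sl' : s + 2 < l + 1 by lra.
have w1 := freq_weight_gt0 gamma alpha_gt0 j1; have w2 := freq_weight_gt0 gamma alpha_gt0 j2.
pose c1 := 2 * c0 * Num.sqrt (freq_weight gamma alpha j1).
have c10 : 0 < c1 by rewrite !mulr_gt0// sqrtr_gt0.
have q1 : 0 <= pi / (2 * T * c1) by rewrite divr_ge0 ?pi_ge0// !mulr_ge0// ltW.
have Oc : 0 <= Omc gamma c0 alpha j1 j2.
  by rewrite mulr_ge0 ?addr_ge0 ?mulr_ge0 ?sqrtr_ge0 ?(ltW c0_gt0).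
have q2 : 0 <= Omc gamma c0 alpha j1 j2 / (4 * freq_weight gamma alpha j1) by rewrite divr_ge0// mulr_ge0// ltW.
(* Beyond [N2] the quarter period pi / (2 Om) of the wave fits into [0, T]; beyond [N3] the
   quadratic symbol exceeds [Om]. *)
pose N2 := Num.bound (pi / (2 * T * c1)); pose N3 := Num.bound (Omc gamma c0 alpha j1 j2 / (4 * freq_weight gamma alpha j1)).
apply: (@no_powR_le R (l + 1) (s + 2) (Kl * M * Ks / c * (Csum / 2)) (maxn N1 (maxn N2 N3)) sl') => N.
rewrite !gtn_max => /and3P[NN1 NN2 NN3].
have N0 : (0 < N)%N by apply: leq_ltn_trans NN1.
have X0 : 0 < N%:R :> R by rewrite ltr0n.
have Xn : (N%:R : R) != 0 by rewrite gt_eqF.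
have [_ hk1 _ _ _] := hs N N0; have [hk2 _ _ _ _] := hl N N0.
have X2 : 0 < N%:R ^+ 2 :> R by rewrite exprn_gt0.
have O1 := Om_kf_ge gamma c0_gt0 alpha_gt0 j12 N.
have O2 := Om_kf_le gamma c0_gt0 alpha_gt0 j12 N0.
have O0 : 0 < Om (kf N) by apply: lt_le_trans O1; rewrite mulr_gt0.
have Oo : Om (kf N) < om (kf N).
  apply: (le_lt_trans O2); rewrite om_kf//.
  have : Omc gamma c0 alpha j1 j2 / (4 * freq_weight gamma alpha j1) < N%:R.
    by apply: (lt_trans (archi_boundP q2)); rewrite ltr_nat.
  rewrite ltr_pdivrMr ?mulr_gt0// => h3.
  have : Omc gamma c0 alpha j1 j2 * N%:R < N%:R * (4 * freq_weight gamma alpha j1) * N%:R by rewrite ltr_pM2r.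
  rewrite expr2; lra.
pose t : R := pi / (2 * Om (kf N)).
have t0 : 0 < t by rewrite divr_gt0 ?pi_gt0// mulr_gt0.
have tT : t <= T.
  rewrite ler_pdivrMr; last exact: mulr_gt0.
  have : pi / (2 * T * c1) < N%:R by apply: (lt_trans (archi_boundP q1)); rewrite ltr_nat.
  rewrite ltr_pdivrMr; last by apply: mulr_gt0 => //; apply: mulr_gt0.
  move=> h3; have : 2 * T * (c1 * N%:R) <= 2 * T * Om (kf N) by rewrite ler_pM2l// mulr_gt0.
  lra.
have tin : t \in `[- T, T] by rewrite in_itv/= tT andbT; lra.
have := hM 0 (kf N) t (kf_neq0 j12 N) tin.
rewrite add0r bracket0 mul1r => h.
have nm : 2 / (Csum * N%:R ^+ 2) <= normc (nmain gamma c0 alpha 0 (kf N) t).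
  have h3 : Om (kf N) < om (0 + kf N) - om 0 by rewrite add0r om0 subr0.
  apply: le_trans (nmain_nonresonant O0 h3).
  have d1 : 0 < Csum * N%:R ^+ 2 by apply: mulr_gt0.
  have d2 : 0 < Om (kf N) + om (kf N) by apply: addr_gt0 => //; exact: lt_trans O0 Oo.
  by rewrite add0r om0 subr0 ler_pM2l// lef_pV2 ?posrE// addrC om_Om_le.
have h1 := hc N NN1.
rewrite powRD ?Xn ?implybT// powRr1 ?(ltW X0)// [_ `^ (s + 2)]powRD ?Xn ?implybT// (powR_mulrn 2) ?(ltW X0)//.
pose q := 2 / (Csum * N%:R ^+ 2).
have q0 : 0 < q by rewrite divr_gt0// mulr_gt0 ?Csum_gt0.
have cN0 : 0 <= c * N%:R by apply: mulr_ge0 => //; exact: ltW.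
have ct : 0 < c * q by rewrite mulr_gt0.
rewrite -(ler_pM2r ct).
apply: (@le_trans _ _ (Kl * (br (kf N) `^ l * `|rz (kf N)| * normc (nmain gamma c0 alpha 0 (kf N) t)))).
  rewrite (_ : N%:R `^ l * N%:R * _ = N%:R `^ l * (c * N%:R) * q); last by ring.
  have m1 : N%:R `^ l * (c * N%:R) <= Kl * (br (kf N) `^ l * `|rz (kf N)|).
    by rewrite [leRHS]mulrA; apply: ler_pM => //; exact: powR_ge0.
  have m0 : 0 <= N%:R `^ l * (c * N%:R) by apply: mulr_ge0 => //; exact: powR_ge0.
  rewrite [leRHS]mulrA; apply: ler_pM => //; exact: ltW.
apply: (@le_trans _ _ (Kl * (M * (Ks * N%:R `^ s)))).
  by rewrite ler_pM2l//; apply: (le_trans h); rewrite ler_wpM2l.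
have Cs : Csum != 0 by rewrite gt_eqF// Csum_gt0.
by rewrite le_eqVlt; apply/orP; left; apply/eqP; rewrite /q; field; rewrite Xn Cs gt_eqF.
Qed.

End NotC2.

(** * Ill-posedness *)

Section IllPosed.
Context {R : realType} {d : nat} (gamma : 'I_d -> {posnum R}) (lambda : R[i])
  (c0 : R) (alpha beta : 'I_d -> R) (T s l : R) (j1 j2 : 'I_d).
Local Notation C := R[i].
Local Notation lattice := {ffun 'I_d -> int}.
Local Notation br := (bracket gamma).
Local Notation kf := (@kf d j1 j2).
Local Notation pf := (@pf R d gamma c0 alpha j1 j2).
Local Notation tres := (tres gamma alpha T j2).
Local Notation rz := (rz gamma c0 alpha beta).
Context (c0_gt0 : 0 < c0) (alpha_gt0 : forall j, 0 < alpha j) (T_gt0 : 0 < T)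
  (j12 : j1 != j2) (beta1 : beta j1 != 0).

Definition resonant_data (A : R) N : seq (C * lattice) :=
  [:: (A%:C, pf N); (A%:C, pf N + kf N)].

(* The quadratic interaction dominates: it is of size [dl ^+ 2], where
   [dl ^+ 2 = A ^+ 2 * N], while the remainder is of size [dl ^+ 3]. *)
Lemma resonant_growth : exists eps0 c : R, [/\ 0 < eps0, 0 < c & exists N0 : nat,
  forall N (A dl : R), (N0 < N)%N -> 0 < A -> 0 < dl -> dl <= eps0 -> A ^+ 2 * N%:R = dl ^+ 2 ->
  exists u n, [/\
    zakharov_solution gamma lambda c0 alpha beta T (u_init gamma (resonant_data A N))
      (n_init gamma [::]) (nt_init gamma c0 alpha [::]) u n,
    smooth_data gamma (u_init gamma (resonant_data A N)) (n_init gamma [::])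
      (nt_init gamma c0 alpha [::]) &
    c * dl ^+ 2 <= normc (rfourier gamma (fun x => n (tres, x)) (kf N))]].
Proof.
have [cf cf_gt0 hcf] := frequency_sizes gamma c0_gt0 alpha_gt0 j12.
have [cz cz_gt0 [N1 hcz]] := rz_kf gamma c0_gt0 alpha_gt0 j12 beta1.
have [N2 hN2] := nmain_resonant_ge gamma c0_gt0 alpha_gt0 T_gt0 j12.
have t0 : 0 < tres by apply: tres_gt0.
have tin : tres \in `[- T, T] by apply: tres_in.
have Kz0 := @Kz_ge0 R d c0 alpha beta c0_gt0.
set kz := Kz c0 alpha beta in Kz0.
pose V := vol gamma; have V0 : 0 < V := vol_gt0 gamma.
have la0 := normc_ge0 lambda.
pose Bc := 8 * kz * cf + 1.
have kc : 0 <= 8 * kz * cf by apply: mulr_ge0; [exact: mulr_ge0|exact: ltW].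
have B1 : 1 <= Bc by rewrite /Bc; lra.
have B0 : 0 < Bc by lra.
(* With rho = 1 / (L dl) the first smallness condition reads |lambda| / (|lambda| + 1) <= 1, and the
   second 64 kz cf <= Bc L. The frequency cf N enters only through A^2 N = dl^2, so rho does not
   depend on N separately. *)
pose L := 8 * (normc lambda + 1) * Bc.
have L0 : 0 < L by apply: mulr_gt0 => //; lra.
pose E := 16 * V * Bc * (tres * L) ^+ 2.
have E0 : 0 < E by apply: mulr_gt0; [apply: mulr_gt0 => //; exact: mulr_gt0|apply: exprn_gt0; exact: mulr_gt0].
pose m := V * cz * tres / 8.
have m0 : 0 < m by apply: divr_gt0 => //; apply: mulr_gt0 => //; exact: mulr_gt0.
(* The first bound makes the solution live on [-T, T]; the second keeps the remainder E dl^3 below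
   half of the main term m dl^2. *)
pose eps0 := Num.min (1 / (4 * T * L)) (m / (2 * E)).
have e0 : 0 < eps0.
  rewrite lt_min; apply/andP; split; apply: divr_gt0 => //; last exact: mulr_gt0.
  by apply: mulr_gt0 => //; exact: mulr_gt0.
exists eps0, (m / 2); split => //; first by rewrite divr_gt0.
exists (maxn N1 N2) => N A dl; rewrite gtn_max => /andP[NN1 NN2] A0 dl0 dle Adl.
have N0 : (0 < N)%N by apply: leq_ltn_trans NN1.
have X0 : 0 < N%:R :> R by rewrite ltr0n.
have [_ _ _ sp spk] := hcf N N0.
pose rho := (L * dl)^-1.
have Ldl : 0 < L * dl by exact: mulr_gt0.
have rho0 : 0 < rho by rewrite invr_gt0.
have TLdl : 4 * T * L * dl <= 1.
  have : dl <= 1 / (4 * T * L) by apply: (le_trans dle); rewrite ge_min lexx.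
  rewrite ler_pdivlMr; first by rewrite mulrC.
  by apply: mulr_gt0 => //; exact: mulr_gt0.
have TLdl0 : 0 < T * L * dl by apply: mulr_gt0 => //; exact: mulr_gt0.
have Trho : 2 * T < rho.
  rewrite /rho -[(L * dl)^-1]mul1r ltr_pdivlMr//; lra.
have kap0 : 0 <= cf * N%:R by apply: mulr_ge0; exact: ltW.
have nA : normc (A%:C : C) = A by rewrite normc_real gtr0_norm.
have sU x : x \in resonant_data A N -> fsize gamma x.2 <= cf * N%:R.
  by rewrite !inE => /orP[]/eqP -> .
have sZ (x : C * lattice) : x \in [::] -> fsize gamma x.2 <= cf * N%:R by [].
have mU : \sum_(x <- resonant_data A N) normc x.1 <= 2 * A.
  by rewrite !big_cons big_nil /= nA; lra.
have mZ : \sum_(x <- ([::] : seq (C * lattice))) normc x.1 <= Bc * dl.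
  by rewrite big_nil mulr_ge0// ltW.
have A2 : 0 <= 2 * A by lra.
have Bdl : 0 <= Bc * dl by rewrite mulr_ge0// ltW.
have s1 : 8 * normc lambda * rho * (Bc * dl) <= 1.
  have l1 : normc lambda + 1 != 0 by rewrite gt_eqF//; lra.
  have -> : 8 * normc lambda * rho * (Bc * dl) = normc lambda / (normc lambda + 1).
    by rewrite /rho /L; field; rewrite l1 !gt_eqF.
  by rewrite ler_pdivrMr; lra.
have s2 : 16 * kz * (cf * N%:R) * rho * (2 * A) ^+ 2 <= Bc * dl.
  have -> : 16 * kz * (cf * N%:R) * rho * (2 * A) ^+ 2 = 64 * kz * cf * (A ^+ 2 * N%:R) / (L * dl).
    by rewrite /rho; ring.
  rewrite Adl ler_pdivrMr//.
  have h : 64 * kz * cf <= Bc * L.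
    apply: (@le_trans _ _ (8 * Bc)); first by rewrite /Bc; lra.
    have -> : Bc * L = 8 * Bc * ((normc lambda + 1) * Bc) by rewrite /L; ring.
    rewrite ler_peMr//; first by lra.
    by apply: mulr_ege1 => //; lra.
  have -> : Bc * dl * (L * dl) = Bc * L * dl ^+ 2 by ring.
  by rewrite ler_wpM2r// sqr_ge0.
have [u [n [sol sm _ hn]]] := @small_data_solution R d gamma lambda c0 alpha beta _ _
  (cf * N%:R) (2 * A) (Bc * dl) rho T c0_gt0 alpha_gt0 kap0 A2 Bdl T_gt0 Trho sU sZ mU mZ s1 s2.
exists u, n; split => //.
have := hn tres (kf N) tin; rewrite Zl_main ?kf_neq0//.
rewrite (ger0_norm (ltW t0)); set main := _ * nmain _ _ _ _ _ _; set X := rfourier _ _ _ => err.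
have hm : m * dl ^+ 2 <= normc main.
  rewrite /main !normcM normcN normc_i normc_conj !normc_real (gtr0_norm V0) (gtr0_norm A0) ger0_norm//.
  rewrite -Adl mul1r.
  have h1 := hcz N NN1; have h2 := hN2 N NN2.
  have -> : m * (A ^+ 2 * N%:R) = (2^-1 * V * A ^+ 2) * ((cz * N%:R) * (tres / 4)).
    by rewrite /m; field.
  rewrite [leRHS](_ : _ = (2^-1 * V * A ^+ 2) * (`|rz (kf N)| * normc (nmain gamma c0 alpha (pf N) (kf N) tres))); last by ring.
  apply: ler_wpM2l; first by apply: mulr_ge0; [apply: mulr_ge0 => //; exact: ltW|exact: sqr_ge0].
  apply: ler_pM => //; first by apply: mulr_ge0; exact: ltW.
  by apply: divr_ge0 => //; exact: ltW.
have he : 16 * V * (Bc * dl) * (tres / rho) ^+ 2 <= m / 2 * dl ^+ 2.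
  rewrite /rho invrK.
  have -> : 16 * V * (Bc * dl) * (tres * (L * dl)) ^+ 2 = E * dl * dl ^+ 2 by rewrite /E; ring.
  rewrite ler_pM2r ?exprn_gt0//.
  have : dl <= m / (2 * E) by apply: (le_trans dle); rewrite ge_min lexx orbT.
  rewrite ler_pdivlMr; last exact: mulr_gt0.
  lra.
have tri : normc main - normc X <= normc (X - main).
  by rewrite -[normc (X - main)]normcN opprB; exact: normc_subr_ge.
have : normc (X - main) <= m / 2 * dl ^+ 2 by exact: le_trans err he.
lra.
Qed.

Lemma not_continuous : 0 <= l -> 2 * s - 1 < l ->
  ~ flow_extends_continuous gamma lambda c0 alpha beta T s l.
Proof.
move=> l0 sl [U [F [oU ext cF]]].
have [eps0 [c [e0 c_gt0 [N0 grow]]]] := resonant_growth.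
have [_ U0] := oU.
have [Ks Ks0 hs] := frequency_powers gamma c0_gt0 alpha_gt0 j12 s.
have [Kl Kl0 hl] := frequency_powers gamma c0_gt0 alpha_gt0 j12 l.
pose V := vol gamma; have V0 : 0 < V := vol_gt0 gamma.
have Cg0 := Cg_ge0 gamma; have Cg0' := Cg'_ge0 gamma.
have tin : tres \in `[- T, T] by apply: tres_in.
(* Chosen so that a jump of the flow below [eta] would force c eps0^2 to be at most Cg' / (Cg' + 1)
   times itself. *)
pose eta := c * eps0 ^+ 2 / (Kl * (Cg' gamma + 1)).
have C1 : 0 < Cg' gamma + 1 by lra.
have ce : 0 < c * eps0 ^+ 2 by rewrite mulr_gt0// exprn_gt0.
have eta0 : 0 < eta by rewrite divr_gt0// mulr_gt0.
have nU : \forall y \near (0 : data_space gamma s l), U y by exact: open_nbhs_nbhs.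
have nF : \forall y \near (0 : data_space gamma s l), `|F 0 - F y| < eta.
  by have /cvgrPdist_lt := cF 0 U0; exact.
have nn : \forall y \near (0 : data_space gamma s l), U y /\ `|F 0 - F y| < eta.
  exact: filterI nU nF.
have [dl dl0 hdl] : exists2 dl : R, 0 < dl & forall y : data_space gamma s l,
    ball (0 : data_space gamma s l) dl y -> U y /\ `|F 0 - F y| < eta.
  by move/nbhs_ballP: nn => [dl dl0 hdl]; exists dl.
(* The data have norm O(N^(-a)) in H^s, and a > 0 is the hypothesis l > 2 s - 1. *)
pose a := (l + 1) / 2 - s.
have a0 : 0 < a by rewrite /a; lra.
pose K := Cg gamma * V * (Ks + Ks) * eps0.
have K0 : 0 <= K.
  apply: mulr_ge0; last exact: ltW.
  by apply: mulr_ge0; [apply: mulr_ge0 => //; exact: ltW|lra].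
have [N NN hN] := powR_unbounded (K / dl) N0.+1 a0.
have N1 : (0 < N)%N by apply: leq_trans NN.
have X1 : 1 <= N%:R :> R by rewrite ler1n.
have X0 : 0 < N%:R :> R by rewrite ltr0n.
have Xn : (N%:R : R) != 0 by rewrite gt_eqF.
pose A : R := eps0 * N%:R `^ (- ((l + 1) / 2)).
(* Then A^2 N = delta^2, and N^l delta^2 = eps0^2: the weighted mode k does not decay with N. *)
pose delta : R := eps0 * N%:R `^ (- (l / 2)).
have A0 : 0 < A by rewrite mulr_gt0// powR_gt0.
have de0 : 0 < delta by rewrite mulr_gt0// powR_gt0.
have del : delta <= eps0.
  (* Here l >= 0 enters: it keeps [delta] in the range where the quadratic term dominates. *)
  have h : N%:R `^ (- (l / 2)) <= N%:R `^ 0 :> R by rewrite ler_powR//; lra.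
  by move: h; rewrite powRr0 -(ler_pM2l e0) mulr1.
have Adl : A ^+ 2 * N%:R = delta ^+ 2.
  rewrite !exprMn !powR_sqr -mulrA; congr (_ * _).
  have -> : 2 * - (l / 2) = 2 * - ((l + 1) / 2) + 1 by field.
  by rewrite powRD ?Xn ?implybT// powRr1 ?(ltW X0).
have [u [n [sol sm hn]]] := grow N A delta NN A0 de0 del Adl.
pose z : data_space gamma s l := (pairH gamma s (V%:C * A%:C) (V%:C * A%:C) (pf N) (pf N + kf N), 0, 0).
have cz : [/\ coef z.1.1 = fourier gamma (u_init gamma (resonant_data A N)),
    coef z.1.2 = rfourier gamma (n_init gamma [::]) &
    coef z.2 = rfourier gamma (nt_init gamma c0 alpha [::])].
  split; [|exact: (coef_zero_init gamma c0 alpha l).1|exact: (coef_zero_init gamma c0 alpha (l - 1)).2].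
  have := coef_u_init gamma 1 s A%:C A%:C (pf N) (pf N + kf N).
  by rewrite scale1r /scaleD /= !mul1r.
have nz : `|z| < dl.
  have nVA : normc (V%:C * A%:C : C) = V * A by rewrite normcM !normc_real !gtr0_norm.
  apply: (@le_lt_trans _ _ (K * N%:R `^ (- a))); last first.
    by rewrite powRN -/(_ / _) ltr_pdivrMr ?powR_gt0// mulrC -ltr_pdivrMr.
  have Ka0 : 0 <= K * N%:R `^ (- a) by rewrite mulr_ge0// powR_ge0.
  apply: data_norm; rewrite /z /= ?normr0//.
  apply: (le_trans (norm_pairH _ _ _ _ _ _)); rewrite nVA.
  have [_ _ hp _ hpk] := hs N N1.
  have -> : K * N%:R `^ (- a) = Cg gamma * ((Ks * N%:R `^ s) * (V * A) + (Ks * N%:R `^ s) * (V * A)).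
    rewrite /K /A (_ : - a = s + - ((l + 1) / 2)); last by rewrite /a; ring.
    by rewrite powRD ?Xn ?implybT//; ring.
  have VA : 0 < V * A by exact: mulr_gt0.
  by apply: ler_wpM2l => //; apply: lerD; rewrite ler_pM2r.
have [Uz Fz] : U z /\ `|F 0 - F z| < eta.
  by apply: hdl; rewrite -ball_normE /ball_/= sub0r normrN.
have [_ ext2] := ext; have [_ E1] := ext2 _ _ _ _ _ _ Uz sm sol cz tres tin.
have [eB _ eK] := ell_n_functional gamma T s l tres (kf N).
have [_ F0] := flow_at_0 c0_gt0 alpha_gt0 T_gt0 (kf N) U0 ext tin.
have bk : 0 < br (kf N) `^ l by rewrite powR_gt0// bracket_gt0.
have h1 : normc (rfourier gamma (fun x => n (tres, x)) (kf N)) <= Cg' gamma / br (kf N) `^ l * eta.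
  have -> : rfourier gamma (fun x => n (tres, x)) (kf N) = ell_n tres (kf N) (F z - F 0).
    by rewrite eB F0 subr0 /ell_n E1.
  apply: (le_trans (eK _)); rewrite distrC; apply: ler_wpM2l; last exact: ltW.
  by apply: divr_ge0 => //; exact: ltW.
have [hk _ _ _ _] := hl N N1.
have h2 := le_trans hn h1.
have h3 : c * eps0 ^+ 2 <= Kl * (Cg' gamma * eta).
  have -> : c * eps0 ^+ 2 = N%:R `^ l * (c * delta ^+ 2).
    rewrite /delta exprMn powR_sqr (_ : 2 * - (l / 2) = - l); last by field.
    transitivity (c * eps0 ^+ 2 * (N%:R `^ l * N%:R `^ (- l))); first by rewrite powRN_mul// mulr1.
    by ring.
  have cd : 0 <= c * delta ^+ 2 by rewrite mulr_ge0 ?sqr_ge0// ltW.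
  apply: (@le_trans _ _ (Kl * br (kf N) `^ l * (c * delta ^+ 2))); first by rewrite ler_wpM2r.
  rewrite -mulrA ler_pM2l// mulrC -ler_pdivlMr//.
  by move: h2; rewrite [Cg' gamma / _ * _]mulrAC.
move: h3; rewrite /eta.
have -> : Kl * (Cg' gamma * (c * eps0 ^+ 2 / (Kl * (Cg' gamma + 1)))) =
  c * eps0 ^+ 2 * (Cg' gamma / (Cg' gamma + 1)) by field; rewrite !gt_eqF.
move=> h4.
have : Cg' gamma / (Cg' gamma + 1) < 1 by rewrite ltr_pdivrMr//; lra.
have : 1 <= Cg' gamma / (Cg' gamma + 1) by move: h4; rewrite -{1}[c * _]mulr1 ler_pM2l.
lra.
Qed.

End IllPosed.

Theorem theorem1p2 (R : realType) (d : nat) (gamma : 'I_d -> {posnum R})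
    (lambda : R[i]) (c0 : R) (alpha beta : 'I_d -> R) (s l : R) :
  (2 <= d)%N -> lambda != 0 -> 0 < c0 ->
  (forall j, 0 < alpha j) -> (exists j, beta j != 0) ->
  (Num.min (2 * s - 1) (s + 1) < l) || (l < Num.max 0 (s - 2)) ->
  (forall T, 0 < T -> ~ flow_extends_C2 gamma lambda c0 alpha beta T s l) /\
  (d = 2%N -> s < 3 / 2 -> 0 <= l -> 2 * s - 1 < l ->
    ill_posed gamma lambda c0 alpha beta s l).
Proof.
move=> d2 la0 c0_gt0 alpha_gt0 [j1 b1] hl.
have [j2 j12] : exists j2, j1 != j2.
  have d1 : (0 < d)%N by exact: leq_trans d2.
  have [->|] := eqVneq j1 (Ordinal d1); last by exists (Ordinal d1).
  by exists (Ordinal d2).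
split=> [T T0|_ _ l0 sl T T0]; last exact: (not_continuous c0_gt0 alpha_gt0 T0 j12 b1 l0 sl).
move: hl; rewrite gt_min lt_max -!orbA => /or4P[] h.
- exact: (not_C2_l_large c0_gt0 alpha_gt0 T0 j12 b1 h).
- exact: (not_C2_l_gt c0_gt0 alpha_gt0 T0 j12 b1 h).
- exact: (not_C2_l_neg c0_gt0 alpha_gt0 T0 j12 la0 h).
- exact: (not_C2_s_large c0_gt0 alpha_gt0 T0 j12 la0 h).
Qed.
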